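(* Let $U\cong\mathbb R^2$ be a Euclidean plane with scalar product $\langle\cdot,\cdot\rangle$ and let $\Omega\subset U$ be a convex compact set with $0\in\operatorname{int}\Omega$. For initial data $q_0=(x_0,y_0)\in U\oplus U$ consider the optimal control problem $$J(x)=\tfrac12\int_0^{+\infty}\langle x(t),x(t)\rangle\,dt\to\inf,\qquad \ddot x=u(t),\ u(t)\in\Omega \text{ measurable},\qquad x(0)=x_0,\ \dot x(0)=y_0 .$$ Then for every $q_0=(x_0,y_0)$: 1. There exists a unique optimal trajectory $\hat q(t,q_0)=(\hat x(t,q_0),\hat y(t,q_0))$ (with $\hat y=\dot{\hat x}$) of this problem, and the adjoint function $\hat p(t,q_0)=(\hat\phi(t,q_0),\hat\psi(t,q_0))$ along it is also unique, i.e. there is exactly one pair of absolutely continuous functions $(\phi,\psi)$ on $[0,\infty)$ such that $\dot\psi=-\phi$, $\dot\phi=\hat x$, and $\langle\psi(t),\hat u(t)\rangle=\max_{u\in\Omega}\langle\psi(t),u\rangle$ for a.e. $t$, where $\hat u=\ddot{\hat x}$ is the optimal control. 2. There exists $T(q_0)\ge0$ such that $\hat q(t,q_0)=0$ and $\hat p(t,q_0)=0$ for all $t\ge T(q_0)$, while $\hat q(t,q_0)\neq0$ and $\hat p(t,q_0)\ne0$ for $t<T(q_0)$. The function $T(\cdot)$ is continuous and there are constants $C_1,C_2>0$ with $$C_1\max\{\sqrt{|x_0|},|y_0|\}\le T(q_0)\le C_2\max\{\sqrt{|x_0|},|y_0|\}.$$ 3. The map $E:q_0\mapsto \hat p(0,q_0)=(\phi_0,\psi_0)$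 from $U\oplus U$ to $U\oplus U$ is locally Lipschitz and bijective, and there are constants $C_3,C_4>0$ with $$C_3\max\{\sqrt{|x_0|},|y_0|\}\le \max\{\sqrt[3]{|\phi_0|},\sqrt[4]{|\psi_0|}\}\le C_4\max\{\sqrt{|x_0|},|y_0|\}.$$
   Context: The adjoint function is the one given by the Pontryagin maximum principle in normal form ($\lambda_0=1$): with Pontryagin function $\mathcal H=-\tfrac12\langle x,x\rangle+\langle\phi,y\rangle+\langle\psi,u\rangle$, the extremals satisfy $\dot\psi=-\phi$, $\dot\phi=x$, $\dot x=y$, $\dot y=u$, $\langle\psi,u\rangle\to\max_{u\in\Omega}$. *)

(* Defs.v *)
From HB Require Import structures.
From mathcomp Require Import all_boot all_order all_algebra.
From mathcomp Require Import all_classical all_reals all_analysis.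
Set Implicit Arguments. Unset Strict Implicit. Unset Printing Implicit Defensive.
Import Order.TTheory GRing.Theory Num.Theory.
Import numFieldNormedType.Exports.
Local Open Scope classical_set_scope.
Local Open Scope ring_scope.

Section Defs.
Variable R : realType.
Local Notation U := (R * R)%type.

Definition vzero : U := (0, 0).
Definition vadd (a b : U) : U := (a.1 + b.1, a.2 + b.2).
Definition vscale (l : R) (a : U) : U := (l * a.1, l * a.2).
Definition dot (a b : U) : R := a.1 * b.1 + a.2 * b.2.
Definition enorm (a : U) : R := Num.sqrt (dot a a).
Definition enorm2 (q : U * U) : R := Num.sqrt (dot q.1 q.1 + dot q.2 q.2).

Definition vint (f : R -> U) (t : R) : U :=
  (Rintegral lebesgue_measure `[0, t] (fun s => (f s).1),
   Rintegral lebesgue_measure `[0, t] (fun s => (f s).2)).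

(* admissible triple (x, y = x', u = x'') on [0,+oo) with x(0)=x0, x'(0)=y0,
   u measurable with values in O; the dynamics x' = y, y' = u are in the
   usual (Caratheodory) integral form *)
Definition admissible (O : set U) (x0 y0 : U) (x y u : R -> U) : Prop :=
  [/\ measurable_fun (`[0, +oo[ : set R) (fun t => (u t).1),
      measurable_fun (`[0, +oo[ : set R) (fun t => (u t).2),
      (forall t, 0 <= t -> O (u t)),
      (forall t, 0 <= t -> x t = vadd x0 (vint y t)) &
      (forall t, 0 <= t -> y t = vadd y0 (vint u t))].

Definition cost (x : R -> U) : \bar R :=
  (2^-1)%:E * \int[lebesgue_measure]_(t in (`[0%R, +oo[ : set R)) (dot (x t) (x t))%:E.

Definition optimal (O : set U) (x0 y0 : U) (x y u : R -> U) : Prop :=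
  admissible O x0 y0 x y u /\
  forall x' y' u', admissible O x0 y0 x' y' u' -> (cost x <= cost x')%E.

(* adjoint (phi, psi) along (x, u): locally absolutely continuous on [0,+oo)
   with psi' = -phi, phi' = x (integral form), and the maximum condition
   <psi(t), u(t)> = max_{v in O} <psi(t), v> for a.e. t >= 0 *)
Definition adjoint (O : set U) (x u phi psi : R -> U) : Prop :=
  [/\ (forall t, 0 <= t -> phi t = vadd (phi 0) (vint x t)),
      (forall t, 0 <= t -> psi t = vadd (psi 0) (vscale (-1) (vint phi t))) &
      {ae lebesgue_measure, forall t, 0 <= t ->
          forall v, O v -> dot (psi t) v <= dot (psi t) (u t)}].

Definition qsub (a b : U * U) : U * U :=
  (vadd a.1 (vscale (-1) b.1), vadd a.2 (vscale (-1) b.2)).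

Definition locally_lipschitz (E : U * U -> U * U) : Prop :=
  forall q, exists r L : R, 0 < r /\
    forall a b, enorm2 (qsub a q) < r -> enorm2 (qsub b q) < r ->
      enorm2 (qsub (E a) (E b)) <= L * enorm2 (qsub a b).
End Defs.

(* Main.v *)
(* Write m(q) = max(sqrt |x|, |y|).  Two estimates drive everything: an energy
   lower bound, c m(q(s))^5 <= int_s^(s + d m(q(s))) |x|^2 along every motion with
   bounded acceleration, and a steering construction that reaches 0 from q within
   the control set at cost at most K m(q)^5.

   Admissible trajectories from q0 form a convex set, so by the parallelogram
   identity the x-parts of a minimising sequence are Cauchy in L^2; the lower
   bound, applied to differences, turns this into uniform convergence of (x, y),
   and separation puts the derivative of the limiting y in the control set.  The
   same identity gives uniqueness.  If W is the remaining energy of an optimal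
   trajectory, then W(s) <= K m(q(s))^5 while W drops by c m(q(s))^5 within time
   d m(q(s)), so W^(1/5) decreases at a definite rate and vanishes in finite time.

   The adjoint variables are obtained by integrating x backwards from the rest
   time; the maximum condition follows by replacing the control with a constant
   on the set where the condition fails and then steering to 0.  Integrating the
   derivative <psi, u> + <x, x> of <psi, y> + <phi, x> shows that -2 E(q) is a
   subgradient at q of the value function, with remainder |x_p - x_q|^2 in L^2.
   Hence the L^2 distance of two optimal trajectories is controlled by
   <E(p) - E(q), q - p>, which yields the Lipschitz bound, injectivity, and
   continuity of T; surjectivity comes from minimising value(q) + 2 <p, q>. *)

Require Import Defs.
From HB Require Import structures.
From mathcomp Require Import all_boot all_order all_algebra.
From mathcomp Require Import all_classical all_reals all_analysis.
From mathcomp Require Import measurable_realfun ring lra.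
Set Implicit Arguments.
Unset Strict Implicit.
Unset Printing Implicit Defensive.
Import Order.TTheory GRing.Theory Num.Theory.
Import numFieldNormedType.Exports.
Local Open Scope classical_set_scope.
Local Open Scope ring_scope.

(** All exponents come from one scaling: replacing x, y, t, u by l^2 x, l y, l t, u preserves the
    dynamics and the control set and multiplies the cost by l^5, while phi and psi scale like l^3
    and l^4. Since m has degree one, every estimate is determined up to its constant.

    Nothing is used about the form of the optimal control, whose switchings can accumulate at the
    rest time; all arguments compare energies.

    The adjoint system carries no condition at infinity. The terminal values come from rest itself:
    once x and y vanish for good, the maximum condition and the interiority of 0 in the control set
    force phi and psi to vanish too. Thus phi and psi are iterated integrals of x over a bounded
    time, and the square of |E(p) - E(q)| is at most a constant times the squared L^2 distance of
    x_p and x_q. That distance is bounded by |E(p) - E(q)| |p - q|, so one factor cancels, and this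
    is the Lipschitz bound. *)

(** * Integrals and primitives of locally bounded measurable functions *)

Section Integral.
Variable R : realType.
Notation mu := (@lebesgue_measure R).
Implicit Types f g F G : R -> R.

Definition itg f (a b : R) : R := Rintegral mu `[a, b] f.

(** Controls, and all functions built from them, stay in this class. It is closed under products and
    under taking primitives, so integrability on bounded intervals is automatic. *)
Definition lbm f : Prop :=
  measurable_fun (`[0, +oo[ : set R) f /\
  forall b, exists M, forall s, 0 <= s <= b -> `|f s| <= M.

(** The Caratheodory form of [F' = f] on the half-line; nothing is said about negative times. *)
Definition prim F f : Prop := forall t, 0 <= t -> F t = F 0 + itg f 0 t.

Lemma lbmD f g : lbm f -> lbm g -> lbm (fun t => f t + g t).
Proof.
move=> [mf bf] [mg bg]; split; first exact: measurable_funD.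
move=> b; have [M1 h1] := bf b; have [M2 h2] := bg b; exists (M1 + M2) => s sb.
by rewrite (le_trans (ler_normD _ _)) // lerD ?h1 ?h2.
Qed.

Lemma lbmM f g : lbm f -> lbm g -> lbm (fun t => f t * g t).
Proof.
move=> [mf bf] [mg bg]; split; first exact: measurable_funM.
move=> b; have [M1 h1] := bf b; have [M2 h2] := bg b; exists (M1 * M2) => s sb.
by rewrite normrM ler_pM ?h1 ?h2.
Qed.

Lemma lbm_cst k : lbm (fun=> k).
Proof. by split; [exact: measurable_cst | move=> b; exists `|k|]. Qed.

Lemma lbmZ k f : lbm f -> lbm (fun t => k * f t).
Proof. by move=> lf; apply: lbmM lf; exact: lbm_cst. Qed.

Lemma lbmN f : lbm f -> lbm (fun t => - f t).
Proof.
move=> [mf bf]; split; first exact: measurableT_comp mf.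
by move=> b; have [M h] := bf b; exists M => s sb; rewrite normrN h.
Qed.

Lemma lbmB f g : lbm f -> lbm g -> lbm (fun t => f t - g t).
Proof. by move=> lf lg; apply: lbmD lf _; exact: lbmN. Qed.

Lemma lbm_integrable f a b : lbm f -> 0 <= a -> mu.-integrable `[a, b] (EFin \o f).
Proof.
move=> [mf bf] a0; apply: measurable_bounded_integrable => //.
- rewrite [X in (X < _)%E](lebesgue_measure_itv `[a, b]) /=.
  by case: ifP => _; rewrite ltry.
- apply: measurable_funS mf => //.
  by move=> x /=; rewrite !in_itv /= => /andP[ax _]; rewrite (le_trans a0 ax).
- have [M h] := bf b; exists M; split; first exact: num_real.
  move=> x Mx s /=; rewrite in_itv /= => /andP[as_ sb].
  by rewrite (le_trans (h s _)) ?(ltW Mx) // (le_trans a0 as_).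
Qed.

Lemma itgE f b : Rintegral mu `[0, b] f = itg f 0 b. Proof. by []. Qed.

Lemma itgxx f a : itg f a a = 0.
Proof. by rewrite /itg set_itv1 Rintegral_set1. Qed.

Lemma itg_cst k a b : a <= b -> itg (fun=> k) a b = k * (b - a).
Proof.
move=> ab; rewrite /itg Rintegral_cst //.
rewrite [X in fine X](lebesgue_measure_itv `[a, b]) /= lte_fin.
by move: ab; rewrite le_eqVlt => /predU1P[->|->] //; rewrite ltxx subrr.
Qed.

Lemma itg0 a b : itg (fun=> 0) a b = 0.
Proof. by rewrite /itg Rintegral_cst // mul0r. Qed.

Lemma eq_itg f g a b : (forall t, a <= t <= b -> f t = g t) ->
  itg f a b = itg g a b.
Proof.
by move=> fg; apply: eq_Rintegral => t; rewrite inE /= in_itv /=; exact: fg.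
Qed.

Lemma itgD f g a b : lbm f -> lbm g -> 0 <= a ->
  itg (fun t => f t + g t) a b = itg f a b + itg g a b.
Proof. by move=> lf lg a0; rewrite /itg RintegralD //; exact: lbm_integrable. Qed.

Lemma itgB f g a b : lbm f -> lbm g -> 0 <= a ->
  itg (fun t => f t - g t) a b = itg f a b - itg g a b.
Proof. by move=> lf lg a0; rewrite /itg RintegralB //; exact: lbm_integrable. Qed.

Lemma itgZ k f a b : lbm f -> 0 <= a ->
  itg (fun t => k * f t) a b = k * itg f a b.
Proof. by move=> lf a0; rewrite /itg RintegralZl //; exact: lbm_integrable. Qed.

Lemma itgN f a b : lbm f -> 0 <= a -> itg (fun t => - f t) a b = - itg f a b.
Proof.
move=> lf a0; rewrite -mulN1r -itgZ //.
by apply: eq_itg => t _; rewrite mulN1r.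
Qed.

Lemma le_itg f g a b : lbm f -> lbm g -> 0 <= a ->
  (forall t, a <= t <= b -> f t <= g t) -> itg f a b <= itg g a b.
Proof.
move=> lf lg a0 fg; apply: le_Rintegral => //; exact: lbm_integrable.
Qed.

Lemma itg_ge0 f a b : (forall t, a <= t <= b -> 0 <= f t) -> 0 <= itg f a b.
Proof. by move=> h; apply: Rintegral_ge0 => t /=; rewrite in_itv /=; exact: h. Qed.

Lemma itg_split f a b c : lbm f -> 0 <= a -> a <= b -> b <= c ->
  itg f a c = itg f a b + itg f b c.
Proof.
move=> lf a0 ab bc; have := @Rintegral_itvB _ f (BLeft a) (BRight c) b.
rewrite Rintegral_itv_obnd_cbnd.
  rewrite /itg => <- //; rewrite ?bnd_simp //; last exact: lbm_integrable.
  by rewrite addrC subrK.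
apply: integrableS (lbm_integrable c lf (le_trans a0 ab)) => //.
exact: subset_itv_oc_cc.
Qed.

Lemma itg_bound f a b M : lbm f -> 0 <= a -> a <= b ->
  (forall t, a <= t <= b -> `|f t| <= M) -> `|itg f a b| <= M * (b - a).
Proof.
move=> lf a0 ab h; rewrite ler_norml -mulNr -!itg_cst //.
apply/andP; split; apply: le_itg => //; try exact: lbm_cst.
- by move=> t /h; rewrite ler_norml => /andP[].
- by move=> t /h; rewrite ler_norml => /andP[].
Qed.

Lemma itg_sub f a a' b' b : lbm f -> 0 <= a -> a <= a' -> a' <= b' -> b' <= b ->
  (forall t, a <= t <= b -> 0 <= f t) -> itg f a' b' <= itg f a b.
Proof.
move=> lf a0 aa ab bb f0.
rewrite (@itg_split f a a' b) // ?(le_trans ab) //.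
rewrite (@itg_split f a' b' b) // ?(le_trans a0) //.
have h1 : 0 <= itg f a a'.
  by apply: itg_ge0 => t /andP[h1 h2]; apply: f0; lra.
have h2 : 0 <= itg f b' b.
  by apply: itg_ge0 => t /andP[h2 h3]; apply: f0; lra.
lra.
Qed.

(** Almost everywhere [- f] equals its absolute value, whose integral is nonnegative. *)
Lemma itg_ae_le0 f a b : lbm f -> 0 <= a ->
  {ae mu, forall t, 0 <= t -> f t <= 0} -> itg f a b <= 0.
Proof.
move=> lf a0 h; rewrite -oppr_ge0 -itgN //.
rewrite (_ : itg _ a b = itg (fun t => `|f t|) a b).
  by apply: itg_ge0 => t _.
have [mf _] := lf.
have mab : measurable_fun (`[a, b] : set R) f.
  apply: measurable_funS mf => //.
  by move=> x /=; rewrite !in_itv /= => /andP[ax _]; rewrite (le_trans a0 ax).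
congr fine; apply: ae_eq_integral => //.
- by apply/measurable_EFinP; apply: measurableT_comp mab.
- by apply/measurable_EFinP; apply: measurableT_comp mab.
- apply: (@filterS _ _ (ae_filter_ringOfSetsType mu) _ _ _ h) => {h} t h; rewrite /= in_itv /= => /andP[at_ _].
  by rewrite ler0_norm // h // (le_trans a0).
Qed.

Lemma prim_itg F f a b : prim F f -> lbm f -> 0 <= a -> a <= b ->
  F b - F a = itg f a b.
Proof.
move=> pF lf a0 ab; rewrite (pF a) // (pF b) ?(le_trans a0) //.
rewrite (@itg_split f 0 a b) //; lra.
Qed.

Lemma prim_lip F f a b M : prim F f -> lbm f -> 0 <= a -> a <= b ->
  (forall t, a <= t <= b -> `|f t| <= M) -> `|F b - F a| <= M * (b - a).
Proof. by move=> pF lf a0 ab h; rewrite (prim_itg pF) // itg_bound. Qed.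

Lemma prim_ge F f a b k : prim F f -> lbm f -> 0 <= a -> a <= b ->
  (forall t, a <= t <= b -> k <= f t) -> k * (b - a) <= F b - F a.
Proof.
move=> pF lf a0 ab h; rewrite (prim_itg pF) // -itg_cst //.
by apply: le_itg => //; exact: lbm_cst.
Qed.

Lemma primD F f G g : prim F f -> prim G g -> lbm f -> lbm g ->
  prim (fun t => F t + G t) (fun t => f t + g t).
Proof. by move=> pF pG lf lg t t0; rewrite itgD // (pF t) // (pG t) //; ring. Qed.

Lemma primB F f G g : prim F f -> prim G g -> lbm f -> lbm g ->
  prim (fun t => F t - G t) (fun t => f t - g t).
Proof. by move=> pF pG lf lg t t0; rewrite itgB // (pF t) // (pG t) //; ring. Qed.

Lemma primZ k F f : prim F f -> lbm f -> prim (fun t => k * F t) (fun t => k * f t).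
Proof. by move=> pF lf t t0; rewrite itgZ // (pF t) //; ring. Qed.

Lemma primN F f : prim F f -> lbm f -> prim (fun t => - F t) (fun t => - f t).
Proof. by move=> pF lf t t0; rewrite itgN // (pF t) //; ring. Qed.

Lemma prim_cst k : prim (fun=> k) (fun=> 0).
Proof. by move=> t t0; rewrite itg0 addr0. Qed.

Lemma prim_ext F f F' f' : prim F f -> (forall t, 0 <= t -> F t = F' t) ->
  (forall t, 0 <= t -> f t = f' t) -> prim F' f'.
Proof.
move=> pF hF hf t t0; rewrite -!hF // (pF t) //; congr (_ + _).
by apply: eq_itg => s /andP[s0 _]; exact: hf.
Qed.

Lemma prim_of_itg f c : prim (fun t => itg f 0 t + c) f.
Proof. by move=> t t0; rewrite itgxx; ring. Qed.

Lemma lbm_lip F L : 0 <= L ->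
  (forall a b, 0 <= a -> a <= b -> `|F b - F a| <= L * (b - a)) -> lbm F.
Proof.
move=> L0 h; split; last first.
  move=> b; exists (`|F 0| + L * b) => s /andP[s0 sb].
  have := h 0 s (lexx _) s0; rewrite subr0 => h1.
  rewrite -[F s](subrK (F 0)) (le_trans (ler_normD _ _)) // addrC lerD2l.
  by rewrite (le_trans h1) // ler_wpM2l.
(* Nothing is known of [F] at negative times; freezing it at [F 0] there gives a Lipschitz, hence
   measurable, function on the whole line. *)
pose G t := F (Num.max t 0).
have GL s t : `|G t - G s| <= L * `|t - s|.
  wlog st : s t / s <= t.
    move=> H; have [st|/ltW st] := leP s t; first exact: H.
    by rewrite distrC (distrC t); exact: H.
  rewrite /G (ger0_norm (_ : 0 <= t - s)) ?subr_ge0 //.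
  apply: le_trans (h _ _ _ _) _.
  - by rewrite le_max lexx orbT.
  - by rewrite ge_max !le_max st lexx orbT.
  - apply: ler_wpM2l => //; rewrite /Num.max; case: ltP => h1; case: ltP => h2; lra.
have cG : continuous G.
  move=> x; apply/cvgrPdist_lt => e e0; near=> t.
  apply: le_lt_trans (GL _ _) _.
  have : `|x - t| < e / (L + 1).
    near: t; apply/nbhs_ballP; exists (e / (L + 1)) => //=.
    by rewrite divr_gt0 // ltr_wpDl.
  rewrite ltr_pdivlMr ?ltr_wpDl // mulrDr mulr1 => h1.
  rewrite mulrC (le_lt_trans _ h1) // lerDl.
  exact: normr_ge0.
apply: eq_measurable_fun (measurable_funTS (continuous_measurable_fun cG)).
move=> t; rewrite inE /= in_itv /= andbT => t0.
by rewrite /G max_l.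
Unshelve. all: by end_near. Qed.

(** As [f] is only locally bounded, [F] is Lipschitz only on bounded intervals. Freezing [F] after
    time [n] makes it globally Lipschitz, and the half-line is the union of the intervals
    [[0, n]]. *)
Lemma lbm_prim F f : prim F f -> lbm f -> lbm F.
Proof.
move=> pF lf.
split; last first.
  move=> b; have [b0|b0] := leP 0 b; last first.
    by exists 0 => s /andP[s0 sb]; lra.
  have [M h] := lf.2 b; exists (`|F 0| + M * b) => s /andP[s0 sb].
  have M0 : 0 <= M by rewrite (le_trans (normr_ge0 _) (h 0 _)) // lexx.
  have h1 : `|F s - F 0| <= M * (s - 0).
    apply: (prim_lip pF) => // t /andP[t0 ts]; apply: h; lra.
  rewrite -[F s](subrK (F 0)) (le_trans (ler_normD _ _)) // addrC lerD2l.
  by rewrite (le_trans h1) // ler_wpM2l // subr0.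
have E : (`[0, +oo[%classic : set R) = \bigcup_n `[0, n%:R]%classic.
  apply/seteqP; split => t /=.
    rewrite in_itv /= andbT => t0; exists (Num.truncn t).+1 => //=.
    by rewrite in_itv /= t0 ltW // truncnS_gt.
  by move=> [n _] /=; rewrite !in_itv /= andbT => /andP[].
rewrite E; apply/measurable_fun_bigcup => // n.
have [M h] := lf.2 n%:R.
have n0 : 0 <= n%:R :> R by exact: ler0n.
have M0 : 0 <= M by rewrite (le_trans (normr_ge0 _) (h 0 _)) // lexx.
have [mG _] : lbm (fun t => F (Num.min t n%:R)).
  apply: (@lbm_lip _ M) => // a b a0 ab.
  have h1 : Num.min a n%:R <= Num.min b n%:R.
    by rewrite /Num.min; case: ltP => h1; case: ltP => h2; lra.
  apply: le_trans (prim_lip pF lf _ h1 (M := M) _) _.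
  - by rewrite le_min a0.
  - move=> t /andP[h2 h3]; apply: h; rewrite (le_trans _ h2) ?le_min ?a0 //=.
    by move: h3; rewrite le_min => /andP[].
  - apply: ler_wpM2l => //.
    by rewrite /Num.min; case: ltP => h2; case: ltP => h3; lra.
have mn : measurable_fun (`[0, n%:R]%classic : set R) (fun t => F (Num.min t n%:R)).
  by apply: measurable_funS mG => // t /=; rewrite !in_itv /= andbT => /andP[].
apply: eq_measurable_fun mn => t; rewrite inE /= in_itv /= => /andP[t0 tn].
by rewrite min_l.
Qed.

End Integral.

(** * Product rule, Cauchy-Schwarz, gluing, and improper integrals *)

Section Calculus.
Variable R : realType.
Notation mu := (@lebesgue_measure R).
Implicit Types f g F G : R -> R.

(** Over a partition into [n + 1] equal steps the increments add up to at most [C S^2 / (n + 1)],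
    which is arbitrarily small. *)
Lemma quad_const (H : R -> R) (C S : R) : 0 <= S ->
  (forall a b : R, 0 <= a -> a <= b -> b <= S -> `|H b - H a| <= C * (b - a) ^+ 2) ->
  H S = H 0.
Proof.
move=> S0 h.
have step n k : (k <= n.+1)%N ->
    `|H (k%:R * (S / n.+1%:R)) - H 0| <= k%:R * (C * (S / n.+1%:R) ^+ 2).
  set d := S / n.+1%:R.
  have d0 : 0 <= d by rewrite divr_ge0.
  have dS : n.+1%:R * d = S by rewrite /d mulrC divfK // pnatr_eq0.
  elim: k => [_|k IH kn]; first by rewrite !mul0r subrr normr0.
  have h1 := IH (ltnW kn).
  have h2 : `|H (k.+1%:R * d) - H (k%:R * d)| <= C * (k.+1%:R * d - k%:R * d) ^+ 2.
    apply: h.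
    - by rewrite mulr_ge0.
    - by rewrite ler_wpM2r // ler_nat.
    - by rewrite -dS ler_wpM2r // ler_nat.
  rewrite -(subrK (H (k%:R * d)) (H _)) -addrA (le_trans (ler_normD _ _)) //.
  have -> : k.+1%:R * (C * d ^+ 2) = C * d ^+ 2 + k%:R * (C * d ^+ 2).
    by rewrite -natr1; ring.
  apply: lerD => //.
  have Ed : k.+1%:R * d - k%:R * d = d by rewrite -natr1; ring.
  by rewrite Ed in h2.
apply/eqP; rewrite -subr_eq0 -normr_eq0; apply/eqP/le_anti; rewrite normr_ge0 andbT.
apply/ler_addgt0Pr => e e0; rewrite add0r.
pose n := Num.truncn (`|C| * S ^+ 2 / e).
have := step n n.+1 (leqnn _).
rewrite [_ * (S / _)]mulrC divfK ?pnatr_eq0 // => h1; apply: (le_trans h1).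
have nn : `|C| * S ^+ 2 / e < n.+1%:R.
  by apply: truncnS_gt.
have n0 : 0 < n.+1%:R :> R by rewrite ltr0n.
have -> : n.+1%:R * (C * (S / n.+1%:R) ^+ 2) = C * S ^+ 2 / n.+1%:R.
  by move: n0; set N := n.+1%:R => n0; field; exact: lt0r_neq0.
rewrite ler_pdivrMr //; move: nn; rewrite ltr_pdivrMr // => nn.
rewrite [leRHS]mulrC (le_trans _ (ltW nn)) // ler_wpM2r ?sqr_ge0 //.
exact: ler_norm.
Qed.

(** The defect between the product and its expected primitive grows over [[a, b]] by the integral of
    [f t * (G b - G t) - (F t - F a) * g t]. This is of order [(b - a)^2] because [F] and [G] are
    Lipschitz on bounded intervals, so [quad_const] applies and no differentiation is involved. *)
Lemma primM F f G g : prim F f -> prim G g -> lbm f -> lbm g ->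
  prim (fun t => F t * G t) (fun t => f t * G t + F t * g t).
Proof.
move=> pF pG lf lg S S0.
have lF := lbm_prim pF lf; have lG := lbm_prim pG lg.
have l1 := lbmD (lbmM lf lG) (lbmM lF lg).
have [Mf hf] := lf.2 S; have [Mg hg] := lg.2 S.
pose H s := F s * G s - itg (fun t => f t * G t + F t * g t) 0 s.
suff : H S = H 0 by rewrite /H itgxx; lra.
apply: (@quad_const H (2 * Mf * Mg)) => // a b a0 ab bS.
have Mf0 : 0 <= Mf by apply: le_trans (normr_ge0 _) (hf a _); lra.
have Mg0 : 0 <= Mg by apply: le_trans (normr_ge0 _) (hg a _); lra.
have l2 := lbmD (lbmZ (G b) lf) (lbmZ (F a) lg).
have -> : H b - H a =
    itg (fun s => (G b * f s + F a * g s) - (f s * G s + F s * g s)) a b.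
  have E1 : itg (fun s => G b * f s + F a * g s) a b =
      G b * (F b - F a) + F a * (G b - G a).
    rewrite (prim_itg pF) // (prim_itg pG) // -!itgZ // -itgD //; exact: lbmZ.
  by rewrite itgB // E1 /H (itg_split l1 (lexx _) a0 ab); ring.
rewrite expr2 mulrA; apply: itg_bound => //; first exact: lbmB.
move=> t /andP[ta tb].
have -> : G b * f t + F a * g t - (f t * G t + F t * g t) =
  f t * (G b - G t) - (F t - F a) * g t by ring.
have t0 := le_trans a0 ta.
have e1 : `|G b - G t| <= Mg * (b - a).
  apply: (le_trans (prim_lip pG lg t0 tb (M := Mg) _)).
    by move=> s /andP[h1 h2]; apply: hg; lra.
  by apply: ler_wpM2l => //; lra.
have e2 : `|F t - F a| <= Mf * (b - a).
  apply: (le_trans (prim_lip pF lf a0 ta (M := Mf) _)).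
    by move=> s /andP[h1 h2]; apply: hf; lra.
  by apply: ler_wpM2l => //; lra.
apply: (le_trans (ler_normB _ _)); rewrite !normrM.
have e3 : `|f t| <= Mf by apply: hf; lra.
have e4 : `|g t| <= Mg by apply: hg; lra.
have -> : 2 * Mf * Mg * (b - a) = Mf * (Mg * (b - a)) + (Mf * (b - a)) * Mg by ring.
by apply: lerD; apply: ler_pM.
Qed.

(** The integral of [(f - k)^2] is nonnegative, where [k] is the mean of [f]. *)
Lemma itg_CS f a b : lbm f -> 0 <= a -> a <= b ->
  (itg f a b) ^+ 2 <= (b - a) * itg (fun t => f t ^+ 2) a b.
Proof.
move=> lf a0; rewrite le_eqVlt => /predU1P[<-|ab].
  by rewrite !itgxx subrr mul0r expr0n.
have ba : 0 < b - a by rewrite subr_gt0.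
set I := itg f a b; pose k := I / (b - a).
have lf2 : lbm (fun t => f t ^+ 2) by exact: (lbmM lf lf).
have : 0 <= itg (fun t => (f t - k) ^+ 2) a b.
  by apply: itg_ge0 => t _; rewrite sqr_ge0.
rewrite (@eq_itg _ _ (fun t => f t ^+ 2 + (- (2 * k) * f t + k ^+ 2))); last first.
  by move=> t _; ring.
have lz := lbmZ (- (2 * k)) lf.
have lk := lbm_cst (k ^+ 2).
rewrite itgD //; last exact: lbmD.
rewrite itgD // itgZ // itg_cst; last exact: ltW.
rewrite -/I => h.
have kb : k * (b - a) = I by rewrite /k; field; exact: lt0r_neq0.
rewrite -subr_ge0; apply: le_trans (mulr_ge0 (ltW ba) h) _.
by rewrite le_eqVlt; apply/orP; left; apply/eqP; rewrite -kb; ring.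
Qed.

Definition glue (T : Type) (a : R) (f g : R -> T) (t : R) : T :=
  if t < a then f t else g t.

Lemma lbm_if (A : set R) f g : measurable A -> lbm f -> lbm g ->
  lbm (fun t => if t \in A then f t else g t).
Proof.
move=> mA lf lg.
have l1 : lbm (\1_A : R -> R).
  split; first exact: measurable_indic.
  move=> b; exists 1 => s _; rewrite indicE.
  by case: (s \in A); rewrite ?normr1 ?normr0.
have E : (fun t => f t * \1_A t + g t * (1 - \1_A t)) =
    (fun t => if t \in A then f t else g t).
  by apply/funext => t; rewrite indicE; case: (t \in A) => /=; ring.
rewrite -E; apply: lbmD; apply: lbmM => //.
by apply: lbmB => //; exact: lbm_cst.
Qed.

Lemma lbm_glue a f g : lbm f -> lbm g -> lbm (glue a f g).
Proof.
move=> lf lg; rewrite (_ : glue a f g = fun t => if t \in `]-oo, a[%classic then f t else g t).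
  by apply: lbm_if => //; exact: measurable_itv.
by apply/funext => t; rewrite mem_setE in_itv.
Qed.

Lemma eq_itg_co f g a b : lbm f -> lbm g -> 0 <= a ->
  (forall t, a <= t < b -> f t = g t) -> itg f a b = itg g a b.
Proof.
move=> lf lg a0 fg; rewrite /itg -!Rintegral_itv_bndo_bndc.
- by apply: eq_Rintegral => t; rewrite inE /= in_itv /=; exact: fg.
- by apply: integrableS (lbm_integrable b lg a0) => //; exact: subset_itv_co_cc.
- by apply: integrableS (lbm_integrable b lf a0) => //; exact: subset_itv_co_cc.
Qed.

Lemma prim_glue a F f G g : 0 <= a -> prim F f -> prim G g -> lbm f -> lbm g ->
  F a = G a -> prim (glue a F G) (glue a f g).
Proof.
move=> a0 pF pG lf lg FG t t0.
have lgl := lbm_glue a lf lg.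
have F0 : glue a F G 0 = F 0.
  rewrite /glue; case: ltP => // a0'.
  by have -> : 0 = a by apply/le_anti; rewrite a0 a0'.
rewrite F0 {1}/glue; case: ltP => ta.
  rewrite (pF t) //; congr (_ + _); apply: eq_itg => s /andP[_ st].
  by rewrite /glue (le_lt_trans st ta).
rewrite (@itg_split _ _ 0 a t) //.
rewrite (@eq_itg_co (glue a f g) f 0 a) //; last first.
  by move=> s /andP[_ sa]; rewrite /glue sa.
rewrite (@eq_itg _ (glue a f g) g a t); last first.
  by move=> s /andP[sa _]; rewrite /glue ltNge sa.
rewrite -(prim_itg pF) // -(prim_itg pG) // FG; ring.
Qed.

(** This is the passage between the improper integral defining the cost and integrals over bounded
    intervals. From right to left it is monotone convergence along [[0, n]]. *)
Lemma itg_ybound f (c : R) : lbm f -> (forall t, 0 <= f t) ->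
  (\int[mu]_(t in (`[0%R, +oo[ : set R)) (f t)%:E <= c%:E)%E <->
  (forall t, 0 <= t -> itg f 0 t <= c).
Proof.
move=> lf f0; have [mf _] := lf.
have mE : measurable_fun (`[0%R, +oo[ : set R) (EFin \o f) by exact/measurable_EFinP.
have fin t : ((itg f 0 t)%:E = \int[mu]_(s in `[0%R, t]) (f s)%:E)%E.
  rewrite /itg /Rintegral fineK //.
  by apply: integrable_fin_num => //; exact: lbm_integrable.
split=> [h t t0|h].
  rewrite -lee_fin fin; apply: le_trans h.
  apply: ge0_subset_integral => //.
  - by move=> x _; rewrite lee_fin.
  - by move=> x /=; rewrite !in_itv /= andbT => /andP[].
have E : (`[0, +oo[%classic : set R) = \bigcup_n `[0, n%:R]%classic.
  apply/seteqP; split => t /=.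
    rewrite in_itv /= andbT => t0; exists (Num.truncn t).+1 => //=.
    by rewrite in_itv /= t0 ltW // truncnS_gt.
  by move=> [n _] /=; rewrite !in_itv /= andbT => /andP[].
rewrite E.
pose J n : set R := `[0, n%:R]%classic.
have cJ : (\int[mu]_(x in J n) (EFin \o f) x @[n --> \oo] -->
    \int[mu]_(x in \bigcup_n J n) (EFin \o f) x)%E.
  apply: ge0_nondecreasing_set_cvg_integral.
  - move=> m n mn; apply/subsetPset => x; rewrite /J /= !in_itv /= => /andP[-> xm] /=.
    by rewrite (le_trans xm) // ler_nat.
  - by move=> i; exact: measurable_itv.
  - move=> i; apply: measurable_funS mE => // x.
    by rewrite /J /= !in_itv /= andbT => /andP[].
  - by move=> i x _; rewrite lee_fin.
rewrite -(cvg_lim _ cJ) //; apply: lime_le; first by apply/cvg_ex; eexists; exact: cJ.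
by apply: nearW => n; rewrite -[X in (X <= _)%E]fin lee_fin; exact: h.
Qed.

End Calculus.

(** * Lipschitz functions are primitives of their almost everywhere derivative *)

Section LipschitzPrimitive.
Variable R : realType.
Notation mu := (@lebesgue_measure R).
Implicit Types f g F G : R -> R.

Lemma stieltjes_oc (c : cumulative R R) (a b : R) : a <= b ->
  lebesgue_stieltjes_measure c `]a, b] = (c b - c a)%:E.
Proof.
move=> ab; rewrite /lebesgue_stieltjes_measure /measure_extension/=.
rewrite measurable_mu_extE/=; last exact: is_ocitv.
exact: wlength_itv_bnd.
Qed.

(* The Stieltjes measures of [F] and [id - F] add up to Lebesgue measure, so the
   first one is absolutely continuous and has a Radon-Nikodym density. *)
Lemma ac_slope01 F (S : R) : (forall s t : R, s <= t -> 0 <= F t - F s <= t - s) ->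
  exists g : R -> R, mu.-integrable setT (EFin \o g) /\
    forall t : R, 0 <= t <= S -> F t - F 0 = itg g 0 t.
Proof.
move=> h.
have cont (K : R -> R) : (forall s t : R, s <= t -> 0 <= K t - K s <= t - s) ->
    {homo K : x y / x <= y} /\ right_continuous K.
  move=> hK; split; first by move=> x y /hK /andP[]; rewrite subr_ge0.
  apply: right_continuousW => x; apply/cvgrPdist_lt => e e0; near=> t.
  have xt : `|x - t| < e by near: t; apply/nbhs_ballP; exists e.
  have [le|/ltW le] := leP x t.
    rewrite distrC ger0_norm; last by have /andP[] := hK _ _ le.
    have /andP[_ h2] := hK _ _ le; apply: le_lt_trans h2 _.
    by rewrite distrC in xt; exact: le_lt_trans (ler_norm _) xt.
  rewrite ger0_norm; last by have /andP[] := hK _ _ le.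
  have /andP[_ h2] := hK _ _ le; apply: le_lt_trans h2 _.
  exact: le_lt_trans (ler_norm _) xt.
have hG (s t : R) : s <= t -> 0 <= (t - F t) - (s - F s) <= t - s.
  by move=> /h /andP[h1 h2]; apply/andP; split; lra.
have [ndF rcF] := cont F h.
have [ndG rcG] := cont (fun t => t - F t) hG.
pose cF : cumulative R R := HB.pack F (isCumulative.Build R _ R F ndF rcF).
pose cG : cumulative R R :=
  HB.pack (fun t => t - F t) (isCumulative.Build R _ R (fun t => t - F t) ndG rcG).
pose nF := lebesgue_stieltjes_measure cF.
pose nG := lebesgue_stieltjes_measure cG.
have E A : measurable A -> (mu A = nF A + nG A)%E.
  move=> mA; rewrite -[RHS]measure_addE.
  apply: (@lebesgue_measure_unique R (measure_add nF nG)) => // X /ocitvP[->|[[a b] /= ab ->]].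
    by rewrite !measure0.
  rewrite [RHS]measure_addE [LHS]stieltjes_oc ?ltW // [X in (X + _)%E]stieltjes_oc ?ltW //.
  rewrite [X in (_ + X)%E]stieltjes_oc ?ltW // -EFinD; congr EFin.
  by rewrite /cF /cG /=; ring.
have leF A : measurable A -> (nF A <= mu A)%E.
  by move=> mA; rewrite E // leeDl.
(* The restriction to [[0, S]] makes the measure finite, as needed for the Radon-Nikodym theorem. *)
have mD : measurable (`[0, S]%classic : set (measurableTypeR R)).
  exact: measurable_itv.
have fD : (nF `[0%R, S]%classic < +oo)%E.
  apply: le_lt_trans (leF _ mD) _.
  rewrite [X in (X < _)%E](lebesgue_measure_itv `[0, S]) /=.
  by case: ifP => _; rewrite ltry.
pose nu : {finite_measure set _ -> \bar R} := mfrestr mD fD.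
have dom : nu `<< mu.
  move=> A nA B mB BA; apply/eqP; rewrite eq_le measure_ge0 andbT.
  have h1 : (nu B <= nF B)%E.
    by apply: le_measure; rewrite ?inE //; exact: measurableI.
  by rewrite (le_trans h1) // (le_trans (leF _ mB)) // nA.
have [g0 [g0p g0f g0i g0E]] := radon_nikodym_sigma_finite dom.
have gE : EFin \o (fine \o g0) = g0.
  by apply/funext => t /=; rewrite fineK.
exists (fine \o g0); split; first by rewrite gE.
move=> t /andP[t0 tS]; rewrite /itg -Rintegral_itv_obnd_cbnd; last first.
  by rewrite gE; apply: integrableS g0i.
rewrite /Rintegral; under eq_integral do rewrite -[(_%:E)]/((EFin \o (fine \o g0)) _) gE.
rewrite -g0E; last exact: measurable_itv.
have -> : nu `]0, t]%classic = nF `]0, t]%classic.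
  rewrite /nu /= /mfrestr /mrestr setIidl //.
  by move=> x /=; rewrite !in_itv /= => /andP[x0 xt]; rewrite ltW //= (le_trans xt).
by rewrite /nF stieltjes_oc.
Unshelve. all: by end_near. Qed.

Lemma is_derive_le F (t d k : R) : is_derive t 1 F d ->
  (forall e : R, 0 < e -> exists2 h, 0 < h < e & F (t + h) - F t <= k * h) -> d <= k.
Proof.
move=> [dF dE] hk; rewrite leNgt; apply/negP => kd.
have cv : (fun h : R => h^-1 *: (F (h *: (1 : R) + t) - F t)) @ 0^' --> d.
  by rewrite -dE; exact: dF.
have dk0 : 0 < d - k by rewrite subr_gt0.
move/cvgrPdist_lt : cv => /(_ _ dk0) /nbhs_ballP[e /= e0 he].
have [h /andP[h0 h1] h2] := hk e e0.
have : ball (0 : R) e h by rewrite /ball /= sub0r normrN gtr0_norm.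
move=> /he /(_ (lt0r_neq0 h0)) /=.
rewrite /GRing.scale /= mulr1 (addrC h) => h3.
have h4 : h^-1 * (F (t + h) - F t) <= k.
  by rewrite mulrC ler_pdivrMr.
move: h3; rewrite ltNge => /negP; apply.
by rewrite (le_trans _ (ler_norm _)) // lerB.
Qed.

(** Densities found for different horizons need not coincide pointwise. By Lebesgue differentiation
    each of them is the derivative of [F] almost everywhere on its horizon, so they glue into a
    single density. *)
Lemma ac_slope01_global F : (forall s t : R, s <= t -> 0 <= F t - F s <= t - s) ->
  exists f : R -> R, [/\ lbm f, forall t, 0 <= f t <= 1, prim F f &
    {ae mu, forall t : R, 0 < t -> is_derive t 1 F (f t)}].
Proof.
move=> h.
pose g n := projT1 (cid (ac_slope01 n.+1%:R h)).
have [gi gE] : (forall n, mu.-integrable setT (EFin \o g n)) /\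
   forall n (t : R), 0 <= t <= n.+1%:R -> F t - F 0 = itg (g n) 0 t.
  split=> n; rewrite /g; case: cid => /= k []; [by []|by move=> _; exact].
have dF01 (t d : R) : is_derive t 1 F d -> 0 <= d <= 1.
  move=> dF; apply/andP; split; last first.
    apply: (is_derive_le dF) => e e0; exists (e / 2); first by apply/andP; split; lra.
    by have /andP[_] := h t (t + e / 2) ltac:(lra); lra.
  rewrite -oppr_le0; apply: (@is_derive_le (fun t => - F t) t (- d) 0) => e e0.
  exists (e / 2); first by apply/andP; split; lra.
  by have /andP[] := h t (t + e / 2) ltac:(lra); lra.
have aeF n : {ae mu, forall t : R, 0 < t < n.+1%:R -> is_derive t 1 F (g n t)}.
  have loc : locally_integrable [set: R] (g n).
    have := integrable_locally measurableT (gi n).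
    by rewrite patch_setT.
  have gy y : mu.-integrable [set` Interval (BLeft (0 : R)) (BRight y)] (EFin \o g n).
    exact: integrableS (gi n).
  apply: (@filterS _ _ (ae_filter_ringOfSetsType mu) _ _ _ (FTC1 gy loc)).
  move=> t ht /andP[t0 tn].
  have [|d1 d2] := ht; first by rewrite /= lte_fin.
  have d3 : is_derive t 1 (fun x => itg (g n) 0 x + F 0) (g n t).
    rewrite -[X in is_derive _ _ _ X]addr0; apply: is_deriveD.
    by apply: DeriveDef; [exact: d1 | rewrite -derive1E; exact: d2].
  apply: near_eq_is_derive d3.
  near=> s.
  rewrite -(gE n) ?subrK //; apply/andP; split; near: s.
    exact: lt_le_nbhsr.
  exact: lt_le_nbhsl.
have ae_all := ae_foralln aeF.
(* The density of the first integer horizon beyond [t], clipped so that the bounds hold at every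
   time. Clipping has no effect where the density is the derivative of [F]. *)
pose f t := Num.max 0 (Num.min 1 (g (Num.truncn t) t)).
have f01 t : 0 <= f t <= 1.
  by rewrite /f le_max lexx /= ge_max ler01 ge_min lexx.
have mg n (A : set R) : measurable A -> measurable_fun A (g n).
  move=> mA; apply: measurable_funTS; apply/measurable_EFinP.
  exact: measurable_int (gi n).
have lf : lbm f.
  split; last first.
    by move=> b; exists 1 => s _; have /andP[h1 h2] := f01 s; rewrite ger0_norm.
  have E : (`[0, +oo[%classic : set R) = \bigcup_n `[n%:R, n.+1%:R[%classic.
    apply/seteqP; split => t /=.
      rewrite in_itv /= andbT => t0; exists (Num.truncn t) => //=.
      by rewrite in_itv /= truncn_itv.
    move=> [n _] /=; rewrite !in_itv /= andbT => /andP[nt _].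
    by rewrite (le_trans _ nt).
  rewrite E; apply/measurable_fun_bigcup => // n.
  have mn : measurable_fun (`[n%:R, n.+1%:R[%classic : set R)
      (fun t => Num.max 0 (Num.min 1 (g n t))).
    apply: measurable_maxr => //; apply: measurable_minr => //; exact: mg.
  apply: eq_measurable_fun mn => t; rewrite inE /= in_itv /= => tn.
  by rewrite /f (@truncn_def _ t n).
have derf : {ae mu, forall t : R, 0 < t ->
    is_derive t 1 F (f t) /\ forall n, t < n.+1%:R -> g n t = f t}.
  apply: (@filterS _ _ (ae_filter_ringOfSetsType mu) _ _ _ ae_all).
  move=> t ht t0.
  have ft n : t < n.+1%:R -> g n t = f t.
    move=> tn; have d1 := ht n ltac:(by rewrite t0 tn).
    have d2 := ht (Num.truncn t) ltac:(by rewrite t0 truncnS_gt).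
    have /andP[h1 h2] := dF01 _ _ d2.
    rewrite /f min_r // max_r //.
    by case: d1 => _ <-; case: d2 => _ <-.
  split => //; rewrite -(ft (Num.truncn t)) ?truncnS_gt //.
  by apply: ht; rewrite t0 truncnS_gt.
exists f; split=> //.
  move=> t t0; apply/eqP; rewrite addrC -subr_eq; apply/eqP.
  rewrite (gE (Num.truncn t)) ?t0 ?ltW ?truncnS_gt // /itg.
  have i1 : mu.-integrable `]0, t] (EFin \o g (Num.truncn t)).
    exact: integrableS (gi _).
  have i2 : mu.-integrable `]0, t] (EFin \o f).
    by apply: integrableS (lbm_integrable t lf (lexx 0)) => //; exact: subset_itv_oc_cc.
  rewrite -!Rintegral_itv_obnd_cbnd //.
  congr fine; apply: ae_eq_integral => //.
  - exact: measurable_int i1.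
  - exact: measurable_int i2.
  - apply: (@filterS _ _ (ae_filter_ringOfSetsType mu) _ _ _ derf).
    move=> s hs; rewrite /= in_itv /= => /andP[s0 st].
    have st1 : s < (Num.truncn t).+1%:R := le_lt_trans st (truncnS_gt t).
    have [_ hn] := hs s0.
    by congr (EFin _); exact: hn.
apply: (@filterS _ _ (ae_filter_ringOfSetsType mu) _ _ _ derf).
by move=> t ht t0; have [] := ht t0.
Unshelve. all: by end_near. Qed.

(** The function [(F + L t) / (2 L)] has slopes between 0 and 1, which reduces the claim to
    [ac_slope01_global]. *)
Lemma lip_prim F (L : R) : 0 < L ->
  (forall a b : R, 0 <= a -> a <= b -> `|F b - F a| <= L * (b - a)) ->
  exists f : R -> R, [/\ lbm f, prim F f &
    {ae mu, forall t : R, 0 < t -> is_derive t 1 F (f t)}].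
Proof.
move=> L0 hF.
pose F1 t := (F (Num.max t 0) + L * Num.max t 0) / (2 * L).
have [|f [lf f01 pf df]] := @ac_slope01_global F1.
  move=> s t st.
  have m0 (x : R) : 0 <= Num.max x 0 by rewrite le_max lexx orbT.
  have m1 : Num.max s 0 <= Num.max t 0 by rewrite ge_max !le_max st lexx orbT.
  have m2 : Num.max t 0 - Num.max s 0 <= t - s.
    by rewrite /Num.max; case: ltP => h1; case: ltP => h2; lra.
  have := hF _ _ (m0 s) m1; rewrite ler_norml => /andP[h1 h2].
  rewrite /F1 -mulrBl; apply/andP; split.
    by apply: divr_ge0; lra.
  rewrite ler_pdivrMr; last lra.
  have h3 := ler_wpM2l (ltW L0) m2; lra.
have E (t : R) : 0 <= t -> F t = 2 * L * F1 t - L * t.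
  by move=> t0; rewrite /F1 max_l //; field; exact: lt0r_neq0.
have pid : prim (fun t : R => t) (fun=> 1).
  by move=> t t0; rewrite itg_cst //; ring.
exists (fun t => 2 * L * f t - L * 1); split.
- by apply: lbmB; [exact: lbmZ | exact: lbm_cst].
- have lc := lbm_cst (1 : R).
  apply: (@prim_ext _ (fun t => 2 * L * F1 t - L * t) (fun t => 2 * L * f t - L * 1)).
  + apply: primB; [exact: primZ|exact: primZ|exact: lbmZ|exact: lbmZ].
  + by move=> t t0; rewrite -E.
  + by [].
- apply: (@filterS _ _ (ae_filter_ringOfSetsType mu) _ _ _ df) => t dt t0.
  have dF := dt t0.
  have d1 : is_derive t 1 (fun t => 2 * L * F1 t - L * t) (2 * L * f t - L * 1).
    apply: is_deriveB; apply: is_deriveZ.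
  apply: near_eq_is_derive d1; near=> s; rewrite -E //; near: s.
  exact: lt_le_nbhsr.
Unshelve. all: by end_near. Qed.

End LipschitzPrimitive.

(** * One-dimensional motions: energy lower bound and steering to rest *)

Section Plane.
Variable R : realType.
Implicit Types f g w : R -> R.

(** A window of length [d * m] is too short for the speed [g] to change by more than [m / 8]. If [g]
    is large, [f] moves monotonically with speed at least [m / 4] and cannot stay near 0. If [f] is
    large while [g] is at most [m], it keeps half of its guaranteed size. Either way [|f|] is of
    order [m^2] for a time of order [m]. *)
Lemma interp_scalar (M : R) : 0 <= M -> exists c d : R, [/\ 0 < c, 0 < d &
  forall f g w, lbm w -> prim g w -> prim f g -> (forall t, 0 <= t -> `|w t| <= M) ->
  forall a m : R, 0 <= a -> 0 <= m ->
  (m ^+ 2 / 2 <= `|f a| /\ `|g a| <= m) \/ (m / 2 <= `|g a|) ->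
  c * m ^+ 5 <= itg (fun t => f t ^+ 2) a (a + d * m)].
Proof.
(* With [8 * d * (1 + M) = 1], speeds change by at most [m / 8] on the window, and positions by at
   most [2 m * d m <= m^2 / 4] when the speed is at most [2 m]. *)
move=> M0; pose d : R := (8 * (1 + M))^-1.
have d0 : 0 < d by rewrite invr_gt0; lra.
have dM : 8 * d * (1 + M) = 1 by rewrite /d; field; apply: lt0r_neq0; lra.
have d8 : 8 * d <= 1 by rewrite -[leRHS]dM ler_peMr; lra.
have Md : M * d <= 1 / 8 by nra.
exists ((d / 16) ^+ 3), d; split=> //; first by rewrite exprn_gt0 // divr_gt0.
have sub (f : R -> R) (a b a' b' k : R) : lbm f -> 0 <= a -> a <= a' -> a' <= b' -> b' <= b ->
    0 <= k -> (forall t, a' <= t <= b' -> k <= `|f t|) ->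
    k ^+ 2 * (b' - a') <= itg (fun t => f t ^+ 2) a b.
  move=> lf a0 aa ab bb k0 h.
  have lf2 : lbm (fun t => f t ^+ 2) by exact: (lbmM lf lf).
  apply: (@le_trans _ _ (itg (fun t => f t ^+ 2) a' b')); last first.
    by apply: itg_sub => // t _; exact: sqr_ge0.
  rewrite -itg_cst //; apply: le_itg => //; first exact: lbm_cst.
    exact: le_trans aa.
  move=> t /h kt; rewrite -(real_normK (num_real (f t))).
  by rewrite ler_pXn2r // nnegrE.
have pos f g w : lbm w -> prim g w -> prim f g -> (forall t, 0 <= t -> `|w t| <= M) ->
    forall a m : R, 0 <= a -> 0 <= m -> m / 2 <= g a ->
    (d / 16) ^+ 3 * m ^+ 5 <= itg (fun t => f t ^+ 2) a (a + d * m).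
  move=> lw pg pf hw a m a0 m0 hg.
  have lg := lbm_prim pg lw; have lf := lbm_prim pf lg.
  have dm0 : 0 <= d * m by rewrite mulr_ge0 // ltW.
  set h := d * m in dm0 *.
  have hM : M * h <= m / 8 by rewrite /h mulrA; nra.
  have g4 t : a <= t <= a + h -> m / 4 <= g t.
    move=> /andP[at_ th].
    have t0 := le_trans a0 at_.
    have h1 : `|g t - g a| <= M * (t - a).
      apply: (prim_lip pg) => // s /andP[as_ _]; apply: hw; exact: le_trans as_.
    have h2 : M * (t - a) <= M * h by apply: ler_wpM2l; lra.
    move: h1; rewrite ler_norml => /andP[h3 h4]; lra.
  have inc s t : a <= s -> s <= t -> t <= a + h -> m / 4 * (t - s) <= f t - f s.
    move=> as_ st th; apply: (prim_ge pf) => //; first exact: le_trans as_.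
    move=> v /andP[sv vt]; apply: g4; lra.
  have -> : (d / 16) ^+ 3 * m ^+ 5 = (m * h / 16) ^+ 2 * (h / 16).
    by rewrite /h; field.
  have k0 : 0 <= m * h / 16 by rewrite divr_ge0 // mulr_ge0.
  (* The sign of [f] at the midpoint decides whether the last or the first sixteenth of the window
     lies far from the zero of the increasing function [f]. *)
  have [fm|fm] := leP 0 (f (a + h / 2)).
    have -> : h / 16 = (a + h) - (a + 15 * h / 16) by field.
    apply: sub => //; try lra.
    move=> t /andP[t1 t2].
    have h1 := inc (a + h / 2) t ltac:(lra) ltac:(lra) ltac:(lra).
    apply: le_trans (ler_norm _).
    have h2 : m / 4 * (h / 4) <= m / 4 * (t - (a + h / 2)) by apply: ler_wpM2l; lra.
    lra.
  have -> : h / 16 = (a + h / 16) - a by field.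
  apply: sub => //; try lra.
  move=> t /andP[t1 t2].
  have h1 := inc t (a + h / 2) ltac:(lra) ltac:(lra) ltac:(lra).
  rewrite -normrN; apply: le_trans (ler_norm _).
  have h2 : m / 4 * (h / 4) <= m / 4 * ((a + h / 2) - t) by apply: ler_wpM2l; lra.
  lra.
move=> f g w lw pg pf hw a m a0 m0.
have lg := lbm_prim pg lw; have lf := lbm_prim pf lg.
have dm0 : 0 <= d * m by rewrite mulr_ge0 // ltW.
case=> [[hf hg]|].
  have hM : M * (d * m) <= m / 8 by rewrite mulrA; nra.
  have g2 t : a <= t <= a + d * m -> `|g t| <= 2 * m.
    move=> /andP[at_ th].
    have t0 := le_trans a0 at_.
    have h1 : `|g t - g a| <= M * (t - a).
      apply: (prim_lip pg) => // s /andP[as_ _]; apply: hw; exact: le_trans as_.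
    have h2 : M * (t - a) <= M * (d * m) by apply: ler_wpM2l; lra.
    have h3 : `|g t| <= `|g t - g a| + `|g a| by rewrite -{1}(subrK (g a) (g t)) ler_normD.
    lra.
  have f4 t : a <= t <= a + d * m -> m ^+ 2 / 4 <= `|f t|.
    move=> /andP[at_ th].
    have h1 : `|f t - f a| <= 2 * m * (t - a).
      apply: (prim_lip pf) => // s /andP[as_ st]; apply: g2; lra.
    have h2 : 2 * m * (t - a) <= 2 * m * (d * m) by apply: ler_wpM2l; lra.
    have h3 : `|f a| <= `|f t - f a| + `|f t|.
      by rewrite distrC -{1}(subrK (f t) (f a)) ler_normD.
    have h4 : 2 * m * (d * m) <= m ^+ 2 / 4.
      have -> : 2 * m * (d * m) = (8 * d) * (m ^+ 2 / 4) by field.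
      by apply: ler_piMl => //; rewrite divr_ge0 // sqr_ge0.
    lra.
  have k0 : 0 <= m ^+ 2 / 4 by rewrite divr_ge0 // sqr_ge0.
  have h1 : (m ^+ 2 / 4) ^+ 2 * (a + d * m - a) <= itg (fun t => f t ^+ 2) a (a + d * m).
    by apply: sub => //; lra.
  apply: le_trans h1.
  have -> : (m ^+ 2 / 4) ^+ 2 * (a + d * m - a) = d / 16 * m ^+ 5 by field.
  apply: ler_wpM2r; first exact: exprn_ge0.
  have e0 : 0 <= d / 16 by rewrite divr_ge0 // ltW.
  have h2 : (d / 16) ^+ 2 <= 1 by rewrite expr_le1 //; lra.
  by rewrite exprS ler_piMr.
case: (leP 0 (g a)) => ga.
  by rewrite ger0_norm // => h; apply: (pos f g w).
rewrite ltr0_norm // => h.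
have := @pos (fun t => - f t) (fun t => - g t) (fun t => - w t) (lbmN lw) (primN pg lw)
  (primN pf lg) _ a m a0 m0 h.
have -> : (fun t => (- f t) ^+ 2) = (fun t => f t ^+ 2).
  by apply/funext => t; rewrite sqrrN.
by apply=> t t0; rewrite normrN hw.
Qed.

Lemma prim_affine (c k a : R) : prim (fun t => c + k * (t - a)) (fun=> k).
Proof. by move=> t t0; rewrite itg_cst //; ring. Qed.

Lemma steer_scalar (a tau xa ya : R) : 0 <= a -> 0 < tau ->
  exists P P1 P2 : R -> R, [/\ prim P P1, prim P1 P2, lbm P2,
    [/\ P a = xa, P1 a = ya, P (a + tau) = 0 & P1 (a + tau) = 0] &
    forall t : R, a <= t <= a + tau ->
      `|P2 t| <= 14 * `|xa| / tau ^+ 2 + 6 * `|ya| / tau /\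
      `|P t| <= 3 * `|xa| + `|ya| * tau].
Proof.
move=> a0 t0; have tn : tau != 0 by exact: lt0r_neq0.
(* [P] is the cubic [s^2 L], where [s] is affine with [s a = 1] and [s (a + tau) = 0]. *)
pose k := - tau^-1; pose b := ya + 2 * xa / tau.
pose s t := 1 + k * (t - a); pose L t := xa + b * (t - a).
have ps : prim s (fun=> k) by exact: prim_affine.
have pL : prim L (fun=> b) by exact: prim_affine.
have lk := lbm_cst k; have lb := lbm_cst b.
have ls := lbm_prim ps lk; have lL := lbm_prim pL lb.
have pss := primM ps ps lk lk.
have lss := lbmD (lbmM lk ls) (lbmM ls lk).
have lss0 := lbm_prim pss lss.
have pP := primM pss pL lss lb.
have p1 : prim (fun t => k * s t + s t * k) (fun t => 2 * k * k).
  apply: (@prim_ext _ (fun t => 2 * k * s t) (fun=> 2 * k * k)) => [|t _|//].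
    by apply: primZ.
  by ring.
have l1 := lbm_cst (2 * k * k).
have l2 := lbm_prim p1 l1.
have p2 := primM p1 pL l1 lb.
have p3 := primM pss (prim_cst b) lss (lbm_cst 0).
have lP2a := lbmD (lbmM l1 lL) (lbmM l2 lb).
have lP2b := lbmD (lbmM lss lb) (lbmM lss0 (lbm_cst 0)).
have p4 := primD p2 p3 lP2a lP2b.
eexists _, _, _; split; [exact: pP | exact: p4 | exact: (lbmD lP2a lP2b) | |].
  by split; rewrite /s /L /k /b; field.
move=> t /andP[at_ ta].
pose v := (t - a) / tau.
have v01 : 0 <= v <= 1.
  apply/andP; split; first by apply: divr_ge0; lra.
  rewrite ler_pdivrMr // mul1r; lra.
have {v01} [v0 v1] := andP v01.
have ts : t - a = v * tau by rewrite /v divfK.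
have sE : s t = 1 - v by rewrite /s /k ts; field.
have tau2 : 0 < tau ^+ 2 by rewrite exprn_gt0.
have mul (A p c q : R) : `|A| <= c -> `|p| = q -> `|A * p| <= c * q.
  by move=> Ac <-; rewrite normrM ler_wpM2r.
have q1 : `|ya * tau| = `|ya| * tau by rewrite normrM (gtr0_norm t0).
have q2 : `|ya / tau| = `|ya| / tau by rewrite normrM normfV (gtr0_norm t0).
have q3 : `|xa / tau ^+ 2| = `|xa| / tau ^+ 2 by rewrite normrM normfV (gtr0_norm tau2).
split; last first.
  have -> : s t * s t * L t = (1 - v) ^+ 2 * (1 + 2 * v) * xa + (1 - v) ^+ 2 * v * (ya * tau).
    by rewrite sE /L ts /b; field.
  have e1 : 0 <= (1 - v) ^+ 2 by exact: sqr_ge0.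
  have e2 : (1 - v) ^+ 2 <= 1 by rewrite expr_le1 //; lra.
  apply: le_trans (ler_normD _ _) _; rewrite -[X in _ <= _ + X]mul1r; apply: lerD; apply: mul => //.
    by rewrite ger0_norm; nra.
  by rewrite ger0_norm; nra.
(* The two coefficients equal [12 v - 6] and [6 v - 4], so the factors 14 and 6 leave room. *)
set A := (X in `|X|); have -> : A = (2 * (1 + 2 * v) - 8 * (1 - v)) * (xa / tau ^+ 2)
    + (2 * v - 4 * (1 - v)) * (ya / tau).
  by rewrite /A sE /L ts /b /k; field.
apply: le_trans (ler_normD _ _) _; rewrite -!mulrA; apply: lerD; apply: mul => //.
- by rewrite ler_norml; apply/andP; split; lra.
- by rewrite ler_norml; apply/andP; split; lra.
Qed.

End Plane.

(** * Planar motions, their energy, and steering inside the control set *)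

Section Trajectories.
Variable R : realType.
Notation U := (R * R)%type.
Implicit Types (f g w : R -> R) (x y u : R -> U) (a b v : U).

Definition vsub a b : U := vadd a (vscale (-1) b).

Lemma vsubE a b : vsub a b = (a.1 - b.1, a.2 - b.2).
Proof. by rewrite /vsub /vadd /vscale /= !mulN1r. Qed.

Lemma dot_ge0 v : 0 <= dot v v.
Proof. by rewrite addr_ge0 // -expr2 sqr_ge0. Qed.

Lemma enorm_ge0 v : 0 <= enorm v. Proof. exact: sqrtr_ge0. Qed.

Lemma enorm_sqr v : enorm v ^+ 2 = dot v v.
Proof. by rewrite sqr_sqrtr // dot_ge0. Qed.

Lemma le_enorm v (k : R) : 0 <= k -> dot v v <= k ^+ 2 -> enorm v <= k.
Proof. by move=> k0 h; rewrite -(ler_pXn2r (ltn0Sn 1)) ?nnegrE ?enorm_ge0 // enorm_sqr. Qed.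

Lemma abs_le_sqr (p k : R) : 0 <= k -> p * p <= k ^+ 2 -> `|p| <= k.
Proof.
move=> k0 h; rewrite -(ler_pXn2r (ltn0Sn 1)) ?nnegrE //.
by rewrite real_normK ?num_real.
Qed.

Lemma enorm_fst v : `|v.1| <= enorm v.
Proof.
apply: abs_le_sqr; first exact: enorm_ge0.
by rewrite enorm_sqr /dot lerDl -expr2 sqr_ge0.
Qed.

Lemma enorm_snd v : `|v.2| <= enorm v.
Proof.
apply: abs_le_sqr; first exact: enorm_ge0.
by rewrite enorm_sqr /dot lerDr -expr2 sqr_ge0.
Qed.

Lemma enorm_le_abs v : enorm v <= `|v.1| + `|v.2|.
Proof.
apply: le_enorm; first by rewrite addr_ge0.
rewrite sqrrD !real_normK ?num_real // /dot -!expr2.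
have := mulr_ge0 (normr_ge0 v.1) (normr_ge0 v.2); rewrite -mulr_natr; lra.
Qed.

Lemma enorm_eq0 v : enorm v <= 0 -> v = vzero R.
Proof.
move=> h; have h1 := le_trans (enorm_fst v) h; have h2 := le_trans (enorm_snd v) h.
by move: h1 h2; rewrite !normr_le0 => /eqP h1 /eqP h2; rewrite (surjective_pairing v) h1 h2.
Qed.

Lemma dot_le a b : dot a b <= enorm a * enorm b.
Proof.
apply: le_trans (ler_norm _) _; apply: abs_le_sqr; first by rewrite mulr_ge0 ?enorm_ge0.
rewrite exprMn !enorm_sqr /dot -subr_ge0.
have -> : (a.1 * a.1 + a.2 * a.2) * (b.1 * b.1 + b.2 * b.2) -
  (a.1 * b.1 + a.2 * b.2) * (a.1 * b.1 + a.2 * b.2) = (a.1 * b.2 - a.2 * b.1) ^+ 2.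
  by ring.
exact: sqr_ge0.
Qed.

Definition mq a b : R := Num.max (Num.sqrt (enorm a)) (enorm b).

Lemma mq_ge0 a b : 0 <= mq a b.
Proof. by rewrite le_max sqrtr_ge0. Qed.

Lemma mq_fst a b : enorm a <= mq a b ^+ 2.
Proof.
rewrite -[leLHS](sqr_sqrtr (enorm_ge0 a)) ler_pXn2r ?nnegrE ?mq_ge0 ?sqrtr_ge0 //.
by rewrite le_max lexx.
Qed.

Lemma mq_snd a b : enorm b <= mq a b.
Proof. by rewrite le_max lexx orbT. Qed.

Lemma mq_cases a b : enorm a = mq a b ^+ 2 \/ enorm b = mq a b.
Proof.
by rewrite /mq; case: leP => h; [right|left; rewrite sqr_sqrtr // enorm_ge0].
Qed.

Lemma mq_le0 a b : mq a b <= 0 -> a = vzero R /\ b = vzero R.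
Proof.
move=> h; have m0 : mq a b = 0 by apply/le_anti; rewrite h mq_ge0.
have := mq_fst a b; have := mq_snd a b; rewrite m0 expr0n /= => h1 h2.
by split; exact: enorm_eq0.
Qed.

Lemma enorm0 : enorm (vzero R) = 0.
Proof. by rewrite /enorm /dot /= mulr0 addr0 sqrtr0. Qed.

Lemma mq0 : mq (vzero R) (vzero R) = 0.
Proof. by rewrite /mq enorm0 sqrtr0 maxxx. Qed.

Definition vlbm x := lbm (fun t => (x t).1) /\ lbm (fun t => (x t).2).
Definition vprim x y := prim (fun t => (x t).1) (fun t => (y t).1) /\
  prim (fun t => (x t).2) (fun t => (y t).2).

Lemma vlbm_prim x y : vprim x y -> vlbm y -> vlbm x.
Proof. by move=> [p1 p2] [l1 l2]; split; [exact: lbm_prim p1 _|exact: lbm_prim p2 _]. Qed.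

Lemma lbm_dot x y : vlbm x -> vlbm y -> lbm (fun t => dot (x t) (y t)).
Proof. by move=> [l1 l2] [l3 l4]; apply: lbmD; apply: lbmM. Qed.

Lemma vlbm_sub x y : vlbm x -> vlbm y -> vlbm (fun t => vsub (x t) (y t)).
Proof.
move=> [l1 l2] [l3 l4]; split; under eq_fun do rewrite vsubE; exact: lbmB.
Qed.

Lemma vprim_sub x y x' y' : vprim x y -> vprim x' y' -> vlbm y -> vlbm y' ->
  vprim (fun t => vsub (x t) (x' t)) (fun t => vsub (y t) (y' t)).
Proof.
move=> [p1 p2] [p3 p4] [l1 l2] [l3 l4]; split.
  by apply: prim_ext (primB p1 p3 l1 l3) _ _ => t _; rewrite vsubE.
by apply: prim_ext (primB p2 p4 l2 l4) _ _ => t _; rewrite vsubE.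
Qed.

Lemma vlbm_cst v : vlbm (fun=> v).
Proof. by split; exact: lbm_cst. Qed.

Lemma vlbm_glue (s : R) x y : vlbm x -> vlbm y -> vlbm (glue s x y).
Proof.
move=> [l1 l2] [l3 l4]; split.
  rewrite (_ : (fun t => _) = glue s (fun t => (x t).1) (fun t => (y t).1)).
    exact: lbm_glue.
  by apply/funext => t; rewrite /glue; case: ltP.
rewrite (_ : (fun t => _) = glue s (fun t => (x t).2) (fun t => (y t).2)).
  exact: lbm_glue.
by apply/funext => t; rewrite /glue; case: ltP.
Qed.

Lemma vprim_glue (s : R) x y x' y' : 0 <= s -> vprim x y -> vprim x' y' ->
  vlbm y -> vlbm y' -> x s = x' s -> vprim (glue s x x') (glue s y y').
Proof.
move=> s0 [p1 p2] [p3 p4] [l1 l2] [l3 l4] xx; split.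
  apply: (@prim_ext _ (glue s (fun t => (x t).1) (fun t => (x' t).1))
    (glue s (fun t => (y t).1) (fun t => (y' t).1))).
  - by apply: prim_glue => //; rewrite xx.
  - by move=> t _; rewrite /glue; case: ltP.
  - by move=> t _; rewrite /glue; case: ltP.
apply: (@prim_ext _ (glue s (fun t => (x t).2) (fun t => (x' t).2))
  (glue s (fun t => (y t).2) (fun t => (y' t).2))).
- by apply: prim_glue => //; rewrite xx.
- by move=> t _; rewrite /glue; case: ltP.
- by move=> t _; rewrite /glue; case: ltP.
Qed.

(** Twice the running cost; the factor one half is restored in [cost_bdd]. *)
Definition en x (s t : R) : R := itg (fun r => dot (x r) (x r)) s t.

Lemma en_ge0 x (s t : R) : 0 <= en x s t.
Proof. by apply: itg_ge0 => r _; exact: dot_ge0. Qed.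

Lemma en_split x (r s t : R) : vlbm x -> 0 <= r -> r <= s -> s <= t ->
  en x r t = en x r s + en x s t.
Proof. by move=> lx r0 rs st; rewrite /en (itg_split (lbm_dot lx lx) r0 rs st). Qed.

Lemma en_mono x (r s t : R) : vlbm x -> 0 <= r -> r <= s -> s <= t ->
  en x r s <= en x r t.
Proof. by move=> lx r0 rs st; rewrite (en_split lx r0 rs st) lerDl en_ge0. Qed.

(** Only a bound on the control is retained, not membership in the control set, so that the
    difference of two motions is again of this kind. *)
Definition dyn (M : R) x y u := [/\ vlbm u, vprim y u, vprim x y &
  forall t, 0 <= t -> `|(u t).1| <= M /\ `|(u t).2| <= M].

Lemma dyn_vlbm M x y u : dyn M x y u -> vlbm x /\ vlbm y.
Proof.
move=> [lu pyu pxy _]; have ly := vlbm_prim pyu lu; split=> //.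
exact: vlbm_prim pxy ly.
Qed.

Lemma dyn_sub M x y u x' y' u' : dyn M x y u -> dyn M x' y' u' ->
  dyn (M + M) (fun t => vsub (x t) (x' t)) (fun t => vsub (y t) (y' t))
    (fun t => vsub (u t) (u' t)).
Proof.
move=> d d'; have [_ ly] := dyn_vlbm d; have [_ ly'] := dyn_vlbm d'.
case: d d' => [lu pyu pxy b] [lu' pyu' pxy' b']; split.
- exact: vlbm_sub.
- exact: vprim_sub.
- exact: vprim_sub.
- move=> t t0; have [h1 h2] := b t t0; have [h3 h4] := b' t t0; rewrite vsubE /=.
  by split; apply: le_trans (ler_normB _ _) _; apply: lerD.
Qed.

(** Whichever of [x s] and [y s] realises the maximum in [mq], one of its coordinates carries at
    least half of its norm. The scalar bound for that coordinate is enough. *)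
Lemma interp (M : R) : 0 <= M -> exists c d : R, [/\ 0 < c, 0 < d &
  forall x y u, dyn M x y u -> forall s : R, 0 <= s ->
  c * mq (x s) (y s) ^+ 5 <= en x s (s + d * mq (x s) (y s))].
Proof.
move=> M0; have [c [d [c0 d0 H]]] := interp_scalar M0.
exists c, d; split=> // x y u dd s s0.
have [[lx1 lx2] [ly1 ly2]] := dyn_vlbm dd; case: dd => [[lu1 lu2] [py1 py2] [px1 px2] b].
set m := mq _ _; have m0 : 0 <= m by exact: mq_ge0.
have e1 : itg (fun t => (x t).1 ^+ 2) s (s + d * m) <= en x s (s + d * m).
  apply: le_itg => //; first exact: lbmM.
    exact: lbm_dot.
  by move=> t _; rewrite /dot -!expr2 lerDl sqr_ge0.
have e2 : itg (fun t => (x t).2 ^+ 2) s (s + d * m) <= en x s (s + d * m).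
  apply: le_itg => //; first exact: lbmM.
    exact: lbm_dot.
  by move=> t _; rewrite /dot -!expr2 lerDr sqr_ge0.
have b1 t : 0 <= t -> `|(u t).1| <= M by move=> /b [].
have b2 t : 0 <= t -> `|(u t).2| <= M by move=> /b [].
have H1 := H _ _ _ lu1 py1 px1 b1 s m s0 m0.
have H2 := H _ _ _ lu2 py2 px2 b2 s m s0 m0.
have f1 := enorm_fst (y s); have f2 := enorm_snd (y s).
have f3 := mq_snd (x s) (y s); rewrite -/m in f3.
have [h|h] := mq_cases (x s) (y s); rewrite -/m in h.
  have h3 := enorm_le_abs (x s); rewrite h in h3.
  have [g|g] := leP (m ^+ 2 / 2) (`|(x s).1|).
    by apply: le_trans e1; apply: H1; left; split=> //; lra.
  by apply: le_trans e2; apply: H2; left; split=> //; lra.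
have h3 := enorm_le_abs (y s); rewrite h in h3.
have [g|g] := leP (m / 2) (`|(y s).1|).
  by apply: le_trans e1; apply: H1; right.
by apply: le_trans e2; apply: H2; right; lra.
Qed.

Variable O : set U.

Definition traj x y u :=
  [/\ vlbm u, forall t, 0 <= t -> O (u t), vprim y u & vprim x y].

Lemma traj_dyn M x y u : (forall v, O v -> `|v.1| <= M /\ `|v.2| <= M) ->
  traj x y u -> dyn M x y u.
Proof. by move=> hM [lu Ou py px]; split=> // t t0; apply: hM; exact: Ou. Qed.

(** Steering in a time proportional to [mq xs ys] keeps the acceleration bounded independently of
    the start. The position stays of order [m^2] during a time of order [m], whence the fifth power.
    Membership in [O] is claimed only after [s], since the cubic is unbounded before. *)
Lemma steer_tail (r : R) : 0 < r ->
  (forall v, `|v.1| <= r -> `|v.2| <= r -> O v) ->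
  exists K : R, 0 < K /\ forall (s : R) (xs ys : U), 0 <= s ->
  exists x y u, [/\ vlbm u, forall t, s <= t -> O (u t), vprim y u, vprim x y &
    [/\ x s = xs, y s = ys & forall t, s <= t -> en x s t <= K * mq xs ys ^+ 5]].
Proof.
(* In time [k * m] the cubic needs an acceleration of at most [14 / k^2 + 6 / k <= 20 / k <= r] in
   each coordinate. *)
move=> r0 hr; pose k : R := 1 + 20 / r.
have k1 : 1 <= k by rewrite lerDl divr_ge0 // ltW.
have k0 : 0 < k by lra.
have kr : 20 / k <= r.
  rewrite ler_pdivrMr // /k mulrDr mulr1 (mulrC 20) mulrA divff ?lt0r_neq0 //; lra.
have O0 : O (vzero R) by apply: hr; rewrite normr0 ltW.
exists (2 * (3 + k) ^+ 2 * k); split.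
  by rewrite mulr_gt0 // mulr_gt0 // exprn_gt0 //; lra.
move=> s xs ys s0; set m := mq xs ys.
have p0 : vprim (fun=> vzero R) (fun=> vzero R) by split; exact: prim_cst.
have l0 := vlbm_cst (vzero R).
(* At rest the steering time would be 0, so the zero motion is given directly. *)
have [m0|m0] := leP m 0.
  have [x0 y0] := mq_le0 m0.
  have m00 : m = 0 by apply/le_anti; rewrite m0 mq_ge0.
  exists (fun=> vzero R), (fun=> vzero R), (fun=> vzero R).
  split=> //; split=> // t _.
  by rewrite /en /dot /= mulr0 addr0 itg0 m00 expr0n /= mulr0.
pose tau := k * m; have tau0 : 0 < tau by rewrite mulr_gt0.
have [P [P1 [P2 [pP pP1 lP2 [Ps P1s Pe P1e] bP]]]] := steer_scalar xs.1 ys.1 s0 tau0.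
have [Q [Q1 [Q2 [pQ pQ1 lQ2 [Qs Q1s Qe Q1e] bQ]]]] := steer_scalar xs.2 ys.2 s0 tau0.
have lP1 := lbm_prim pP1 lP2; have lQ1 := lbm_prim pQ1 lQ2.
have lP := lbm_prim pP lP1; have lQ := lbm_prim pQ lQ1.
have st0 : 0 <= s + tau by rewrite addr_ge0 // ltW.
have vP : vlbm (fun t => (P t, Q t)) by [].
have vP1 : vlbm (fun t => (P1 t, Q1 t)) by [].
have vP2 : vlbm (fun t => (P2 t, Q2 t)) by [].
pose x := glue (s + tau) (fun t => (P t, Q t)) (fun=> vzero R).
pose y := glue (s + tau) (fun t => (P1 t, Q1 t)) (fun=> vzero R).
pose u := glue (s + tau) (fun t => (P2 t, Q2 t)) (fun=> vzero R).
have x1 : `|xs.1| <= m ^+ 2 := le_trans (enorm_fst xs) (mq_fst xs ys).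
have x2 : `|xs.2| <= m ^+ 2 := le_trans (enorm_snd xs) (mq_fst xs ys).
have y1 : `|ys.1| <= m := le_trans (enorm_fst ys) (mq_snd xs ys).
have y2 : `|ys.2| <= m := le_trans (enorm_snd ys) (mq_snd xs ys).
have bnd2 (p q : R) : p <= m ^+ 2 -> q <= m -> 14 * p / tau ^+ 2 + 6 * q / tau <= r.
  move=> hp hq; apply: le_trans kr.
  have i1 : 0 < k^-1 by rewrite invr_gt0.
  have i2 : 0 < tau^-1 by rewrite invr_gt0.
  have i4 : k^-1 <= 1 by rewrite invf_le1.
  have e1 : p / tau ^+ 2 <= k^-1 ^+ 2.
    rewrite /tau exprMn invfM -exprVn mulrCA.
    apply: ler_piMr; first by apply: exprn_ge0; exact: ltW.
    by rewrite ler_pdivrMr ?exprn_gt0 // mul1r.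
  have e2 : q / tau <= k^-1.
    rewrite /tau invfM mulrCA.
    apply: ler_piMr; first exact: ltW.
    by rewrite ler_pdivrMr // mul1r.
  have e3 : k^-1 ^+ 2 <= k^-1 by rewrite expr2 ler_piMl //; exact: ltW.
  rewrite -!mulrA; lra.
have bnd0 (p q : R) : 0 <= p -> 0 <= q -> p <= m ^+ 2 -> q <= m ->
    3 * p + q * tau <= (3 + k) * m ^+ 2.
  move=> p0' q0' hp hq; have : q * tau <= m * tau by rewrite ler_wpM2r // ltW.
  rewrite /tau => h1.
  have -> : (3 + k) * m ^+ 2 = 3 * m ^+ 2 + m * (k * m) by ring.
  lra.
exists x, y, u; split.
- exact: vlbm_glue.
- move=> t st; rewrite /u /glue; case: ltP => // tt.
  have tin : s <= t <= s + tau by rewrite st ltW.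
  have [h1 _] := bP t tin; have [h2 _] := bQ t tin.
  apply: hr => /=; [apply: le_trans h1 _|apply: le_trans h2 _]; exact: bnd2.
- by apply: vprim_glue => //; rewrite P1e Q1e.
- by apply: vprim_glue => //; rewrite Pe Qe.
have sst : s < s + tau by rewrite ltrDl.
split.
- by rewrite /x /glue sst Ps Qs -surjective_pairing.
- by rewrite /y /glue sst P1s Q1s -surjective_pairing.
move=> t st.
have lx : vlbm x by exact: vlbm_glue.
have ldot := lbm_dot lx lx.
pose B := 2 * ((3 + k) * m ^+ 2) ^+ 2.
have B0 : 0 <= B by rewrite mulr_ge0 // sqr_ge0.
have dx z : s <= z -> dot (x z) (x z) <= B.
  move=> sz; rewrite /x /glue; case: ltP => zt; last by rewrite /dot /= mulr0 addr0.
  have tin : s <= z <= s + tau by rewrite sz ltW.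
  have [_ h1] := bP z tin; have [_ h2] := bQ z tin.
  have h3 := le_trans h1 (bnd0 _ _ (normr_ge0 _) (normr_ge0 _) x1 y1).
  have h4 := le_trans h2 (bnd0 _ _ (normr_ge0 _) (normr_ge0 _) x2 y2).
  have K0 : 0 <= (3 + k) * m ^+ 2 by exact: le_trans h3.
  have sq (p q : R) : 0 <= q -> `|p| <= q -> p * p <= q ^+ 2.
    by move=> q0 pq; rewrite -expr2 -real_normK ?num_real // ler_pXn2r ?nnegrE.
  by rewrite /dot /B /=; have := sq _ _ K0 h3; have := sq _ _ K0 h4; lra.
have short z : s <= z -> z <= s + tau -> en x s z <= B * tau.
  move=> sz zt; apply: (@le_trans _ _ (itg (fun=> B) s z)).
    by apply: le_itg => // [|z' /andP[h1 h2]]; [exact: lbm_cst|exact: dx].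
  by rewrite itg_cst // ler_wpM2l //; lra.
have -> : 2 * (3 + k) ^+ 2 * k * m ^+ 5 = B * tau by rewrite /B /tau; ring.
have [tt|tt] := leP t (s + tau); first exact: short.
rewrite (en_split lx s0 (ltW sst) (ltW tt)).
have -> : en x (s + tau) t = 0.
  rewrite /en (@eq_itg _ _ (fun=> 0)) ?itg0 // => z /andP[h1 h2].
  by rewrite /x /glue ltNge h1 /= /dot /= mulr0 addr0.
by rewrite addr0; apply: short => //; exact: ltW.
Qed.

Lemma steer (r : R) : 0 < r ->
  (forall v, `|v.1| <= r -> `|v.2| <= r -> O v) ->
  exists K : R, 0 < K /\ forall x y u, traj x y u -> forall s : R, 0 <= s ->
  exists x' y' u', [/\ traj x' y' u', x' 0 = x 0, y' 0 = y 0, forall t, t < s -> u' t = u t &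
   (forall t, t <= s -> x' t = x t) /\
   forall t, s <= t -> en x' s t <= K * mq (x s) (y s) ^+ 5].
Proof.
move=> r0 hr; have [K [K0 H]] := steer_tail r0 hr.
exists K; split=> // x y u [lu Ou py px] s s0.
have [X [Y [W [lW OW pY pX [Xs Ys HX]]]]] := H s (x s) (y s) s0.
have ly := vlbm_prim py lu; have lY := vlbm_prim pY lW.
have gs (z z' : R -> U) t : z s = z' s -> t <= s -> glue s z z' t = z t.
  rewrite /glue => zz; rewrite le_eqVlt => /predU1P[->|-> //].
  by rewrite ltxx.
exists (glue s x X), (glue s y Y), (glue s u W); split.
- split.
  + exact: vlbm_glue.
  + move=> t t0; rewrite /glue; case: ltP => h; [exact: Ou|exact: OW].
  + exact: vprim_glue.
  + exact: vprim_glue.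
- exact: gs.
- exact: gs.
- by move=> t ts; rewrite /glue ts.
split; first by move=> t; exact: gs.
move=> t st; have := HX t st; rewrite /en (@eq_itg _ _ (fun r => dot (X r) (X r))) //.
by move=> z /andP[sz _]; rewrite /glue ltNge sz.
Qed.

End Trajectories.

(** * Existence of a minimiser *)

Section Existence.
Variable R : realType.
Notation mu := (@lebesgue_measure R).
Notation U := (R * R)%type.
Implicit Types (f g : R -> R) (x y u : R -> U) (a b v w p : U).

Lemma itg_ae_eq f g (s t : R) : lbm f -> lbm g -> 0 <= s ->
  {ae mu, forall r : R, 0 <= r -> f r = g r} -> itg f s t = itg g s t.
Proof.
move=> lf lg s0 h.
have h1 : itg (fun r => f r - g r) s t <= 0.
  apply: itg_ae_le0 => //; first exact: lbmB.
  apply: (@filterS _ _ (ae_filter_ringOfSetsType mu) _ _ _ h) => r hr r0.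
  by rewrite hr // subrr.
have h2 : itg (fun r => g r - f r) s t <= 0.
  apply: itg_ae_le0 => //; first exact: lbmB.
  apply: (@filterS _ _ (ae_filter_ringOfSetsType mu) _ _ _ h) => r hr r0.
  by rewrite hr // subrr.
by rewrite itgB // in h1; rewrite itgB // in h2; lra.
Qed.

Lemma unif_cauchy (f : nat -> R -> R) :
  (forall e : R, 0 < e -> exists N, forall n m, (N <= n)%N -> (N <= m)%N ->
     forall t : R, 0 <= t -> `|f n t - f m t| <= e) ->
  exists g : R -> R, forall e : R, 0 < e -> exists N, forall n, (N <= n)%N ->
     forall t : R, 0 <= t -> `|f n t - g t| <= e.
Proof.
move=> h; exists (fun t => limn (fun n => f n t)) => e e0.
have [N hN] := h e e0; exists N => n nN t t0.
have cv : cvgn (fun n => f n t).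
  apply: cauchy_cvg; apply: cauchy_exP => d d0.
  have [N' hN'] := h (d / 2) (divr_gt0 d0 (ltr0Sn _ 1)).
  exists (f N' t); exists N' => // m /= Nm; rewrite /ball /=.
  by apply: le_lt_trans (hN' _ _ (leqnn _) Nm t t0) _; lra.
have cv2 : (fun m => `|f n t - f m t|) @ \oo --> `|f n t - limn (fun n => f n t)|.
  by apply: cvg_norm; apply: cvgB; [exact: cvg_cst|exact: cv].
rewrite -(cvg_lim _ cv2) //; apply: limr_le; first by apply/cvg_ex; eexists; exact: cv2.
by exists N => // m /= Nm; apply: hN.
Qed.

Definition ulim (f : nat -> R -> R) (g : R -> R) :=
  forall e : R, 0 < e -> exists N, forall n, (N <= n)%N ->
     forall t : R, 0 <= t -> `|f n t - g t| <= e.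

Lemma prim_ulim (F f : nat -> R -> R) G g : ulim F G -> ulim f g ->
  (forall n, prim (F n) (f n)) -> (forall n, lbm (f n)) -> lbm g -> prim G g.
Proof.
move=> uF uf pF lf lg t t0.
suff : `|G t - (G 0 + itg g 0 t)| <= 0.
  by rewrite normr_le0 subr_eq0 => /eqP.
apply/ler_addgt0Pr => e e0; rewrite add0r.
pose d := e / (2 + t).
have d0 : 0 < d by rewrite divr_gt0 // ltr_wpDr.
have [N1 h1] := uF d d0; have [N2 h2] := uf d d0.
pose n := maxn N1 N2.
have a1 := h1 n (leq_maxl _ _) t t0.
have a2 := h1 n (leq_maxl _ _) 0 (lexx _).
have a3 : `|itg (fun s => f n s - g s) 0 t| <= d * (t - 0).
  apply: itg_bound => //; first exact: lbmB.
  by move=> s /andP[s0 _]; apply: h2 => //; exact: leq_maxr.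
have a4 := pF n t t0.
rewrite itgB // subr0 in a3.
have -> : e = d + d + d * t by rewrite /d; field; apply: lt0r_neq0; lra.
have -> : G t - (G 0 + itg g 0 t) = - (F n t - G t) + (F n 0 - G 0) +
  (itg (f n) 0 t - itg g 0 t) by rewrite a4; ring.
apply: le_trans (ler_normD _ _) _; apply: lerD => //.
apply: le_trans (ler_normD _ _) _; apply: lerD => //.
by rewrite normrN.
Qed.

Lemma lip_ulim (F : nat -> R -> R) G (M s t : R) : ulim F G -> 0 <= s -> 0 <= t ->
  (forall n, F n t - F n s <= M) -> G t - G s <= M.
Proof.
move=> uF s0 t0 h; apply/ler_addgt0Pr => e e0.
have [N hN] := uF (e / 2) (divr_gt0 e0 (ltr0Sn _ 1)).
have := hN N (leqnn _) s s0; have := hN N (leqnn _) t t0.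
rewrite !ler_norml => /andP[h1 h2] /andP[h3 h4]; have := h N; lra.
Qed.

Variables (O : set U) (r M : R).
Hypothesis r0 : 0 < r.
Hypothesis Obox : forall v, `|v.1| <= r -> `|v.2| <= r -> O v.
Hypothesis Obnd : forall v, O v -> `|v.1| <= M /\ `|v.2| <= M.
Hypothesis Oconv : forall v w (l : R), O v -> O w -> 0 <= l <= 1 ->
  O (vadd (vscale l v) (vscale (1 - l) w)).
Hypothesis Osep : forall v, ~ O v -> exists p (h : R),
  (forall w, O w -> dot p w <= h) /\ h < dot p v.

Let O0 : O (vzero R).
Proof. by apply: Obox; rewrite normr0 ltW. Qed.

Lemma bound_gt0 : 0 < M.
Proof.
have [|h _] := @Obnd (r, r); last by rewrite (lt_le_trans r0) // (le_trans (ler_norm _) h).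
by apply: Obox; rewrite /= gtr0_norm.
Qed.

(* The hypothesis places the difference quotients of [y] in the intersection of
   the half-planes containing [O], which is [O] itself by [Osep]. *)
Lemma lip_traj y : (forall (p : U) (h s t : R), (forall v, O v -> dot p v <= h) ->
    0 <= s -> s <= t -> dot p (y t) - dot p (y s) <= h * (t - s)) ->
  exists u, [/\ vlbm u, forall t, 0 <= t -> O (u t) & vprim y u].
Proof.
move=> hy.
have lip1 (s t : R) : 0 <= s -> s <= t -> `|(y t).1 - (y s).1| <= M * (t - s).
  move=> s0 st.
  have h1 := @hy (1, 0) M s t _ s0 st; have h2 := @hy (-1, 0) M s t _ s0 st.
  rewrite /dot /= in h1 h2.
  rewrite ler_norml; apply/andP; split.
    suff : -1 * (y t).1 + 0 * (y t).2 - (-1 * (y s).1 + 0 * (y s).2) <= M * (t - s) by lra.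
    apply: h2 => v /Obnd [h _]; rewrite mul0r addr0 mulN1r.
    by move: h; rewrite ler_norml => /andP[]; lra.
  suff : 1 * (y t).1 + 0 * (y t).2 - (1 * (y s).1 + 0 * (y s).2) <= M * (t - s) by lra.
  apply: h1 => v /Obnd [h _]; rewrite mul0r addr0 mul1r.
  exact: le_trans (ler_norm _) h.
have lip2 (s t : R) : 0 <= s -> s <= t -> `|(y t).2 - (y s).2| <= M * (t - s).
  move=> s0 st.
  have h1 := @hy (0, 1) M s t _ s0 st; have h2 := @hy (0, -1) M s t _ s0 st.
  rewrite /dot /= in h1 h2.
  rewrite ler_norml; apply/andP; split.
    suff : 0 * (y t).1 + -1 * (y t).2 - (0 * (y s).1 + -1 * (y s).2) <= M * (t - s) by lra.
    apply: h2 => v /Obnd [_ h]; rewrite mul0r add0r mulN1r.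
    by move: h; rewrite ler_norml => /andP[]; lra.
  suff : 0 * (y t).1 + 1 * (y t).2 - (0 * (y s).1 + 1 * (y s).2) <= M * (t - s) by lra.
  apply: h1 => v /Obnd [_ h]; rewrite mul0r add0r mul1r.
  exact: le_trans (ler_norm _) h.
have [w1 [lw1 pw1 dw1]] := lip_prim bound_gt0 lip1.
have [w2 [lw2 pw2 dw2]] := lip_prim bound_gt0 lip2.
pose w t : U := (w1 t, w2 t).
have aeQ : {ae mu, forall t : R, (0 < t -> O (w t)) /\ t != 0}.
  have n0 : {ae mu, forall t : R, t != 0}.
    exists [set 0]; split=> //; first exact: lebesgue_measure_set1.
    by move=> t /= /negP; rewrite negbK => /eqP.
  have F := ae_filter_ringOfSetsType mu.
  apply: (@filterS3 _ _ F _ _ _ _ _ dw1 dw2 n0) => t h1 h2 t0.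
  split=> // tpos; apply: contrapT => nO.
  have [p [h [hp hv]]] := Osep nO.
  have d1 := h1 tpos; have d2 := h2 tpos.
  have d3 : is_derive t 1 (fun s => p.1 * (y s).1 + p.2 * (y s).2) (p.1 * w1 t + p.2 * w2 t).
    by apply: is_deriveD; apply: is_deriveZ.
  move: hv; rewrite ltNge => /negP; apply.
  apply: (is_derive_le d3) => e e0; exists (e / 2); first by apply/andP; split; lra.
  have := hy p h t (t + e / 2) hp (ltW tpos) ltac:(lra).
  rewrite /dot; lra.
have [N [mN N0 hN]] := aeQ.
have nN t : t \notin N -> (0 < t -> O (w t)) /\ t != 0.
  by move=> tN; apply: contrapT => h; move: tN; rewrite notin_setE; apply; exact: hN.
(* Membership in [O] is required at every time. The control is therefore reset to 0, a point of [O],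
   on a measurable null set that contains time 0 and all positive times at which [w] is outside
   [O]. *)
pose u t := if t \in N then vzero R else w t.
have u1 : (fun t => (u t).1) = (fun t => if t \in N then 0 else w1 t).
  by apply/funext => t; rewrite /u; case: ifP.
have u2 : (fun t => (u t).2) = (fun t => if t \in N then 0 else w2 t).
  by apply/funext => t; rewrite /u; case: ifP.
have l1 : lbm (fun t => (u t).1) by rewrite u1; apply: lbm_if => //; exact: lbm_cst.
have l2 : lbm (fun t => (u t).2) by rewrite u2; apply: lbm_if => //; exact: lbm_cst.
have aeN : {ae mu, forall t : R, 0 <= t -> w t = u t}.
  exists N; split=> // t /= h; apply: contrapT => tN; apply: h => _.
  by rewrite /u ifF //; apply/negP; rewrite inE.
exists u; split=> //.
- move=> t t0; rewrite /u; case: ifPn => // tN; have [h1 h2] := nN t tN.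
  by apply: h1; rewrite lt_neqAle eq_sym h2.
- split=> t t0.
    rewrite (pw1 t t0); congr (_ + _); apply: itg_ae_eq => //.
    by apply: (@filterS _ _ (ae_filter_ringOfSetsType mu) _ _ _ aeN) => z hz z0; rewrite -hz.
  rewrite (pw2 t t0); congr (_ + _); apply: itg_ae_eq => //.
  by apply: (@filterS _ _ (ae_filter_ringOfSetsType mu) _ _ _ aeN) => z hz z0; rewrite -hz.
Qed.

Definition start x y u (x0 y0 : U) := [/\ traj O x y u, x 0 = x0 & y 0 = y0].

(* Twice the cost is at most [c], stated without extended reals. *)
Definition bdd x (c : R) := forall t : R, 0 <= t -> en x 0 t <= c.

Definition minimal x y u (x0 y0 : U) (c : R) := [/\ start x y u x0 y0, bdd x c &
  forall x' y' u' c', start x' y' u' x0 y0 -> bdd x' c' -> c <= c'].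

Lemma traj_vlbm x y u : traj O x y u -> [/\ vlbm x, vlbm y & vlbm u].
Proof. by move=> tr; have [] := dyn_vlbm (traj_dyn Obnd tr); case: tr. Qed.

Definition mix (l : R) x x' (s : R) : U := vadd (vscale l (x s)) (vscale (1 - l) (x' s)).

Lemma start_mix (l : R) x y u x' y' u' (x0 y0 : U) : 0 <= l <= 1 ->
  start x y u x0 y0 -> start x' y' u' x0 y0 ->
  start (mix l x x') (mix l y y') (mix l u u') x0 y0.
Proof.
move=> l01 [tr x00 y00] [tr' x00' y00'].
have [lx ly lu] := traj_vlbm tr; have [lx' ly' lu'] := traj_vlbm tr'.
case: tr tr' => [_ Ou [py1 py2] [px1 px2]] [_ Ou' [py1' py2'] [px1' px2']].
case: (ly) (lu) (ly') (lu') => [ly1 ly2] [lu1 lu2] [ly1' ly2'] [lu1' lu2'].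
have mprim (f f' g g' : R -> R) : prim f g -> prim f' g' -> lbm g -> lbm g' ->
    prim (fun s => l * f s + (1 - l) * f' s) (fun s => l * g s + (1 - l) * g' s).
  by move=> p1 p2 l1 l2; apply: primD; [exact: primZ|exact: primZ|exact: lbmZ|exact: lbmZ].
split.
- split.
  + by split; apply: lbmD; exact: lbmZ.
  + by move=> s s0; apply: Oconv => //; [exact: Ou|exact: Ou'].
  + by split; exact: mprim.
  + by split; exact: mprim.
- rewrite /mix /vadd /vscale x00 x00' /= -!mulrDl addrC subrK !mul1r.
  by rewrite -surjective_pairing.
- rewrite /mix /vadd /vscale y00 y00' /= -!mulrDl addrC subrK !mul1r.
  by rewrite -surjective_pairing.
Qed.

(** By convexity the midpoint of the two motions is a competitor, so its energy bounds are at least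
    [cs]. The parallelogram identity leaves only the excesses of [c] and [c'] over [cs] for the
    energy of the difference. *)
Lemma parallelogram x y u x' y' u' (x0 y0 : U) (c c' cs : R) :
  start x y u x0 y0 -> start x' y' u' x0 y0 -> bdd x c -> bdd x' c' ->
  (forall x'' y'' u'' c'', start x'' y'' u'' x0 y0 -> bdd x'' c'' -> cs <= c'') ->
  forall t : R, 0 <= t -> en (fun s => vsub (x s) (x' s)) 0 t <= 2 * (c - cs) + 2 * (c' - cs).
Proof.
move=> st st' bx bx' hcs t t0; have [tr _ _] := st; have [tr' _ _] := st'.
have [lx _ _] := traj_vlbm tr; have [lx' _ _] := traj_vlbm tr'.
pose l : R := 2^-1.
have l01 : 0 <= l <= 1 by rewrite /l; apply/andP; split; lra.
have smid := start_mix l01 st st'.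
have [lmx _ _] := traj_vlbm (let: And3 h _ _ := smid in h).
set D := fun s => vsub (x s) (x' s).
have lD : vlbm D by exact: vlbm_sub.
have ide s : 0 <= s -> en (mix l x x') 0 s = 2^-1 * en x 0 s + 2^-1 * en x' 0 s - 4^-1 * en D 0 s.
  move=> s0; rewrite /en.
  have d1 := lbm_dot lx lx; have d2 := lbm_dot lx' lx'; have d3 := lbm_dot lD lD.
  rewrite -!itgZ // -itgD //; [|exact: lbmZ|exact: lbmZ].
  rewrite -itgB //; [|by apply: lbmD; exact: lbmZ|exact: lbmZ].
  apply: eq_itg => z _; rewrite /mix /D vsubE /dot /vadd /vscale /= /l.
  by field.
(* A bound on the midpoint is needed at all times [s]. It is read off at the later of [s] and [t],
   where the energy of the difference is already at least [en D 0 t]. *)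
have bm : bdd (mix l x x') ((2 * c + 2 * c' - en D 0 t) / 4).
  move=> s s0; pose s' := Num.max s t.
  have ss : s <= s' by rewrite le_max lexx.
  have ts : t <= s' by rewrite le_max lexx orbT.
  have s0' := le_trans s0 ss.
  apply: le_trans (en_mono lmx (lexx 0) s0 ss) _.
  rewrite ide //.
  have := bx s' s0'; have := bx' s' s0'; have := en_mono lD (lexx 0) t0 ts; lra.
have := hcs _ _ _ _ smid bm; lra.
Qed.

Lemma pow5_le (m e : R) : 0 <= e -> m ^+ 5 <= e ^+ 5 -> m <= e.
Proof.
move=> e0 h; rewrite leNgt; apply/negP => em; move: h; rewrite leNgt => /negP; apply.
by rewrite ltr_pXn2r // nnegrE // ltW // (le_lt_trans e0).
Qed.

Lemma minimal_exists (x0 y0 : U) : exists x y u c, minimal x y u x0 y0 c.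
Proof.
pose A := [set c : R | exists x y u, start x y u x0 y0 /\ bdd x c].
have A0 : A !=set0.
  have [K [K0 HK]] := steer_tail r0 Obox.
  have [x [y [u [lu Ou py px [x00 y00 hx]]]]] := HK 0 x0 y0 (lexx 0).
  by exists (K * mq x0 y0 ^+ 5); exists x, y, u.
have lbA : lbound A 0.
  by move=> c [x [y [u [_ b]]]]; apply: le_trans (b 0 (lexx _)); exact: en_ge0.
have hA : has_inf A by split=> //; exists 0.
set cs := inf A.
have csle x y u c : start x y u x0 y0 -> bdd x c -> cs <= c.
  by move=> h1 h2; apply: ge_inf; [exists 0|exists x, y, u].
have exX n : exists z : (R -> U) * (R -> U) * (R -> U),
    start z.1.1 z.1.2 z.2 x0 y0 /\ bdd z.1.1 (cs + n.+1%:R^-1).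
  have e0 : 0 < n.+1%:R^-1 :> R by rewrite invr_gt0 ltr0n.
  have [c [x [y [u [h1 h2]]]] hc] := inf_adherent e0 hA.
  by exists (x, y, u); split=> //= t t0; apply: le_trans (h2 t t0) (ltW hc).
have [X HX] := choice exX.
pose xn n := (X n).1.1; pose yn n := (X n).1.2; pose un n := (X n).2.
have sn n : start (xn n) (yn n) (un n) x0 y0 by have [] := HX n.
have bn n : bdd (xn n) (cs + n.+1%:R^-1) by have [] := HX n.
have trn n : traj O (xn n) (yn n) (un n) by have [] := sn n.
have dn n := traj_dyn Obnd (trn n).
have [c [d [c0 d0 Hint]]] := interp (ltW (addr_gt0 bound_gt0 bound_gt0)).
have inv_lt (e : R) : 0 < e -> exists N, forall n, (N <= n)%N -> n.+1%:R^-1 <= e.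
  move=> e0; exists (Num.truncn e^-1) => n Nn.
  rewrite -[leRHS]invrK lef_pV2 ?posrE ?invr_gt0 ?ltr0n //.
  by apply: le_trans (ltW (truncnS_gt _)) _; rewrite ler_nat.
have cau (e : R) : 0 < e -> exists N, forall n m, (N <= n)%N -> (N <= m)%N ->
    forall t : R, 0 <= t -> mq (vsub (xn n t) (xn m t)) (vsub (yn n t) (yn m t)) <= e.
  move=> e0; have [|N hN] := inv_lt (c * e ^+ 5 / 4).
    by rewrite divr_gt0 // mulr_gt0 // exprn_gt0.
  exists N => n m Nn Nm t t0; apply: pow5_le; first exact: ltW.
  have h1 := Hint _ _ _ (dyn_sub (dn n) (dn m)) t t0.
  set m5 := mq _ _ in h1 *.
  have m50 : 0 <= m5 by exact: mq_ge0.
  have [lxn _ _] := traj_vlbm (trn n); have [lxm _ _] := traj_vlbm (trn m).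
  have tt : t <= t + d * m5 by rewrite lerDl mulr_ge0 // ltW.
  have h2 := parallelogram (sn n) (sn m) (bn n) (bn m) csle (le_trans t0 tt).
  rewrite (en_split (vlbm_sub lxn lxm) (lexx 0) t0 tt) in h2.
  have h3 := en_ge0 (fun s => vsub (xn n s) (xn m s)) 0 t.
  have h4 := hN n Nn; have h5 := hN m Nm.
  rewrite -(ler_pM2l c0); apply: le_trans h1 _.
  move: h2 h3 h4 h5; set i1 := n.+1%:R^-1; set i2 := m.+1%:R^-1.
  move: (en _ 0 t) (en _ t _) i1 i2 (c * e ^+ 5) => E1 E2 i1 i2 E3; lra.
(* Positions are controlled by the square of [mq] and velocities by [mq] itself; lowering the
   tolerance to at most 1 treats both at once. *)
have cau1 (f : nat -> R -> R) : (forall n m t, `|f n t - f m t| <=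
      mq (vsub (xn n t) (xn m t)) (vsub (yn n t) (yn m t)) ^+ 2 \/ `|f n t - f m t| <=
      mq (vsub (xn n t) (xn m t)) (vsub (yn n t) (yn m t))) -> exists g, ulim f g.
  move=> hf; apply: unif_cauchy => e e0.
  pose e1 := Num.min e 1.
  have e10 : 0 < e1 by rewrite lt_min e0 ltr01.
  have e1e : e1 <= e by rewrite ge_min lexx.
  have e11 : e1 <= 1 by rewrite ge_min lexx orbT.
  have [N hN] := cau e1 e10; exists N => n m Nn Nm t t0.
  have h1 := hN n m Nn Nm t t0.
  have [h|h] := hf n m t; apply: (le_trans h); last exact: le_trans e1e.
  set q := mq _ _ in h1 *; have q0 : 0 <= q by exact: mq_ge0.
  have q1 := le_trans h1 e11.
  by apply: le_trans e1e; rewrite expr2; apply: le_trans h1; apply: ler_piMr.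
have [x1 ux1] : exists g, ulim (fun n t => (xn n t).1) g.
  apply: cau1 => n m t; left; apply: le_trans (mq_fst _ _).
  by have := enorm_fst (vsub (xn n t) (xn m t)); rewrite vsubE.
have [x2 ux2] : exists g, ulim (fun n t => (xn n t).2) g.
  apply: cau1 => n m t; left; apply: le_trans (mq_fst _ _).
  by have := enorm_snd (vsub (xn n t) (xn m t)); rewrite vsubE.
have [y1 uy1] : exists g, ulim (fun n t => (yn n t).1) g.
  apply: cau1 => n m t; right; apply: le_trans (mq_snd _ _).
  by have := enorm_fst (vsub (yn n t) (yn m t)); rewrite vsubE.
have [y2 uy2] : exists g, ulim (fun n t => (yn n t).2) g.
  apply: cau1 => n m t; right; apply: le_trans (mq_snd _ _).
  by have := enorm_snd (vsub (yn n t) (yn m t)); rewrite vsubE.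
pose x t : U := (x1 t, x2 t); pose y t : U := (y1 t, y2 t).
(* The controls of the sequence need not converge. What passes to the limit are the linear
   inequalities on the increments of the velocities, and these produce a control for the limit. *)
have [u [lu Ou py]] : exists u, [/\ vlbm u, forall t, 0 <= t -> O (u t) & vprim y u].
  apply: lip_traj => p h s t hp s0 st; have t0 := le_trans s0 st.
  apply: (@lip_ulim (fun n t => dot p (yn n t)) (fun t => dot p (y t))) => //.
    move=> e e0; pose e' := e / (`|p.1| + `|p.2| + 1).
    have den0 : 0 < `|p.1| + `|p.2| + 1 by rewrite ltr_wpDl // addr_ge0.
    have e'0 : 0 < e' by rewrite divr_gt0.
    have [N1 h1] := uy1 e' e'0; have [N2 h2] := uy2 e' e'0.
    exists (maxn N1 N2) => n; rewrite geq_max => /andP[n1 n2] z z0.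
    have -> : dot p (yn n z) - dot p (y z) =
      p.1 * ((yn n z).1 - y1 z) + p.2 * ((yn n z).2 - y2 z) by rewrite /dot /=; ring.
    apply: le_trans (ler_normD _ _) _; rewrite !normrM.
    have := ler_wpM2l (normr_ge0 p.1) (h1 n n1 z z0).
    have := ler_wpM2l (normr_ge0 p.2) (h2 n n2 z z0).
    have : (`|p.1| + `|p.2| + 1) * e' = e by rewrite /e'; field; exact: lt0r_neq0.
    lra.
  move=> n; have [lun Oun [py1 py2] _] := trn n; case: (lun) => lun1 lun2.
  have pd : prim (fun t => dot p (yn n t)) (fun t => dot p (un n t)).
    by apply: primD; [exact: primZ|exact: primZ|exact: lbmZ|exact: lbmZ].
  rewrite (prim_itg pd) //; last exact: (lbm_dot (vlbm_cst p) lun).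
  rewrite -itg_cst //; apply: le_itg => //.
  - exact: (lbm_dot (vlbm_cst p) lun).
  - exact: lbm_cst.
  - by move=> z /andP[sz _]; apply: hp; apply: Oun; exact: le_trans sz.
have ly := vlbm_prim py lu; case: (ly) => ly1 ly2.
have lyn n : vlbm (yn n) by have [] := traj_vlbm (trn n).
have px : vprim x y.
  split.
    apply: (prim_ulim ux1 uy1) => // n; last by have [] := lyn n.
    by have [_ _ _ []] := trn n.
  apply: (prim_ulim ux2 uy2) => // n; last by have [] := lyn n.
  by have [_ _ _ []] := trn n.
have lx := vlbm_prim px ly; case: (lx) => lx1 lx2.
have lim0 (f : nat -> R -> R) g (k : R) : ulim f g -> (forall n, f n 0 = k) -> g 0 = k.
  move=> uf fk; apply/esym/eqP; rewrite -subr_eq0 -normr_le0.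
  apply/ler_addgt0Pr => e e0; rewrite add0r; have [N hN] := uf e e0.
  by have := hN N (leqnn _) 0 (lexx _); rewrite fk.
exists x, y, u, cs; split.
- split=> //.
    rewrite /x (surjective_pairing x0); congr pair.
      by apply: (lim0 _ _ _ ux1) => n; have [_ -> _] := sn n.
    by apply: (lim0 _ _ _ ux2) => n; have [_ -> _] := sn n.
  rewrite /y (surjective_pairing y0); congr pair.
    by apply: (lim0 _ _ _ uy1) => n; have [_ _ ->] := sn n.
  by apply: (lim0 _ _ _ uy2) => n; have [_ _ ->] := sn n.
- move=> t t0.
  have [B1 hB1] := lx1.2 t; have [B2 hB2] := lx2.2 t.
  have B10 : 0 <= B1 by rewrite (le_trans (normr_ge0 _) (hB1 0 _)) // lexx.
  have B20 : 0 <= B2 by rewrite (le_trans (normr_ge0 _) (hB2 0 _)) // lexx.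
  apply/ler_addgt0Pr => e e0.
  (* Half of [e] pays for replacing [x] by [xn n] on [[0, t]], the other half for the excess of
     [xn n] over the infimum. *)
  pose e1 := e / 2 / (2 * (B1 + B2) * t + 1).
  have den : 0 < 2 * (B1 + B2) * t + 1.
    by rewrite ltr_wpDl // mulr_ge0 // mulr_ge0 // addr_ge0.
  have e10 : 0 < e1 by rewrite divr_gt0 // divr_gt0.
  have [N1 h1] := ux1 e1 e10; have [N2 h2] := ux2 e1 e10.
  have [N3 h3] := inv_lt (e / 2) (divr_gt0 e0 (ltr0Sn _ 1)).
  pose n := maxn N3 (maxn N1 N2).
  have n1 : (N1 <= n)%N by rewrite /n !leq_max leqnn orbT.
  have n2 : (N2 <= n)%N by rewrite /n !leq_max leqnn !orbT.
  have n3 : (N3 <= n)%N by rewrite /n !leq_max leqnn.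
  have a1 := bn n t t0; have a2 := h3 n n3.
  have [lxn _ _] := traj_vlbm (trn n).
  have a3 : en x 0 t <= en (xn n) 0 t + 2 * (B1 + B2) * e1 * (t - 0).
    have ldn := lbm_dot lxn lxn.
    have lc := lbm_cst (2 * (B1 + B2) * e1).
    rewrite -itg_cst // /en -itgD //; apply: le_itg => //; first exact: lbm_dot.
      exact: lbmD.
    move=> z /andP[z0 zt].
    have sq (p q b : R) : `|q - p| <= e1 -> `|p| <= b -> p * p <= q * q + 2 * b * e1.
      move=> h4 h5.
      have h6 : - (2 * b * e1) <= 2 * p * (q - p).
        have : `|2 * p * (q - p)| <= 2 * b * e1.
          by rewrite !normrM (ger0_norm (ler0n _ 2)) -!mulrA ler_wpM2l // ler_pM.
        by rewrite ler_norml => /andP[].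
      have h7 := sqr_ge0 (q - p).
      have -> : q * q = p * p + 2 * p * (q - p) + (q - p) ^+ 2 by ring.
      lra.
    have zz : 0 <= z <= t by rewrite z0 zt.
    have := sq _ _ _ (h1 n n1 z z0) (hB1 z zz); have := sq _ _ _ (h2 n n2 z z0) (hB2 z zz).
    rewrite /dot /=; lra.
  have a4 : 2 * (B1 + B2) * e1 * (t - 0) <= e / 2.
    have : (2 * (B1 + B2) * t + 1) * e1 = e / 2 by rewrite /e1; field; exact: lt0r_neq0.
    lra.
  move: (n.+1%:R^-1) a1 a2 => i a1 a2; lra.
- exact: csle.
Qed.

End Existence.

(** * Optimal motions: uniqueness and rest in finite time *)

Section FiniteTime.
Variable R : realType.
Notation U := (R * R)%type.
Implicit Types (f g : R -> R) (x y u : R -> U) (a b v w p : U).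
Variables (O : set U) (r M : R).
Hypothesis r0 : 0 < r.
Hypothesis Obox : forall v, `|v.1| <= r -> `|v.2| <= r -> O v.
Hypothesis Obnd : forall v, O v -> `|v.1| <= M /\ `|v.2| <= M.
Hypothesis Oconv : forall v w (l : R), O v -> O w -> 0 <= l <= 1 ->
  O (vadd (vscale l v) (vscale (1 - l) w)).
Hypothesis Osep : forall v, ~ O v -> exists p (h : R),
  (forall w, O w -> dot p w <= h) /\ h < dot p v.

Let M0 : 0 < M := bound_gt0 r0 Obox Obnd.

(** Optimality expressed through energy bounds: a competitor of infinite cost satisfies no [bdd] and
    imposes nothing. *)
Definition opt x y u (x0 y0 : U) := start O x y u x0 y0 /\
  forall x' y' u' c, start O x' y' u' x0 y0 -> bdd x' c -> bdd x c.

Lemma minimal_opt x y u (x0 y0 : U) c : minimal O x y u x0 y0 c -> opt x y u x0 y0.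
Proof.
move=> [s b m]; split=> // x' y' u' c' s' b' t t0.
exact: le_trans (b t t0) (m _ _ _ _ s' b').
Qed.

Lemma opt_exists (x0 y0 : U) : exists x y u, opt x y u x0 y0.
Proof.
have [x [y [u [c m]]]] := minimal_exists r0 Obox Obnd Oconv Osep x0 y0.
by exists x, y, u; exact: minimal_opt m.
Qed.

Lemma en_eq0 (M' : R) x y u (s : R) : 0 <= M' -> dyn M' x y u -> 0 <= s ->
  (forall t, s <= t -> en x s t <= 0) -> x s = vzero R /\ y s = vzero R.
Proof.
move=> M'0 dd s0 h; have [c [d [c0 d0 H]]] := interp M'0.
apply: mq_le0; set m := mq _ _; have m0 : 0 <= m by exact: mq_ge0.
apply: (@pow5_le R) => //; rewrite expr0n /= -(ler_pM2l c0) mulr0.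
apply: le_trans (H _ _ _ dd s s0) _; apply: h.
by rewrite lerDl mulr_ge0 // ltW.
Qed.

Lemma vsub_eq0 a b : vsub a b = vzero R -> a = b.
Proof.
rewrite vsubE => -[/eqP h1 /eqP h2].
by rewrite (surjective_pairing a) (surjective_pairing b); congr pair; apply/eqP; rewrite -subr_eq0.
Qed.

Lemma opt_unique x y u x' y' u' (x0 y0 : U) : opt x y u x0 y0 -> opt x' y' u' x0 y0 ->
  forall t : R, 0 <= t -> x t = x' t /\ y t = y' t.
Proof.
move=> [s1 o1] [s2 o2] t t0.
have [xm [ym [um [c [sm bm mm]]]]] := minimal_exists r0 Obox Obnd Oconv Osep x0 y0.
have b1 := o1 _ _ _ _ sm bm; have b2 := o2 _ _ _ _ sm bm.
have P := parallelogram Obnd Oconv s1 s2 b1 b2 mm.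
have [tr1 _ _] := s1; have [tr2 _ _] := s2.
have dd := dyn_sub (traj_dyn Obnd tr1) (traj_dyn Obnd tr2).
have [l1 _ _] := traj_vlbm Obnd tr1; have [l2 _ _] := traj_vlbm Obnd tr2.
have [] := en_eq0 (ltW (addr_gt0 M0 M0)) dd t0.
  move=> s ts; have := P s (le_trans t0 ts).
  rewrite (en_split (vlbm_sub l1 l2) (lexx 0) t0 ts) subrr mulr0 addr0.
  have := en_ge0 (fun s => vsub (x s) (x' s)) 0 t; lra.
by move=> /vsub_eq0 h1 /vsub_eq0 h2.
Qed.

(* Otherwise it would be cheaper to follow the optimal trajectory up to time [s]
   and then steer to rest. *)
Lemma opt_tail : exists K : R, 0 < K /\ forall x y u (x0 y0 : U), opt x y u x0 y0 ->
  forall s t : R, 0 <= s -> s <= t -> en x s t <= K * mq (x s) (y s) ^+ 5.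
Proof.
have [K [K0 H]] := steer r0 Obox; exists K; split=> // x y u x0 y0 [[tr xx yy] o] s t s0 st.
have [x' [y' [u' [tr' x0' y0' _ [xe hx]]]]] := H _ _ _ tr s s0.
have [lx _ _] := traj_vlbm Obnd tr; have [lx' _ _] := traj_vlbm Obnd tr'.
have st' : start O x' y' u' x0 y0 by split=> //; rewrite ?x0' ?y0'.
have es : en x' 0 s = en x 0 s.
  by apply: eq_itg => z /andP[_ zs]; rewrite xe.
have K5 : 0 <= K * mq (x s) (y s) ^+ 5 by rewrite mulr_ge0 ?exprn_ge0 ?mq_ge0 // ltW.
have b' : bdd x' (en x 0 s + K * mq (x s) (y s) ^+ 5).
  move=> z z0; have [zs|sz] := leP z s.
    by have := en_mono lx' (lexx 0) z0 zs; rewrite es; lra.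
  rewrite (en_split lx' (lexx 0) s0 (ltW sz)) es lerD2l.
  by apply: hx; exact: ltW.
have := o _ _ _ _ st' b' t (le_trans s0 st).
by rewrite (en_split lx (lexx 0) s0 st) lerD2l.
Qed.

Lemma root5 (z : R) : 0 <= z -> exists q : R, 0 <= q /\ q ^+ 5 = z.
Proof.
move=> z0; exists (powR z (5^-1)); split; first exact: powR_ge0.
by rewrite -powR_mulrn ?powR_ge0 // -powRrM mulVf ?powRr1 // pnatr_eq0.
Qed.

(** The estimate may be started at any time [s]. At a point of rest it says that rest is never left,
    and at later times it is what makes the rest time depend continuously on the start. *)
Lemma finite_time : exists C : R, 0 < C /\ forall x y u (x0 y0 : U), opt x y u x0 y0 ->
  forall s t : R, 0 <= s -> s + C * mq (x s) (y s) <= t -> x t = vzero R /\ y t = vzero R.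
Proof.
have [K [K0 HK]] := opt_tail.
have [c [d [c0 d0 Hint]]] := interp (ltW M0).
have [k [k0 kE]] := root5 (ltW K0).
have kp : 0 < k.
  by rewrite lt_neqAle k0 andbT; apply/eqP => k00; move: K0; rewrite -kE -k00 expr0n /= ltxx.
(* With [w <= k * m], a drop of [w^5] by [c * m^5] forces [c * m <= 5 * k^4 * (w - w')]. Hence the
   elapsed time [d * m] is at most [B * (w - w')]. *)
pose B := 5 * k ^+ 4 * d / c.
have B0 : 0 < B by rewrite divr_gt0 // mulr_gt0 // mulr_gt0 ?exprn_gt0.
exists (B * k); split; first exact: mulr_gt0.
move=> x y u x0 y0 op s t s0 hst.
have [[tr _ _] _] := op.
have [lx ly _] := traj_vlbm Obnd tr; have dd := traj_dyn Obnd tr.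
have tail := HK _ _ _ _ _ op.
pose m z := mq (x z) (y z).
have m0 z : 0 <= m z by exact: mq_ge0.
pose E := [set en x 0 z | z in [set z | 0 <= z]].
have E0 : E !=set0 by exists (en x 0 0); exists 0 => /=.
have Eb : ubound E (K * m 0 ^+ 5).
  by move=> _ [z /= z0 <-]; exact: tail.
have supE : has_sup E by split=> //; exists (K * m 0 ^+ 5).
pose W z := sup E - en x 0 z.
have W_ge z z' : 0 <= z -> z <= z' -> en x z z' <= W z.
  move=> z0 zz; have : en x 0 z' <= sup E.
    by apply: ub_le_sup; [exists (K * m 0 ^+ 5)|exists z' => //=; exact: le_trans zz].
  by rewrite (en_split lx (lexx 0) z0 zz) /W; lra.
have W0 z : 0 <= z -> 0 <= W z.
  by move=> z0; apply: le_trans (W_ge z z z0 (lexx _)); exact: en_ge0.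
have W_le z : 0 <= z -> W z <= K * m z ^+ 5.
  move=> z0; rewrite /W lerBlDr; apply: ge_sup => // _ [z' /= z'0 <-].
  have [zz|/ltW zz] := leP z z'.
    by rewrite (en_split lx (lexx 0) z0 zz) addrC lerD2r; exact: tail.
  have := en_mono lx (lexx 0) z'0 zz.
  have : 0 <= K * m z ^+ 5 by rewrite mulr_ge0 ?exprn_ge0 // ltW.
  lra.
have W_dec z z' : 0 <= z -> z <= z' -> W z' = W z - en x z z'.
  by move=> z0 zz; rewrite /W (en_split lx (lexx 0) z0 zz); ring.
have [w hw] : exists w : R -> R, forall z, 0 <= z -> 0 <= w z /\ w z ^+ 5 = W z.
  have ex z : exists q : R, 0 <= z -> 0 <= q /\ q ^+ 5 = W z.
    have [z0|z0] := leP 0 z; last by exists 0 => z0'; lra.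
    by have [q hq] := root5 (W0 z z0); exists q.
  by have [w hw] := choice ex; exists w.
have w_le z : 0 <= z -> w z <= k * m z.
  move=> z0; apply: (@pow5_le R); first by rewrite mulr_ge0.
  by rewrite (hw z z0).2 exprMn kE; exact: W_le.
have w_mono z z' : 0 <= z -> z <= z' -> w z' <= w z.
  move=> z0 zz; apply: (@pow5_le R); first exact: (hw z z0).1.
  rewrite (hw z z0).2 (hw z' (le_trans z0 zz)).2 (W_dec z z' z0 zz).
  by have := en_ge0 x z z'; lra.
(* With [w = W^(1/5)]: as long as [m z > 0], some later time has a value of
   [z + B * w z] that is no larger.  The jumps may accumulate, so the rest time is
   the supremum of the reachable times. *)
have jump z : 0 <= z -> 0 < m z -> (z + d * m z) + B * w (z + d * m z) <= z + B * w z.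
  move=> z0 mz; set z' := z + d * m z.
  have zz : z <= z' by rewrite lerDl mulr_ge0 // ltW.
  have z'0 := le_trans z0 zz.
  have h1 : c * m z ^+ 5 <= W z - W z'.
    by rewrite (W_dec z z' z0 zz) opprB addrC subrK; exact: (Hint _ _ _ dd z z0).
  rewrite -(hw z z0).2 -(hw z' z'0).2 in h1.
  have wm := w_mono z z' z0 zz.
  have [w0 _] := hw z z0; have [w'0 _] := hw z' z'0.
  have h2 : w z ^+ 5 - w z' ^+ 5 <= 5 * w z ^+ 4 * (w z - w z').
    have p i : w z' ^+ i <= w z ^+ i by rewrite lerXn2r ?nnegrE.
    have -> : w z ^+ 5 - w z' ^+ 5 = (w z - w z') * (w z ^+ 4 + w z ^+ 3 * w z' ^+ 1
      + w z ^+ 2 * w z' ^+ 2 + w z * w z' ^+ 3 + w z' ^+ 4) by ring.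
    rewrite [leRHS]mulrC; apply: ler_wpM2l; first lra.
    have q i j : w z ^+ i * w z' ^+ j <= w z ^+ i * w z ^+ j.
      by apply: ler_wpM2l; [exact: exprn_ge0|exact: p].
    have := q 3%N 1%N; have := q 2%N 2%N; have := q 1%N 3%N; have := p 4%N.
    rewrite -!exprD !expr1 /=; lra.
  have h3 : w z ^+ 4 <= (k * m z) ^+ 4 by rewrite lerXn2r ?nnegrE ?mulr_ge0 ?w_le.
  have h4 : 5 * w z ^+ 4 * (w z - w z') <= 5 * (k * m z) ^+ 4 * (w z - w z').
    by apply: ler_wpM2r; lra.
  have h5 : c * m z <= 5 * k ^+ 4 * (w z - w z').
    rewrite -(ler_pM2r (exprn_gt0 4 mz)).
    have -> : c * m z * m z ^+ 4 = c * m z ^+ 5 by ring.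
    have -> : 5 * k ^+ 4 * (w z - w z') * m z ^+ 4 = 5 * (k * m z) ^+ 4 * (w z - w z').
      by ring.
    lra.
  have h6 : d * m z <= B * (w z - w z').
    have -> : B * (w z - w z') = (5 * k ^+ 4 * (w z - w z')) * (d / c).
      by rewrite /B; field; exact: lt0r_neq0.
    have -> : d * m z = c * m z * (d / c) by field; exact: lt0r_neq0.
    by apply: ler_wpM2r => //; rewrite divr_ge0 // ltW.
  rewrite /z' in h6 *; lra.
pose S := [set z | s <= z /\ z + B * w z <= s + B * w s].
have Sn : S !=set0 by exists s; split.
have Sub : ubound S (s + B * w s).
  move=> z [sz hz]; have := mulr_ge0 (ltW B0) (hw z (le_trans s0 sz)).1; lra.
have supS : has_sup S by split=> //; exists (s + B * w s).
set T := sup S.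
have sT : s <= T by apply: ub_le_sup; [exists (s + B * w s)|split].
have T0 := le_trans s0 sT.
(* Since [w] is nonincreasing, [S] contains its supremum. A positive [m T] would then allow one more
   jump beyond [T]. *)
have TS : T + B * w T <= s + B * w s.
  rewrite -lerBrDr; apply: ge_sup => // z [sz hz]; rewrite lerBrDr.
  apply: (le_trans _ hz); rewrite lerD2l; apply: ler_wpM2l; first exact: ltW.
  apply: w_mono.
    exact: le_trans sz.
  by apply: ub_le_sup; [exists (s + B * w s)|split].
have mT : m T = 0.
  apply/eqP; rewrite eq_le m0 andbT leNgt; apply/negP => mT.
  have h1 : S (T + d * m T).
    split; first by rewrite (le_trans sT) // lerDl mulr_ge0 // ltW.
    exact: le_trans (jump T T0 mT) TS.
  have : T + d * m T <= T by apply: ub_le_sup => //; exists (s + B * w s).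
  by rewrite gerDl leNgt mulr_gt0.
have WT : W T <= 0 by apply: le_trans (W_le T T0) _; rewrite mT expr0n /= mulr0.
have Tt : T <= t.
  apply: le_trans hst; have := mulr_ge0 (ltW B0) (hw T T0).1.
  have := ler_wpM2l (ltW B0) (w_le s s0); rewrite -/(m s) -mulrA; lra.
have t0 := le_trans T0 Tt.
apply: (en_eq0 (ltW M0) dd t0) => z tz.
apply: le_trans (W_ge t z t0 tz) _; rewrite (W_dec T t T0 Tt).
by have := en_ge0 x T t; lra.
Qed.

End FiniteTime.

(** * Consequences of the adjoint system and the maximum condition *)

Section Adjoint.
Variable R : realType.
Notation mu := (@lebesgue_measure R).
Notation U := (R * R)%type.
Implicit Types (f g : R -> R) (x y u phi psi : R -> U) (a b v w p : U).

Lemma itg0_ae f (S : R) : lbm f -> (forall t, 0 <= f t) -> itg f 0 S <= 0 ->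
  {ae mu, forall t : R, 0 <= t <= S -> f t = 0}.
Proof.
move=> lf f0 h.
have mf : measurable_fun (`[0, S]%classic : set R) f.
  by apply: measurable_funS lf.1 => // z /=; rewrite !in_itv /= andbT => /andP[].
have I0 : itg f 0 S = 0 by apply/le_anti; rewrite h itg_ge0.
have [+ _] := @ae_eq_integral_abs _ _ R mu `[0, S]%classic (measurable_itv _) (EFin \o f)
  ((measurable_EFinP _ _).2 mf).
have -> : (\int[mu]_(z in `[0%R, S]) `|(EFin \o f) z| = 0)%E.
  have -> : (\int[mu]_(z in `[0%R, S]) `|(EFin \o f) z| = \int[mu]_(z in `[0%R, S]) (f z)%:E)%E.
    by apply: eq_integral => z _ /=; rewrite ger0_norm.
  rewrite -[LHS]fineK; last exact: integrable_fin_num (lbm_integrable S lf (lexx 0)).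
  by congr EFin.
move=> /(_ erefl); apply: (@filterS _ _ (ae_filter_ringOfSetsType mu)) => t ht t0S.
by have := ht; rewrite /= in_itv /= => /(_ t0S) [].
Qed.

(** A positive value at [s] would persist with at least half its size for a short time, as [f] is
    Lipschitz near [s], and the integral over that time would be positive. *)
Lemma prim_neg f g (s : R) : prim f g -> lbm g -> 0 <= s ->
  (forall t, s <= t -> itg f s t <= 0) -> f s <= 0.
Proof.
move=> pf lg s0 h; rewrite leNgt; apply/negP => fs.
have lf := lbm_prim pf lg.
have [L hL] := lg.2 (s + 1).
have L0 : 0 <= L by apply: le_trans (normr_ge0 _) (hL s _); lra.
pose d := Num.min 1 (f s / (2 * (L + 1))).
have den : 0 < 2 * (L + 1) by lra.
have d0 : 0 < d by rewrite lt_min ltr01 divr_gt0.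
have d1 : d <= 1 by rewrite ge_min lexx.
have dL : d * (2 * (L + 1)) <= f s by rewrite -ler_pdivlMr // ge_min lexx orbT.
have : f s / 2 * (s + d - s) <= itg f s (s + d).
  rewrite -itg_cst; last lra.
  apply: le_itg => //; first exact: lbm_cst.
  move=> t /andP[st td].
  have h1 : `|f t - f s| <= L * (t - s).
    by apply: (prim_lip pf) => // z /andP[z1 z2]; apply: hL; lra.
  have h2 : L * (t - s) <= L * d by apply: ler_wpM2l => //; lra.
  move: h1; rewrite ler_norml => /andP[h3 h4]; nra.
have := h (s + d) ltac:(lra).
have : 0 < f s / 2 * (s + d - s) by rewrite mulr_gt0 // ?divr_gt0 //; lra.
lra.
Qed.

(** In the product rule the terms [- <phi, y>] and [<phi, y>] cancel. The derivative [w] of [phi] is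
    kept separate from [x] because the state may be a difference of two motions while [w] belongs to
    one of them. *)
Lemma pairing x y u phi psi (w : R -> U) : vprim phi w -> vlbm w ->
  vprim psi (fun t => vscale (-1) (phi t)) -> vprim x y -> vprim y u -> vlbm u ->
  prim (fun t => dot (psi t) (y t) + dot (phi t) (x t))
       (fun t => dot (psi t) (u t) + dot (w t) (x t)).
Proof.
move=> pphi lw ppsi px py lu.
have lphi := vlbm_prim pphi lw.
have lmphi : vlbm (fun t => vscale (-1) (phi t)).
  by case: lphi => l1 l2; split; exact: lbmZ.
have ly := vlbm_prim py lu.
have lpsi := vlbm_prim ppsi lmphi; have lx := vlbm_prim px ly.
case: pphi ppsi px py => [pa1 pa2] [pb1 pb2] [pc1 pc2] [pd1 pd2].
case: lw lphi lmphi lu => [lw1 lw2] [la1 la2] [lm1 lm2] [lu1 lu2].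
case: ly lpsi lx => [ly1 ly2] [ls1 ls2] [lx1 lx2].
have q1 := primM pb1 pd1 lm1 lu1; have q2 := primM pb2 pd2 lm2 lu2.
have q3 := primM pa1 pc1 lw1 ly1; have q4 := primM pa2 pc2 lw2 ly2.
have k1 := lbmD (lbmM lm1 ly1) (lbmM ls1 lu1).
have k2 := lbmD (lbmM lm2 ly2) (lbmM ls2 lu2).
have k3 := lbmD (lbmM lw1 lx1) (lbmM la1 ly1).
have k4 := lbmD (lbmM lw2 lx2) (lbmM la2 ly2).
apply: prim_ext (primD (primD q1 q2 k1 k2) (primD q3 q4 k3 k4) (lbmD k1 k2) (lbmD k3 k4)) _ _.
  by move=> t _; rewrite /dot.
by move=> t _; rewrite /dot /vscale /=; ring.
Qed.

Variables (O : set U) (r M : R).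
Hypothesis r0 : 0 < r.
Hypothesis Obox : forall v, `|v.1| <= r -> `|v.2| <= r -> O v.
Hypothesis Obnd : forall v, O v -> `|v.1| <= M /\ `|v.2| <= M.

Let M0 : 0 < M := bound_gt0 r0 Obox Obnd.

Let O0 : O (vzero R).
Proof. by apply: Obox; rewrite normr0 ltW. Qed.

Definition adj x u phi psi := [/\ vprim phi x, vprim psi (fun t => vscale (-1) (phi t)) &
  {ae mu, forall t : R, 0 <= t -> forall v, O v -> dot (psi t) v <= dot (psi t) (u t)}].

Definition zero_from x y (S : R) := forall t, S <= t -> x t = vzero R /\ y t = vzero R.

Lemma adj_vlbm x u phi psi : vlbm x -> adj x u phi psi -> vlbm phi /\ vlbm psi.
Proof.
move=> lx [p1 p2 _]; have lphi := vlbm_prim p1 lx; split=> //.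
apply: vlbm_prim p2 _; case: lphi => l1 l2; split; exact: lbmZ.
Qed.

Lemma adj_ae x y u phi psi x' y' u' (s t : R) : traj O x y u -> adj x u phi psi ->
  traj O x' y' u' -> 0 <= s ->
  itg (fun z => dot (psi z) (vsub (u' z) (u z))) s t <= 0.
Proof.
move=> tr ad tr' s0; have [lx ly lu] := traj_vlbm Obnd tr; have [_ _ lu'] := traj_vlbm Obnd tr'.
have [_ lpsi] := adj_vlbm lx ad; have [_ _ ae] := ad; have [_ Ou' _ _] := tr'.
apply: itg_ae_le0 => //; first exact: lbm_dot (vlbm_sub lu' lu).
apply: (@filterS _ _ (ae_filter_ringOfSetsType mu) _ _ _ ae) => z hz z0.
have := hz z0 _ (Ou' z z0); rewrite vsubE /dot /=; lra.
Qed.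

Lemma start_control u (x0 y0 : U) : vlbm u -> (forall t, 0 <= t -> O (u t)) ->
  exists x y, start O x y u x0 y0.
Proof.
move=> lu Ou.
pose y t : U := (itg (fun z => (u z).1) 0 t + y0.1, itg (fun z => (u z).2) 0 t + y0.2).
have py : vprim y u by split; exact: prim_of_itg.
pose x t : U := (itg (fun z => (y z).1) 0 t + x0.1, itg (fun z => (y z).2) 0 t + x0.2).
exists x, y; split; first by split=> //; split; exact: prim_of_itg.
  by rewrite /x !itgxx !add0r -surjective_pairing.
by rewrite /y !itgxx !add0r -surjective_pairing.
Qed.

Lemma traj_const v : O v -> exists x y, traj O x y (fun=> v).
Proof.
move=> Ov; have [x [y [tr _ _]]] := start_control (vzero R) (vzero R) (vlbm_cst v) (fun _ _ => Ov).
by exists x, y.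
Qed.

(** This supplies the missing terminal condition. After [S] the pairing is identically zero, so
    [<psi, u>] integrates to 0. By the maximum condition [<psi, v>] then has nonpositive integral
    over every later interval, hence [<psi t, v> <= 0] for each [v] in [O]. As [O] contains a box
    around 0, [psi] vanishes, and so does its derivative [- phi]. *)
Lemma adj_zero x y u phi psi (S : R) : traj O x y u -> adj x u phi psi -> 0 <= S ->
  zero_from x y S -> zero_from phi psi S.
Proof.
move=> tr ad S0 z.
have [lx ly lu] := traj_vlbm Obnd tr; have [lphi lpsi] := adj_vlbm lx ad.
have [pphi ppsi _] := ad; have [_ _ py px] := tr.
have lmphi : vlbm (fun t => vscale (-1) (phi t)).
  by case: lphi => l1 l2; split; exact: lbmZ.
have pairE := pairing pphi lx ppsi px py lu.
have ldp : lbm (fun t => dot (psi t) (u t) + dot (x t) (x t)).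
  by apply: lbmD; exact: lbm_dot.
have neg v t : O v -> S <= t -> dot (psi t) v <= 0.
  move=> Ov St; have t0 := le_trans S0 St.
  have [x' [y' tr']] := traj_const Ov.
  have lv := vlbm_cst v.
  apply: (@prim_neg (fun t => dot (psi t) v) (fun t => dot (vscale (-1) (phi t)) v)) => //.
  - case: ppsi lmphi => p1 p2 [l1 l2].
    apply: prim_ext (primD (primZ v.1 p1 l1) (primZ v.2 p2 l2) (lbmZ v.1 l1) (lbmZ v.2 l2)) _ _.
      by move=> s _; rewrite /dot; ring.
    by move=> s _; rewrite /dot; ring.
  - exact: lbm_dot.
  move=> s ts; have := adj_ae s tr ad tr' t0.
  have I0 : itg (fun z => dot (psi z) (u z) + dot (x z) (x z)) t s = 0.
    rewrite -(prim_itg pairE) //.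
    have [-> ->] := z t St; have [-> ->] := z s (le_trans St ts).
    by rewrite /dot /= !mulr0 !addr0 subrr.
  rewrite (itgD s (lbm_dot lpsi lu) (lbm_dot lx lx) t0) in I0.
  have I1 : itg (fun z => dot (x z) (x z)) t s = 0.
    rewrite (@eq_itg _ _ (fun=> 0)) ?itg0 // => q /andP[tq _].
    by have [-> _] := z q (le_trans St tq); rewrite /dot /= mulr0 addr0.
  have -> : itg (fun z => dot (psi z) (vsub v (u z))) t s =
      itg (fun z => dot (psi z) v) t s - itg (fun z => dot (psi z) (u z)) t s.
    rewrite -(itgB s (lbm_dot lpsi lv) (lbm_dot lpsi lu) t0).
    by apply: eq_itg => q _; rewrite vsubE /dot /=; ring.
  lra.
have psi0 t : S <= t -> psi t = vzero R.
  move=> St.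
  have b (c1 c2 : R) : `|c1| <= r -> `|c2| <= r -> dot (psi t) (c1, c2) <= 0.
    by move=> h1 h2; apply: neg => //; exact: Obox.
  have rr : `|r| <= r by rewrite gtr0_norm.
  have rN : `|- r| <= r by rewrite normrN.
  have r00 : `|0 : R| <= r by rewrite normr0 ltW.
  have := b r 0 rr r00; have := b (- r) 0 rN r00; have := b 0 r r00 rr; have := b 0 (- r) r00 rN.
  rewrite /dot /= !mulr0 !addr0 !add0r !mulrN !oppr_le0 !pmulr_lle0 // !pmulr_lge0 //.
  move=> h1 h2 h3 h4; rewrite (surjective_pairing (psi t)).
  by congr pair; apply/le_anti; rewrite ?h1 ?h2 ?h3 ?h4.
move=> t St; split; last exact: psi0.
have t0 := le_trans S0 St.
have I0 s : t <= s -> itg (fun q => -1 * (phi q).1) t s = 0 /\ itg (fun q => -1 * (phi q).2) t s = 0.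
  move=> ts; case: ppsi lmphi => p1 p2 [l1 l2].
  rewrite -(prim_itg p1) // -(prim_itg p2) //.
  by rewrite (psi0 t St) (psi0 s (le_trans St ts)) subrr.
have [l1 l2] := lphi; case: pphi lx => p1 p2 [lx1 lx2].
rewrite (surjective_pairing (phi t)); congr pair; apply/le_anti/andP; split.
- apply: (prim_neg p1 lx1 t0) => s ts; have [+ _] := I0 s ts; rewrite itgZ //; lra.
- rewrite -oppr_le0; apply: (prim_neg (primN p1 lx1) (lbmN lx1) t0) => s ts.
  by have [+ _] := I0 s ts; rewrite itgZ // itgN //; lra.
- apply: (prim_neg p2 lx2 t0) => s ts; have [_] := I0 s ts; rewrite itgZ //; lra.
- rewrite -oppr_le0; apply: (prim_neg (primN p2 lx2) (lbmN lx2) t0) => s ts.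
  by have [_] := I0 s ts; rewrite itgZ // itgN //; lra.
Qed.

(** Both adjoints vanish at [S] and are determined from there by the common [x]. Two triples are
    allowed because optimal controls need not be the same function. *)
Lemma adj_unique x y u phi psi x' y' u' phi' psi' (S : R) :
  traj O x y u -> adj x u phi psi -> traj O x' y' u' -> adj x' u' phi' psi' ->
  (forall t, 0 <= t -> x t = x' t) -> 0 <= S -> zero_from x y S -> zero_from x' y' S ->
  forall t : R, 0 <= t -> phi t = phi' t /\ psi t = psi' t.
Proof.
move=> tr a1 tr' a2 xx S0 z z'.
have [phiS psiS] := adj_zero tr a1 S0 z (lexx S).
have [phiS' psiS'] := adj_zero tr' a2 S0 z' (lexx S).
have cst (f g h k : R -> R) : prim f h -> prim g k -> (forall t, 0 <= t -> h t = k t) ->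
    f S = g S -> forall t, 0 <= t -> f t = g t.
  move=> pf pg hk e t t0; have I s : itg h 0 s = itg k 0 s.
    by apply: eq_itg => q /andP[q0 _]; exact: hk.
  by move: e; rewrite (pf S) // (pg S) // (pf t) // (pg t) // !I => /addIr ->.
have [[p11 p12] [q11 q12] _] := a1; have [[p21 p22] [q21 q22] _] := a2.
have e1 t : 0 <= t -> phi t = phi' t.
  move=> t0; rewrite (surjective_pairing (phi t)) (surjective_pairing (phi' t)); congr pair.
    by apply: (cst _ _ _ _ p11 p21) => // [s s0|]; rewrite ?xx ?phiS ?phiS'.
  by apply: (cst _ _ _ _ p12 p22) => // [s s0|]; rewrite ?xx ?phiS ?phiS'.
move=> t t0; split; first exact: e1.
rewrite (surjective_pairing (psi t)) (surjective_pairing (psi' t)); congr pair.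
  by apply: (cst _ _ _ _ q11 q21) => // [s s0|]; rewrite ?e1 ?psiS ?psiS'.
by apply: (cst _ _ _ _ q12 q22) => // [s s0|]; rewrite ?e1 ?psiS ?psiS'.
Qed.

Lemma en_eq_from x y (S t : R) : vlbm x -> 0 <= S -> zero_from x y S -> S <= t ->
  en x 0 t = en x 0 S.
Proof.
move=> lx S0 z St; rewrite (en_split lx (lexx 0) S0 St).
rewrite [X in _ + X](_ : _ = 0) ?addr0 // /en (@eq_itg _ _ (fun=> 0)) ?itg0 //.
by move=> q /andP[Sq _]; have [-> _] := z q Sq; rewrite /dot /= mulr0 addr0.
Qed.

(** With [D = x' - x], expand the energy of [x + D]. The cross term is the integral of [<x, D>], and
    by [pairing] it equals minus the initial pairing minus the integral of [<psi, u' - u>], which is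
    nonpositive by the maximum condition. The competitor may start anywhere and need not be at rest
    at [S]. *)
Lemma adj_ineq x y u phi psi x' y' u' (S : R) : traj O x y u -> adj x u phi psi ->
  0 <= S -> zero_from x y S -> traj O x' y' u' ->
  en x 0 S + en (fun t => vsub (x' t) (x t)) 0 S
    - 2 * (dot (psi 0) (vsub (y' 0) (y 0)) + dot (phi 0) (vsub (x' 0) (x 0)))
  <= en x' 0 S.
Proof.
move=> tr ad S0 z tr'.
have [lx ly lu] := traj_vlbm Obnd tr; have [lx' ly' lu'] := traj_vlbm Obnd tr'.
have [lphi lpsi] := adj_vlbm lx ad; have [pphi ppsi _] := ad.
have [_ _ py px] := tr; have [_ _ py' px'] := tr'.
have lD := vlbm_sub lx' lx.
have pr := pairing pphi lx ppsi (vprim_sub px' px ly' ly) (vprim_sub py' py lu' lu) (vlbm_sub lu' lu).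
have [zphi zpsi] := adj_zero tr ad S0 z (lexx S).
have := pr S S0; rewrite zphi zpsi.
rewrite (itgD S (lbm_dot lpsi (vlbm_sub lu' lu)) (lbm_dot lx lD) (lexx 0)).
have := adj_ae S tr ad tr' (lexx 0).
have -> : en x' 0 S = en x 0 S + 2 * itg (fun t => dot (x t) (vsub (x' t) (x t))) 0 S
    + en (fun t => vsub (x' t) (x t)) 0 S.
  have l1 := lbm_dot lx lx; have l2 := lbm_dot lx lD; have l3 := lbm_dot lD lD.
  rewrite /en -(itgZ 2 S l2 (lexx 0)) -(itgD S l1 (lbmZ 2 l2) (lexx 0)).
  rewrite -(itgD S (lbmD l1 (lbmZ 2 l2)) l3 (lexx 0)).
  by apply: eq_itg => t _; rewrite vsubE /dot /=; ring.
have -> : forall v, dot (vzero R) v = 0 by move=> v; rewrite /dot /= !mul0r addr0.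
have -> : forall v, dot (vzero R) v = 0 by move=> v; rewrite /dot /= !mul0r addr0.
lra.
Qed.

(** Comparison with the zero control shows that [<psi, u>] has nonnegative integral, and the pairing
    is zero at rest. What remains of [pairing] bounds the energy still to be spent. *)
Lemma adj_energy x y u phi psi (S s t : R) : traj O x y u -> adj x u phi psi ->
  0 <= S -> zero_from x y S -> 0 <= t -> t <= s ->
  en x t s <= - (dot (psi t) (y t) + dot (phi t) (x t)).
Proof.
move=> tr ad S0 z t0 ts.
have [lx ly lu] := traj_vlbm Obnd tr.
have [lphi lpsi] := adj_vlbm lx ad; have [pphi ppsi _] := ad.
have [_ _ py px] := tr.
have pr := pairing pphi lx ppsi px py lu.
have ldp : lbm (fun t => dot (psi t) (u t) + dot (x t) (x t)).
  by apply: lbmD; exact: lbm_dot.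
pose S' := Num.max S s.
have SS : S <= S' by rewrite le_max lexx.
have sS : s <= S' by rewrite le_max lexx orbT.
apply: le_trans (en_mono lx t0 ts sS) _.
have [zphi zpsi] := adj_zero tr ad S0 z SS.
have := prim_itg pr ldp t0 (le_trans ts sS).
rewrite zphi zpsi (itgD S' (lbm_dot lpsi lu) (lbm_dot lx lx) t0).
have d0 v : dot (vzero R) v = 0 by rewrite /dot /= !mul0r addr0.
rewrite !d0.
have [x' [y' tr']] := traj_const O0.
have := adj_ae S' tr ad tr' t0.
have -> : itg (fun z => dot (psi z) (vsub (vzero R) (u z))) t S' =
    - itg (fun z => dot (psi z) (u z)) t S'.
  by rewrite -(itgN S' (lbm_dot lpsi lu) t0); apply: eq_itg => q _; rewrite vsubE /dot /=; ring.
rewrite -/(en x t S'); lra.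
Qed.

Lemma adj_nonzero x y u phi psi (S t : R) : traj O x y u -> adj x u phi psi ->
  0 <= S -> zero_from x y S -> 0 <= t -> phi t = vzero R -> psi t = vzero R ->
  x t = vzero R /\ y t = vzero R.
Proof.
move=> tr ad S0 z t0 phit psit.
apply: (en_eq0 (ltW M0) (traj_dyn Obnd tr) t0) => s ts.
apply: le_trans (adj_energy tr ad S0 z t0 ts) _.
by rewrite phit psit /dot /= !mul0r !addr0 oppr0.
Qed.

End Adjoint.

(** * Optimality implies the maximum condition *)

Section MaximumPrinciple.
Variable R : realType.
Notation mu := (@lebesgue_measure R).
Notation U := (R * R)%type.
Implicit Types (f g : R -> R) (x y u phi psi : R -> U) (a b v w p : U).
Variables (O : set U) (r M : R).
Hypothesis r0 : 0 < r.
Hypothesis Obox : forall v, `|v.1| <= r -> `|v.2| <= r -> O v.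
Hypothesis Obnd : forall v, O v -> `|v.1| <= M /\ `|v.2| <= M.
Hypothesis Oconv : forall v w (l : R), O v -> O w -> 0 <= l <= 1 ->
  O (vadd (vscale l v) (vscale (1 - l) w)).

Let O0 : O (vzero R).
Proof. by apply: Obox; rewrite normr0 ltW. Qed.

(** Each [v] brings its own null set to the maximum condition, so only countably many [v] may be
    tested. For each rational point and each scale a nearby point of [O] is selected. *)
Lemma countable_dense : exists e : nat -> U, (forall n, O (e n)) /\
  forall v (d : R), O v -> 0 < d -> exists n, `|(e n).1 - v.1| <= d /\ `|(e n).2 - v.2| <= d.
Proof.
pose near_ (z : rat * rat * nat) := [set w : U | O w /\
  `|w.1 - ratr z.1.1| <= z.2.+1%:R^-1 /\ `|w.2 - ratr z.1.2| <= z.2.+1%:R^-1].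
(* When no point of [O] is near enough the default is 0, which itself lies in [O]. *)
pose e n : U := if unpickle n is Some z then xget (vzero R) (near_ z) else vzero R.
exists e; split.
  move=> n; rewrite /e; case: unpickle => [z|//].
  by case: xgetP => // w _ [].
move=> v d Ov d0.
pose k := Num.truncn (2 / d).
have k0 : 0 < k.+1%:R^-1 :> R by rewrite invr_gt0 ltr0n.
have kd : k.+1%:R^-1 <= d / 2.
  rewrite -[leRHS]invrK lef_pV2 ?posrE ?invr_gt0 ?divr_gt0 ?ltr0n //.
  by rewrite invf_div; exact: ltW (truncnS_gt _).
have rat_near (c : R) : exists q : rat, `|c - ratr q| <= k.+1%:R^-1.
  move: (k.+1%:R^-1) k0 => i i0.
  have [|q] := @rat_in_itvoo R (c - i) (c + i); first lra.
  rewrite in_itv /= => /andP[h1 h2]; exists q; rewrite ler_norml; apply/andP; split; lra.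
have [q1 hq1] := rat_near v.1; have [q2 hq2] := rat_near v.2.
exists (pickle ((q1, q2), k)); rewrite /e pickleK.
have Pv : near_ ((q1, q2), k) v by split.
have [_ [/= h1 h2]] := xgetPex (vzero R) (ex_intro _ v Pv).
move: (xget _ _) h1 h2 => w h1 h2.
move: (k.+1%:R^-1) kd hq1 hq2 h1 h2 => i kd.
rewrite !ler_norml => /andP[a1 a2] /andP[a3 a4] /andP[a5 a6] /andP[a7 a8].
by split; apply/andP; split; lra.
Qed.

(** Moving from [x] towards [x'] by the fraction [l] gives a competitor whose energy changes by
    [2 l I] plus a term of order [l^2]. A negative [I] would lower the energy for small [l]. *)
Lemma opt_variation x y u (x0 y0 : U) (S : R) x' y' u' c :
  opt O x y u x0 y0 -> 0 <= S -> zero_from x y S ->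
  start O x' y' u' x0 y0 -> bdd x' c ->
  0 <= itg (fun t => dot (x t) (vsub (x' t) (x t))) 0 S.
Proof.
move=> [st o] S0 z st' b'.
have [tr _ _] := st; have [tr' _ _] := st'.
have [lx _ _] := traj_vlbm Obnd tr; have [lx' _ _] := traj_vlbm Obnd tr'.
set D := fun t => vsub (x' t) (x t).
have lD : vlbm D by exact: vlbm_sub.
have l1 := lbm_dot lx lx; have l2 := lbm_dot lx lD; have l3 := lbm_dot lD lD.
have l4 := lbm_dot lx' lx'.
set E := en x 0 S; set I := itg _ 0 S.
have E0 : 0 <= E by exact: en_ge0.
(* Bounds the energy of the difference by [|a - b|^2 <= 2 |a|^2 + 2 |b|^2]. *)
pose B := 2 * c + 2 * E.
have B0 : 0 <= B.
  have := b' 0 (lexx _); have := en_ge0 x' 0 0; rewrite /B; lra.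
have DB t : S <= t -> en D 0 t <= B.
  move=> St; have t0 := le_trans S0 St.
  have h : en D 0 t <= 2 * en x' 0 t + 2 * en x 0 t.
    rewrite /en -(itgZ 2 t l4 (lexx 0)) -(itgZ 2 t l1 (lexx 0)).
    rewrite -(itgD t (lbmZ 2 l4) (lbmZ 2 l1) (lexx 0)).
    apply: le_itg => //; first exact: lbmD (lbmZ 2 l4) (lbmZ 2 l1).
    move=> s _; rewrite /D vsubE /dot /=.
    have := sqr_ge0 ((x' s).1 + (x s).1); have := sqr_ge0 ((x' s).2 + (x s).2); lra.
  have := b' t t0; rewrite (en_eq_from lx S0 z St) -/E in h; rewrite /B; lra.
have It t : S <= t -> itg (fun t => dot (x t) (D t)) 0 t = I.
  move=> St; rewrite (itg_split l2 (lexx 0) S0 St).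
  rewrite [X in _ + X](_ : _ = 0) ?addr0 // (@eq_itg _ _ (fun=> 0)) ?itg0 //.
  by move=> q /andP[Sq _]; have [-> _] := z q Sq; rewrite /dot /= !mul0r addr0.
have key (l : R) : 0 < l -> l <= 1 -> 0 <= 2 * I + l * B.
  move=> lp l1'.
  have l01 : 0 <= l <= 1 by rewrite ltW.
  have sm := start_mix Obnd Oconv l01 st' st.
  have [trm _ _] := sm; have [lm _ _] := traj_vlbm Obnd trm.
  have em t : S <= t -> en (mix l x' x) 0 t = E + 2 * l * I + l ^+ 2 * en D 0 t.
    move=> St; rewrite -(It t St) /E -(en_eq_from lx S0 z St) /en.
    rewrite -(itgZ (2 * l) t l2 (lexx 0)) -(itgZ (l ^+ 2) t l3 (lexx 0)).
    rewrite -(itgD t l1 (lbmZ _ l2) (lexx 0)).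
    rewrite -(itgD t (lbmD l1 (lbmZ (2 * l) l2)) (lbmZ _ l3) (lexx 0)).
    by apply: eq_itg => s _; rewrite /mix /D vsubE /dot /vadd /vscale /=; ring.
  have bm : bdd (mix l x' x) (E + 2 * l * I + l ^+ 2 * B).
    move=> t t0; pose t' := Num.max t S.
    have tt : t <= t' by rewrite le_max lexx.
    have St : S <= t' by rewrite le_max lexx orbT.
    apply: le_trans (en_mono lm (lexx 0) t0 tt) _; rewrite em // lerD2l.
    by apply: ler_wpM2l; [exact: sqr_ge0|exact: DB].
  have := o _ _ _ _ sm bm S S0; rewrite -/E => h.
  have : 0 <= l * (2 * I + l * B) by lra.
  by rewrite pmulr_rge0.
rewrite leNgt; apply/negP => I0.
pose l := Num.min 1 (- I / (B + 1)).
have den : 0 < B + 1 by lra.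
have lp : 0 < l by rewrite lt_min ltr01 divr_gt0 // oppr_gt0.
have lI : l * (B + 1) <= - I by rewrite -ler_pdivlMr // ge_min lexx orbT.
have := key l lp; rewrite ge_min lexx => /(_ isT); lra.
Qed.

(* The comparison control takes the value [v] where the inequality fails and is
   continued by steering to rest after [S]. *)
Lemma max_point x y u phi psi (x0 y0 : U) (S : R) v : opt O x y u x0 y0 -> 0 <= S ->
  zero_from x y S -> vprim phi x -> vprim psi (fun t => vscale (-1) (phi t)) ->
  zero_from phi psi S -> O v ->
  {ae mu, forall t : R, 0 <= t -> dot (psi t) v <= dot (psi t) (u t)}.
Proof.
move=> op S0 z pphi ppsi zp Ov.
have [[tr x00 y00] _] := op.
have [lx ly lu] := traj_vlbm Obnd tr.
have lphi := vlbm_prim pphi lx.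
have lmphi : vlbm (fun t => vscale (-1) (phi t)).
  by case: lphi => l1 l2; split; exact: lbmZ.
have lpsi := vlbm_prim ppsi lmphi.
have lv := vlbm_cst v.
pose h t := dot (psi t) (vsub v (u t)).
have lh : lbm h by exact: lbm_dot lpsi (vlbm_sub lv lu).
pose A : set R := `[0, +oo[%classic `&` h @^-1` `]0, +oo[%classic.
have mA : measurable A by apply: lh.1 => //; exact: measurable_itv.
have inA t : 0 <= t -> (t \in A) = (0 < h t).
  move=> t0; apply/idP/idP; first by rewrite inE => -[_]; rewrite /= in_itv /= andbT.
  by move=> ht; rewrite inE; split; rewrite /= in_itv /= ?t0 ?ht.
pose u1 t : U := if t \in A then v else u t.
have lu1 : vlbm u1.
  case: (lu) => l1 l2; split.
    rewrite (_ : (fun t => _) = fun t => if t \in A then v.1 else (u t).1).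
      by apply: lbm_if => //; exact: lbm_cst.
    by apply/funext => t; rewrite /u1; case: ifP.
  rewrite (_ : (fun t => _) = fun t => if t \in A then v.2 else (u t).2).
    by apply: lbm_if => //; exact: lbm_cst.
  by apply/funext => t; rewrite /u1; case: ifP.
have Ou1 t : 0 <= t -> O (u1 t).
  by move=> t0; rewrite /u1; case: ifP => // _; have [_ Ou _ _] := tr; exact: Ou.
have [xa [ya [tra xa0 ya0]]] := start_control x0 y0 lu1 Ou1.
have [K [K0 HK]] := steer r0 Obox.
have [x' [y' [u' [tr' x0' y0' u'E [x'E hx']]]]] := HK _ _ _ tra S S0.
have [lx' ly' lu'] := traj_vlbm Obnd tr'.
have st' : start O x' y' u' x0 y0 by split=> //; rewrite ?x0' ?y0'.
have K5 : 0 <= K * mq (xa S) (ya S) ^+ 5 by rewrite mulr_ge0 ?exprn_ge0 ?mq_ge0 // ltW.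
have b' : bdd x' (en x' 0 S + K * mq (xa S) (ya S) ^+ 5).
  move=> t t0; have [tS|St] := leP t S.
    by have := en_mono lx' (lexx 0) t0 tS; lra.
  rewrite (en_split lx' (lexx 0) S0 (ltW St)) lerD2l; apply: hx'; exact: ltW.
have var := opt_variation op S0 z st' b'.
have [_ _ py px] := tr; have [_ _ py' px'] := tr'.
have pr := pairing pphi lx ppsi (vprim_sub px' px ly' ly) (vprim_sub py' py lu' lu) (vlbm_sub lu' lu).
have [zphi zpsi] := zp S (lexx S).
have lpu := lbm_dot lpsi (vlbm_sub lu' lu).
have := pr S S0; rewrite zphi zpsi (itgD S lpu (lbm_dot lx (vlbm_sub lx' lx)) (lexx 0)).
rewrite x0' y0' xa0 ya0 x00 y00.
have d0 w : dot (vzero R) w = 0 by rewrite /dot /= !mul0r addr0.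
have s0 w : vsub w w = vzero R by rewrite vsubE !subrr.
have d0' w : dot w (vzero R) = 0 by rewrite /dot /= !mulr0 addr0.
rewrite !s0 !d0 !d0' !add0r => bal.
pose g t := if t \in A then h t else 0.
have lg : lbm g by apply: lbm_if => //; exact: lbm_cst.
have g0 t : 0 <= g t.
  rewrite /g; case: ifP => // tA; rewrite ltW // -inA //.
  by move: tA; rewrite inE => -[]; rewrite /= in_itv /= andbT.
(* The first variation is nonnegative and balances the integral of [<psi, u' - u>], whose integrand
   is [g] before [S]. Being nonnegative, [g] must vanish almost everywhere. *)
have gI : itg g 0 S <= 0.
  rewrite (@eq_itg_co _ g (fun t => dot (psi t) (vsub (u' t) (u t))) 0 S) //; first lra.
  move=> t /andP[t0 tS]; rewrite u'E // /g /u1; case: ifP => // _.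
  by rewrite s0 d0'.
apply: (@filterS _ _ (ae_filter_ringOfSetsType mu) _ _ _ (itg0_ae lg g0 gI)) => t gt t0.
have [St|tS] := leP S t; first by have [_ ->] := zp t St; rewrite !d0.
have := gt; rewrite t0 ltW // => /(_ isT); rewrite /g inA //.
have hE : h t = dot (psi t) v - dot (psi t) (u t).
  by rewrite /h vsubE /dot /=; ring.
by case: ltP => [|h0 _]; [lra|rewrite hE in h0; lra].
Qed.

Lemma ae_max_dense (e : nat -> U) u psi :
  (forall v (d : R), O v -> 0 < d -> exists n, `|(e n).1 - v.1| <= d /\ `|(e n).2 - v.2| <= d) ->
  (forall n, {ae mu, forall t : R, 0 <= t -> dot (psi t) (e n) <= dot (psi t) (u t)}) ->
  {ae mu, forall t : R, 0 <= t -> forall v, O v -> dot (psi t) v <= dot (psi t) (u t)}.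
Proof.
move=> de ae; have ae_all := ae_foralln ae.
apply: (@filterS _ _ (ae_filter_ringOfSetsType mu) _ _ _ ae_all) => t ht t0 v Ov.
apply/ler_addgt0Pr => d d0.
pose k := `|(psi t).1| + `|(psi t).2| + 1.
have k0 : 0 < k by rewrite ltr_wpDl // addr_ge0.
have [n [h1 h2]] := de v (d / k) Ov (divr_gt0 d0 k0).
have h3 := ht n t0.
have h4 : - ((psi t).1 * ((e n).1 - v.1)) <= `|(psi t).1| * (d / k).
  by apply: le_trans (ler_norm _) _; rewrite normrN normrM ler_wpM2l.
have h5 : - ((psi t).2 * ((e n).2 - v.2)) <= `|(psi t).2| * (d / k).
  by apply: le_trans (ler_norm _) _; rewrite normrN normrM ler_wpM2l.
have h6 : k * (d / k) = d by field; exact: lt0r_neq0.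
have h7 : 0 < d / k by exact: divr_gt0.
rewrite {1}/k in h6; rewrite /dot in h3 *; lra.
Qed.

Lemma adj_exists x y u (x0 y0 : U) (S : R) : opt O x y u x0 y0 -> 0 <= S ->
  zero_from x y S -> exists phi psi, adj O x u phi psi.
Proof.
move=> op S0 z; have [[tr _ _] _] := op.
have [[lx1 lx2] _ _] := traj_vlbm Obnd tr; have [lx _ _] := traj_vlbm Obnd tr.
pose phi t : U := (itg (fun s => (x s).1) 0 t + - itg (fun s => (x s).1) 0 S,
                   itg (fun s => (x s).2) 0 t + - itg (fun s => (x s).2) 0 S).
have pphi : vprim phi x by split; exact: prim_of_itg.
have lphi := vlbm_prim pphi lx; case: (lphi) => lphi1 lphi2.
pose mp t := vscale (-1) (phi t).
have [lm1 lm2] : vlbm mp by split; exact: lbmZ.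
pose psi t : U := (itg (fun s => (mp s).1) 0 t + - itg (fun s => (mp s).1) 0 S,
                   itg (fun s => (mp s).2) 0 t + - itg (fun s => (mp s).2) 0 S).
have ppsi : vprim psi mp by split; exact: prim_of_itg.
have tail0 (f : R -> R) t : lbm f -> (forall s, S <= s -> f s = 0) -> S <= t ->
    itg f 0 t + - itg f 0 S = 0.
  move=> lf f0 St; rewrite (itg_split lf (lexx 0) S0 St).
  rewrite (@eq_itg _ f (fun=> 0) S t) ?itg0; first by ring.
  by move=> s /andP[Ss _]; exact: f0.
have zphi t : S <= t -> phi t = vzero R.
  move=> St; rewrite /phi !tail0 // => s Ss; by have [-> _] := z s Ss.
have zp : zero_from phi psi S.
  move=> t St; split; first exact: zphi.
  by rewrite /psi !tail0 // => s Ss; rewrite /mp zphi // /vscale /= mulr0.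
exists phi, psi; split=> //.
have [e [Oe de]] := countable_dense.
exact: (ae_max_dense de (fun n => max_point op S0 z pphi ppsi zp (Oe n))).
Qed.

End MaximumPrinciple.

(** * Rest time, bounds backwards from rest, and Euclidean norms *)

Section Estimates.
Variable R : realType.
Notation U := (R * R)%type.
Implicit Types (f g : R -> R) (x y u phi psi : R -> U) (a b v w : U) (p q : U * U).

Lemma prim_right_zero f g (T : R) : prim f g -> lbm g -> 0 <= T ->
  (forall t, T < t -> f t = 0) -> f T = 0.
Proof.
move=> pf lg T0 h; apply/eqP; rewrite -normr_le0; apply/ler_addgt0Pr => e e0; rewrite add0r.
have [L hL] := lg.2 (T + 1).
have L0 : 0 <= L by apply: le_trans (normr_ge0 _) (hL T _); lra.
pose d := Num.min 1 (e / (L + 1)).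
have d0 : 0 < d by rewrite lt_min ltr01 divr_gt0 //; lra.
have d1 : d <= 1 by rewrite ge_min lexx.
have dL : d * (L + 1) <= e by rewrite -ler_pdivlMr ?ge_min ?lexx ?orbT //; lra.
have : `|f (T + d) - f T| <= L * (T + d - T).
  by apply: (prim_lip pf) => //; [lra|move=> t /andP[t1 t2]; apply: hL; lra].
rewrite h ?ltrDl // sub0r normrN; lra.
Qed.

Lemma zero_bound f g (T B : R) : prim f g -> lbm g -> 0 <= T -> f T = 0 ->
  (forall t, 0 <= t <= T -> `|g t| <= B) -> forall t, 0 <= t <= T -> `|f t| <= B * T.
Proof.
move=> pf lg T0 fT h t /andP[t0 tT].
have B0 : 0 <= B by apply: le_trans (normr_ge0 _) (h t _); rewrite t0.
have : `|f T - f t| <= B * (T - t).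
  by apply: (prim_lip pf) => // s /andP[s1 s2]; apply: h; lra.
rewrite fT sub0r normrN => h1; apply: (le_trans h1).
by apply: ler_wpM2l => //; lra.
Qed.

Lemma mq_le a b (k : R) : 0 <= k -> enorm a <= k ^+ 2 -> enorm b <= k -> mq a b <= k.
Proof.
move=> k0 h1 h2; rewrite /mq ge_max h2 andbT -[leRHS](ger0_norm k0) -sqrtr_sqr.
exact: ler_wsqrtr.
Qed.

(** The rest time is the infimum of the times at rest. By the assumed estimate rest is never left,
    and continuity adds the infimum itself. *)
Lemma hitting (C : R) x y u : vlbm x -> vlbm y -> vlbm u -> vprim x y -> vprim y u ->
  (forall s t : R, 0 <= s -> s + C * mq (x s) (y s) <= t -> x t = vzero R /\ y t = vzero R) ->
  0 < C ->
  exists T : R, [/\ 0 <= T, zero_from x y T,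
    (forall t, 0 <= t -> t < T -> ~ (x t = vzero R /\ y t = vzero R)) &
    forall s, 0 <= s -> T <= s + C * mq (x s) (y s)].
Proof.
move=> lx ly lu px py hft C0.
pose Z := [set t : R | 0 <= t /\ (x t = vzero R /\ y t = vzero R)].
have Zs s : 0 <= s -> Z (s + C * mq (x s) (y s)).
  move=> s0; split; first by rewrite addr_ge0 // mulr_ge0 ?mq_ge0 // ltW.
  exact: hft (lexx _).
have Zn : Z !=set0 by exists (0 + C * mq (x 0) (y 0)); exact: Zs.
have Zb : lbound Z 0 by move=> t [].
have hZ : has_inf Z by split=> //; exists 0.
have T0 : 0 <= inf Z by exact: lb_le_inf.
have after t : inf Z < t -> x t = vzero R /\ y t = vzero R.
  move=> Tt; have e0 : 0 < t - inf Z by rewrite subr_gt0.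
  have [z [z0 [xz yz]] zt] := inf_adherent e0 hZ.
  apply: (hft z t z0); rewrite xz yz mq0 mulr0 addr0; lra.
exists (inf Z); split=> //.
- move=> t; rewrite le_eqVlt => /predU1P[<-|]; last exact: after.
  case: lx ly lu px py => [lx1 lx2] [ly1 ly2] [lu1 lu2] [px1 px2] [py1 py2].
  rewrite (surjective_pairing (x _)) (surjective_pairing (y _)); split; congr pair.
  + by apply: (prim_right_zero px1) => // s /after [-> _].
  + by apply: (prim_right_zero px2) => // s /after [-> _].
  + by apply: (prim_right_zero py1) => // s /after [_ ->].
  + by apply: (prim_right_zero py2) => // s /after [_ ->].
- move=> t t0 tT h; have : inf Z <= t by apply: ge_inf; [exists 0|split].
  lra.
- by move=> s s0; apply: ge_inf; [exists 0|exact: Zs].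
Qed.

(** Each integration backwards from rest gains one power of [T]. Together with [adj_bounds] this
    yields the orders 1, 2, 3, 4 for [y], [x], [phi], [psi]. *)
Lemma dyn_bounds (M T : R) x y u : dyn M x y u -> 0 <= T -> zero_from x y T ->
  forall t, 0 <= t <= T -> [/\ `|(x t).1| <= M * T * T, `|(x t).2| <= M * T * T,
    `|(y t).1| <= M * T & `|(y t).2| <= M * T].
Proof.
move=> dd T0 z t tT; have [_ [ly1 ly2]] := dyn_vlbm dd.
case: dd => [[lu1 lu2] [py1 py2] [px1 px2] b]; have [xT yT] := z T (lexx T).
have y1 s : 0 <= s <= T -> `|(y s).1| <= M * T.
  apply: (zero_bound py1 lu1 T0) => [|r /andP[r0 _]]; first by rewrite yT.
  by have [] := b r r0.
have y2 s : 0 <= s <= T -> `|(y s).2| <= M * T.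
  apply: (zero_bound py2 lu2 T0) => [|r /andP[r0 _]]; first by rewrite yT.
  by have [] := b r r0.
split.
- by apply: (zero_bound px1 ly1 T0) tT => //; rewrite xT.
- by apply: (zero_bound px2 ly2 T0) tT => //; rewrite xT.
- exact: y1.
- exact: y2.
Qed.

Lemma adj_bounds (T B : R) x phi psi : vlbm x -> vprim phi x ->
  vprim psi (fun t => vscale (-1) (phi t)) -> 0 <= T -> zero_from phi psi T ->
  (forall t, 0 <= t <= T -> `|(x t).1| <= B /\ `|(x t).2| <= B) ->
  forall t, 0 <= t <= T -> [/\ `|(phi t).1| <= B * T, `|(phi t).2| <= B * T,
    `|(psi t).1| <= B * T * T & `|(psi t).2| <= B * T * T].
Proof.
move=> lx pphi ppsi T0 z b t tT.
have lphi := vlbm_prim pphi lx; have [phiT psiT] := z T (lexx T).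
case: lx lphi pphi ppsi => [lx1 lx2] [l1 l2] [p1 p2] [q1 q2].
have f1 s : 0 <= s <= T -> `|(phi s).1| <= B * T.
  apply: (zero_bound p1 lx1 T0) => [|r rT]; first by rewrite phiT.
  by have [] := b r rT.
have f2 s : 0 <= s <= T -> `|(phi s).2| <= B * T.
  apply: (zero_bound p2 lx2 T0) => [|r rT]; first by rewrite phiT.
  by have [] := b r rT.
split; [exact: f1|exact: f2| |].
- apply: (zero_bound q1 (lbmZ _ l1) T0) tT => [|r rT]; first by rewrite psiT.
  by rewrite /= mulN1r normrN; exact: f1.
- apply: (zero_bound q2 (lbmZ _ l2) T0) tT => [|r rT]; first by rewrite psiT.
  by rewrite /= mulN1r normrN; exact: f2.
Qed.

(** By Cauchy-Schwarz each coordinate of [phi] has square at most [T * E], and one more integration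
    gives [T^3 * E] for [psi]. Unlike [adj_bounds] this uses only the L^2 size of [x], which is what
    is known of a difference of optimal motions. *)
Lemma adj_en_bounds (T : R) x phi psi : vlbm x -> vprim phi x ->
  vprim psi (fun t => vscale (-1) (phi t)) -> 0 <= T -> phi T = vzero R -> psi T = vzero R ->
  dot (phi 0) (phi 0) + dot (psi 0) (psi 0) <= 2 * (T + T ^+ 3) * en x 0 T.
Proof.
move=> lx pphi ppsi T0 phiT psiT.
have lphi := vlbm_prim pphi lx; have ldx := lbm_dot lx lx.
case: (lx) lphi pphi ppsi => [lx1 lx2] [l1 l2] [p1 p2] [q1 q2].
set E := en x 0 T; have E0 : 0 <= E by exact: en_ge0.
have sub f g : prim f g -> lbm g -> f T = 0 ->
    (forall t, 0 <= t -> g t ^+ 2 <= dot (x t) (x t)) ->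
    forall t, 0 <= t <= T -> f t ^+ 2 <= T * E.
  move=> pf lg fT gx t /andP[t0 tT].
  have -> : f t ^+ 2 = itg g t T ^+ 2.
    by rewrite -(prim_itg pf lg t0 tT) fT sub0r sqrrN.
  apply: le_trans (itg_CS lg t0 tT) _.
  have lg2 : lbm (fun t => g t ^+ 2) by exact: (lbmM lg lg).
  have h1 : itg (fun t => g t ^+ 2) t T <= E.
    apply: (@le_trans _ _ (en x t T)).
      by apply: le_itg => // s /andP[ts _]; apply: gx; exact: le_trans ts.
    by rewrite /E (en_split lx (lexx 0) t0 tT) lerDr en_ge0.
  apply: ler_pM => //; [lra| |lra].
  by apply: itg_ge0 => s _; exact: sqr_ge0.
have f1 := sub _ _ p1 lx1 (congr1 fst phiT) (fun t _ => ltac:(by rewrite /dot -!expr2 lerDl sqr_ge0)).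
have f2 := sub _ _ p2 lx2 (congr1 snd phiT) (fun t _ => ltac:(by rewrite /dot -!expr2 lerDr sqr_ge0)).
have bnd (f g : R -> R) : prim f (fun t => -1 * g t) -> lbm g -> f T = 0 ->
    (forall t, 0 <= t <= T -> g t ^+ 2 <= T * E) -> f 0 ^+ 2 <= T ^+ 3 * E.
  move=> pf lg fT gE.
  have lmg := lbmZ (-1) lg.
  have -> : f 0 ^+ 2 = itg (fun t => -1 * g t) 0 T ^+ 2.
    by rewrite -(prim_itg pf lmg (lexx 0) T0) fT sub0r sqrrN.
  apply: le_trans (itg_CS lmg (lexx 0) T0) _.
  have -> : T ^+ 3 * E = (T - 0) * (T * E * (T - 0)) by ring.
  apply: ler_wpM2l; first lra.
  rewrite -itg_cst //; apply: le_itg => //; first exact: (lbmM lmg lmg).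
    exact: lbm_cst.
  by move=> t tT; rewrite exprMn sqrrN expr1n mul1r; exact: gE.
have s1 := bnd _ _ q1 l1 (congr1 fst psiT) f1.
have s2 := bnd _ _ q2 l2 (congr1 snd psiT) f2.
have T00 : 0 <= (0 : R) <= T by rewrite lexx.
have := f1 0 T00; have := f2 0 T00; rewrite /dot -!expr2 /= in s1 s2 *; lra.
Qed.

(** The inner product of the state-costate pairing: for [p = (phi, psi)] and [q = (x, y)] it is the
    quantity followed in [pairing]. *)
Definition pq p q : R := dot p.2 q.2 + dot p.1 q.1.

Lemma enorm2_ge0 p : 0 <= enorm2 p. Proof. exact: sqrtr_ge0. Qed.

Lemma enorm2_sqr p : enorm2 p ^+ 2 = pq p p.
Proof. by rewrite /pq addrC sqr_sqrtr // addr_ge0 ?dot_ge0. Qed.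

Lemma pq_abs p q : `|pq p q| <= enorm2 p * enorm2 q.
Proof.
apply: abs_le_sqr; first by rewrite mulr_ge0 ?enorm2_ge0.
have h1 := dot_le p.1 q.1; have h2 := dot_le p.2 q.2.
have h3 : `|pq p q| <= enorm p.2 * enorm q.2 + enorm p.1 * enorm q.1.
  have d v w : `|dot v w| <= enorm v * enorm w.
    rewrite ler_norml dot_le andbT lerNl.
    have -> : - dot v w = dot (vscale (-1) v) w by rewrite /dot /vscale /=; ring.
    apply: le_trans (dot_le _ _) _; apply: ler_wpM2r; first exact: enorm_ge0.
    by rewrite /enorm /dot /vscale /= !mulN1r !mulrNN.
  by apply: le_trans (ler_normD _ _) _; apply: lerD; exact: d.
rewrite -expr2 -real_normK ?num_real //.
have h4 : 0 <= enorm p.2 * enorm q.2 + enorm p.1 * enorm q.1.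
  by rewrite addr_ge0 // mulr_ge0 ?enorm_ge0.
apply: (@le_trans _ _ ((enorm p.2 * enorm q.2 + enorm p.1 * enorm q.1) ^+ 2)).
  by rewrite ler_pXn2r ?nnegrE.
rewrite exprMn !enorm2_sqr /pq -!enorm_sqr -subr_ge0.
have -> : (enorm p.2 ^+ 2 + enorm p.1 ^+ 2) * (enorm q.2 ^+ 2 + enorm q.1 ^+ 2) -
  (enorm p.2 * enorm q.2 + enorm p.1 * enorm q.1) ^+ 2 =
  (enorm p.2 * enorm q.1 - enorm p.1 * enorm q.2) ^+ 2 by ring.
exact: sqr_ge0.
Qed.

Lemma pq_le p q : pq p q <= enorm2 p * enorm2 q.
Proof. exact: le_trans (ler_norm _) (pq_abs p q). Qed.

Lemma enorm2_eq0 p : enorm2 p <= 0 -> p = (vzero R, vzero R).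
Proof.
move=> h; have h0 : enorm2 p = 0 by apply/le_anti; rewrite h enorm2_ge0.
have := enorm2_sqr p; rewrite h0 expr0n /= /pq => e.
have d1 := dot_ge0 p.1; have d2 := dot_ge0 p.2.
rewrite (surjective_pairing p); congr pair; apply: enorm_eq0; apply: le_enorm => //;
  rewrite expr0n /=; lra.
Qed.

Lemma qsub_eq0 p q : qsub p q = (vzero R, vzero R) -> p = q.
Proof.
move=> h; rewrite (surjective_pairing p) (surjective_pairing q); congr pair.
  exact: vsub_eq0 (congr1 fst h).
exact: vsub_eq0 (congr1 snd h).
Qed.

Lemma powR_root (z b : R) (n : nat) : 0 <= z -> 0 <= b -> z <= b ^+ n.+1 ->
  powR z (n.+1%:R^-1) <= b.
Proof.
move=> z0 b0 h; have n0 : n.+1%:R != 0 :> R by rewrite pnatr_eq0.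
rewrite -[leRHS](powRr1 b0) -[X in powR b X](mulfV n0) powRrM powR_mulrn //.
by apply: ge0_ler_powR => //; rewrite ?nnegrE ?exprn_ge0 // invr_ge0.
Qed.

Lemma powR_rootK (z : R) (n : nat) : 0 <= z -> powR z (n.+1%:R^-1) ^+ n.+1 = z.
Proof.
by move=> z0; rewrite -powR_mulrn ?powR_ge0 // -powRrM mulVf ?powRr1 // pnatr_eq0.
Qed.

Lemma near_enorm2 q (e : R) : 0 < e -> \forall p \near q, enorm2 (qsub p q) < e.
Proof.
(* Neighbourhoods are those of the product topology; four coordinates below [e / 5] have Euclidean
   norm below [2 e / 5]. *)
move=> e0; apply/nbhs_ballP; exists (e / 5) => /=; first by rewrite divr_gt0.
move=> p [[b1 b2] [b3 b4]]; move: b1 b2 b3 b4; rewrite /ball /= => b1 b2 b3 b4.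
have a (c d : R) : `|c - d| < e / 5 -> (d - c) ^+ 2 <= (e / 5) ^+ 2.
  move=> h; rewrite -real_normK ?num_real // distrC.
  by rewrite ler_pXn2r ?nnegrE ?divr_ge0 // ltW.
have a1 := a _ _ b1; have a2 := a _ _ b2; have a3 := a _ _ b3; have a4 := a _ _ b4.
rewrite -(ltr_pXn2r (ltn0Sn 1)) ?nnegrE ?enorm2_ge0 ?ltW // enorm2_sqr /pq /dot /= !mulN1r -!expr2.
have : 0 < e ^+ 2 by rewrite exprn_gt0.
rewrite expr_div_n in a1 a2 a3 a4; lra.
Qed.

End Estimates.

(** * Dependence of the optimal motion on its start *)

Section Synthesis.
Variable R : realType.
Notation U := (R * R)%type.
Implicit Types (f g : R -> R) (x y u phi psi : R -> U) (a b v w : U) (p q : U * U).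
Variables (O : set U) (r M C : R).
Hypothesis r0 : 0 < r.
Hypothesis Obox : forall v, `|v.1| <= r -> `|v.2| <= r -> O v.
Hypothesis Obnd : forall v, O v -> `|v.1| <= M /\ `|v.2| <= M.
(** One motion, adjoint and rest time chosen for every start. Optimality is present through the
    adjoint condition [Xadj] and the rest estimates [Tzero] and [Tle]. *)
Variables (X Y V Phi Psi : U * U -> R -> U) (T : U * U -> R).
Hypothesis Xtraj : forall q, traj O (X q) (Y q) (V q).
Hypothesis X0 : forall q, (X q 0, Y q 0) = q.
Hypothesis Xadj : forall q, adj O (X q) (V q) (Phi q) (Psi q).
Hypothesis T0 : forall q, 0 <= T q.
Hypothesis Tzero : forall q, zero_from (X q) (Y q) (T q).
Hypothesis C0 : 0 < C.
Hypothesis Tle : forall q (s : R), 0 <= s -> T q <= s + C * mq (X q s) (Y q s).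

Let M0 : 0 < M := bound_gt0 r0 Obox Obnd.

Let Xq q : X q 0 = q.1. Proof. by rewrite -[in RHS](X0 q). Qed.
Let Yq q : Y q 0 = q.2. Proof. by rewrite -[in RHS](X0 q). Qed.
Let lX q : vlbm (X q). Proof. by have [] := traj_vlbm Obnd (Xtraj q). Qed.

Definition costate0 q : U * U := (Phi q 0, Psi q 0).
Local Notation E := costate0.

(** Twice the optimal cost, whence the factor 2 in front of the costate below. *)
Definition value q : R := en (X q) 0 (T q).

Lemma value_ge q (t : R) : 0 <= t -> en (X q) 0 t <= value q.
Proof.
move=> t0; have [tT|Tt] := leP t (T q); first exact: en_mono.
by rewrite (en_eq_from (lX q) (T0 q) (@Tzero q)) // ltW.
Qed.

Lemma T_le_mq q : T q <= C * mq q.1 q.2.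
Proof. by have := @Tle q 0 (lexx _); rewrite add0r Xq Yq. Qed.

Lemma value_subgrad q p : value q - 2 * pq (E q) (qsub p q) +
  en (fun t => vsub (X p t) (X q t)) 0 (T q) <= value p.
Proof.
have := adj_ineq r0 Obox Obnd (Xtraj q) (Xadj q) (T0 q) (@Tzero q) (Xtraj p).
rewrite !Xq !Yq => h; apply: le_trans (value_ge p (T0 q)).
apply: le_trans h; rewrite /value /pq /qsub /E /= -/(vsub _ _); lra.
Qed.

(** Adding [adj_ineq] for the pair and for the exchanged pair, at a common rest time, cancels both
    energies. What is left is a strong monotonicity of [- E], with the L^2 distance of the motions
    as its modulus. *)
Lemma delta_en q p (t : R) : 0 <= t -> en (fun t => vsub (X p t) (X q t)) 0 t <=
  enorm2 (qsub (E p) (E q)) * enorm2 (qsub p q).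
Proof.
move=> t0; pose S := Num.max t (Num.max (T q) (T p)).
have tS : t <= S by rewrite le_max lexx.
have qS : T q <= S by rewrite !le_max lexx orbT.
have pS : T p <= S by rewrite !le_max lexx !orbT.
have S0 := le_trans t0 tS.
have lD : vlbm (fun t => vsub (X p t) (X q t)) by exact: vlbm_sub.
apply: le_trans (en_mono lD (lexx 0) t0 tS) _.
have zq : zero_from (X q) (Y q) S by move=> s Ss; apply: Tzero; exact: le_trans Ss.
have zp : zero_from (X p) (Y p) S by move=> s Ss; apply: Tzero; exact: le_trans Ss.
have h1 := adj_ineq r0 Obox Obnd (Xtraj q) (Xadj q) S0 zq (Xtraj p).
have h2 := adj_ineq r0 Obox Obnd (Xtraj p) (Xadj p) S0 zp (Xtraj q).
have h3 : en (fun t => vsub (X q t) (X p t)) 0 S = en (fun t => vsub (X p t) (X q t)) 0 S.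
  by apply: eq_itg => s _; rewrite !vsubE /dot /=; ring.
rewrite !Xq !Yq in h1 h2; rewrite h3 in h2.
have := pq_le (qsub (E p) (E q)) (qsub q p).
have -> : enorm2 (qsub q p) = enorm2 (qsub p q).
  by rewrite /enorm2 /qsub /dot /=; congr Num.sqrt; ring.
apply: le_trans.
have -> : pq (qsub (E p) (E q)) (qsub q p) =
   (dot (Psi q 0) (vsub p.2 q.2) + dot (Phi q 0) (vsub p.1 q.1)) +
   (dot (Psi p 0) (vsub q.2 p.2) + dot (Phi p 0) (vsub q.1 p.1)).
  by rewrite /pq /qsub /E /= !vsubE /dot /vadd /vscale /=; ring.
lra.
Qed.

(** Apply [adj_en_bounds] to the difference and then [delta_en]: the squared distance of the
    costates is at most a constant times that distance times the distance of the starts. One factor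
    is divided out. *)
Lemma costate_local_lip q p (B : R) : T q <= B -> T p <= B ->
  enorm2 (qsub (E p) (E q)) <= 2 * (B + B ^+ 3) * enorm2 (qsub p q).
Proof.
move=> qB pB; have B0 := le_trans (T0 q) qB.
have [pphi ppsi _] := Xadj q; have [pphi' ppsi' _] := Xadj p.
have [lphi lpsi] := adj_vlbm (lX q) (Xadj q); have [lphi' lpsi'] := adj_vlbm (lX p) (Xadj p).
have [phiB psiB] := adj_zero r0 Obox Obnd (Xtraj q) (Xadj q) (T0 q) (@Tzero q) qB.
have [phiB' psiB'] := adj_zero r0 Obox Obnd (Xtraj p) (Xadj p) (T0 p) (@Tzero p) pB.
have lm x : vlbm x -> vlbm (fun t => vscale (-1) (x t)).
  by move=> [l1 l2]; split; exact: lbmZ.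
pose D t := vsub (X p t) (X q t).
have lD : vlbm D by exact: vlbm_sub.
have p1 : vprim (fun t => vsub (Phi p t) (Phi q t)) D by exact: vprim_sub.
have p2 : vprim (fun t => vsub (Psi p t) (Psi q t))
    (fun t => vscale (-1) (vsub (Phi p t) (Phi q t))).
  have [h1 h2] := vprim_sub ppsi' ppsi (lm _ lphi') (lm _ lphi).
  split; [apply: prim_ext h1 _ _|apply: prim_ext h2 _ _] => // t _;
    rewrite !vsubE /vscale /=; ring.
have := adj_en_bounds lD p1 p2 B0.
rewrite phiB psiB phiB' psiB' => /(_ _ _)/wrap[||h].
- by rewrite vsubE !subrr.
- by rewrite vsubE !subrr.
have h1 : enorm2 (qsub (E p) (E q)) ^+ 2 <= 2 * (B + B ^+ 3) * en D 0 B.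
  by rewrite enorm2_sqr /pq addrC.
have K0 : 0 <= 2 * (B + B ^+ 3) by rewrite mulr_ge0 // addr_ge0 // exprn_ge0.
have h2 := ler_wpM2l K0 (delta_en q p B0).
have h3 := le_trans h1 h2.
have [e0|e0] := leP (enorm2 (qsub (E p) (E q))) 0.
  by apply: le_trans e0 _; rewrite mulr_ge0 ?enorm2_ge0.
by rewrite -(ler_pM2l e0) -expr2; apply: le_trans h3 _; rewrite le_eqVlt; apply/orP; left; apply/eqP; ring.
Qed.

Lemma enorm_bound a (k : R) : `|a.1| <= k -> `|a.2| <= k -> enorm a <= 2 * k.
Proof. by move=> h1 h2; apply: le_trans (enorm_le_abs a) _; lra. Qed.

Lemma enorm2_comp p : [/\ `|p.1.1| <= enorm2 p, `|p.1.2| <= enorm2 p,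
  `|p.2.1| <= enorm2 p & `|p.2.2| <= enorm2 p].
Proof.
have e := enorm2_sqr p; rewrite /pq /dot in e.
have s1 := sqr_ge0 p.1.1; have s2 := sqr_ge0 p.1.2.
have s3 := sqr_ge0 p.2.1; have s4 := sqr_ge0 p.2.2.
by split; apply: abs_le_sqr; rewrite ?enorm2_ge0 // e; lra.
Qed.

Lemma mq_near q : exists B : R, forall p, enorm2 (qsub p q) < 1 -> mq p.1 p.2 <= B.
Proof.
pose k := 2 * (enorm2 q + 1).
have k1 : 1 <= k by have := enorm2_ge0 q; rewrite /k; lra.
exists k => p h.
have [a1 a2 a3 a4] := enorm2_comp (qsub p q).
set N := enorm2 (qsub p q) in h a1 a2 a3 a4 *.
have [b1 b2 b3 b4] := enorm2_comp q.
rewrite /qsub /vadd /vscale /= !mulN1r in a1 a2 a3 a4.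
have t (c d : R) : `|c - d| <= N -> `|d| <= enorm2 q -> `|c| <= enorm2 q + 1.
  by move=> h1 h2; have := ler_normD (c - d) d; rewrite subrK; lra.
apply: mq_le; first lra.
  apply: (@le_trans _ _ k); first by apply: enorm_bound; [apply: t a1 b1|apply: t a2 b2].
  by rewrite expr2 ler_peMr //; lra.
by apply: enorm_bound; [apply: t a3 b3|apply: t a4 b4].
Qed.

Lemma costate_lip : locally_lipschitz E.
Proof.
move=> q; have [B hB] := mq_near q.
pose K := C * B; exists 1, (2 * (K + K ^+ 3)); split=> // a b ha hb.
have TK p : enorm2 (qsub p q) < 1 -> T p <= K.
  by move=> h; apply: le_trans (T_le_mq p) _; apply: ler_wpM2l; [exact: ltW|exact: hB].
by apply: costate_local_lip; exact: TK.
Qed.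

Lemma qsubxx q : enorm2 (qsub q q) = 0.
Proof.
rewrite /enorm2 /qsub /dot /vadd /vscale /= !mulN1r !subrr !mulr0 !addr0.
by rewrite sqrtr0.
Qed.

Lemma qsubC p q : enorm2 (qsub q p) = enorm2 (qsub p q).
Proof. by rewrite /enorm2 /qsub /dot /=; congr Num.sqrt; ring. Qed.

Lemma costate_inj : injective E.
Proof.
move=> q p Epq.
have := @en_eq0 R _ _ _ _ 0 (ltW (addr_gt0 M0 M0))
  (dyn_sub (traj_dyn Obnd (Xtraj p)) (traj_dyn Obnd (Xtraj q))) (lexx 0).
rewrite !Xq !Yq => /(_ _)/wrap[|[h1 h2]].
  by move=> t t0; apply: le_trans (delta_en q p t0) _; rewrite Epq qsubxx mul0r.
by rewrite (surjective_pairing p) (surjective_pairing q) (vsub_eq0 h1) (vsub_eq0 h2).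
Qed.

(* At the time when one of two nearby optimal trajectories reaches rest, the other
   is within [mq <= e / C] of rest, and needs at most [e] more time. *)
Lemma T_cont : continuous T.
Proof.
move=> q; have [c [d [c0 d0 Hint]]] := interp (ltW (addr_gt0 M0 M0)).
have [rr [L [rr0 HL]]] := costate_lip q.
apply/cvgrPdist_le => e e0.
(* For starts closer than [k], 1 and [rr], the energy of the difference is at most
   [(|L| + 1) k = c (e / C)^5], so that the lower bound gives [mq <= e / C]. *)
pose k := c * (e / C) ^+ 5 / (`|L| + 1).
have L0 : 0 < `|L| + 1 by rewrite ltr_wpDl.
have k0 : 0 < k by rewrite divr_gt0 // mulr_gt0 // exprn_gt0 // divr_gt0.
pose dl := Num.min (Num.min rr 1) k.
have dl0 : 0 < dl by rewrite !lt_min rr0 ltr01 k0.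
near=> p.
have pd : enorm2 (qsub p q) < dl by near: p; exact: near_enorm2.
have [p1 p2 p3] : [/\ enorm2 (qsub p q) < rr, enorm2 (qsub p q) < 1 & enorm2 (qsub p q) < k].
  by move: pd; rewrite !lt_min => /andP[/andP[]].
have n0 := enorm2_ge0 (qsub p q).
have eqq : enorm2 (qsub q q) < rr by rewrite qsubxx.
have lip := HL _ _ p1 eqq.
have sm (s : R) : 0 <= s -> mq (vsub (X p s) (X q s)) (vsub (Y p s) (Y q s)) <= e / C.
  move=> s0; apply: pow5_le; first by rewrite divr_ge0 // ltW.
  have := Hint _ _ _ (dyn_sub (traj_dyn Obnd (Xtraj p)) (traj_dyn Obnd (Xtraj q))) s s0.
  set m := mq _ _ => h1.
  have m0 : 0 <= m by exact: mq_ge0.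
  have lD : vlbm (fun t => vsub (X p t) (X q t)) by exact: vlbm_sub.
  have ss : s <= s + d * m by rewrite lerDl mulr_ge0 // ltW.
  have h2 := delta_en q p (le_trans s0 ss).
  rewrite (en_split lD (lexx 0) s0 ss) in h2.
  have h3 := en_ge0 (fun t => vsub (X p t) (X q t)) 0 s.
  rewrite -(ler_pM2l c0); apply: le_trans h1 _.
  apply: (@le_trans _ _ (enorm2 (qsub (E p) (E q)) * enorm2 (qsub p q))); first lra.
  apply: (@le_trans _ _ ((`|L| + 1) * enorm2 (qsub p q))).
    apply: le_trans (ler_wpM2r n0 lip) _; apply: ler_wpM2r => //.
    have h4 := ler_wpM2r n0 (ler_norm L).
    have h5 : `|L| * enorm2 (qsub p q) <= `|L| by rewrite ler_piMr // ltW.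
    lra.
  by rewrite mulrC -ler_pdivlMr // ltW.
have v0 a : vsub a (vzero R) = a.
  by rewrite vsubE /= !subr0 -surjective_pairing.
have v0' a b : mq (vsub (vzero R) a) (vsub (vzero R) b) = mq a b.
  have en_opp w : enorm (vsub (vzero R) w) = enorm w.
    by rewrite /enorm /dot vsubE /= !sub0r !mulrNN.
  by rewrite /mq !en_opp.
have h1 := sm _ (T0 q); have h2 := sm _ (T0 p).
have [xq yq] := Tzero (lexx (T q)); have [xp yp] := Tzero (lexx (T p)).
rewrite xq yq !v0 in h1; rewrite xp yp v0' in h2.
have h3 := Tle p (T0 q); have h4 := Tle q (T0 p).
rewrite ler_pdivlMr // in h1; rewrite ler_pdivlMr // in h2.
rewrite ler_norml; apply/andP; split; lra.
Unshelve. all: by end_near. Qed.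

(** The subgradient inequalities at the two points bound the difference of the values from both
    sides, with costates bounded near [q]. *)
Lemma value_cont : continuous value.
Proof.
move=> q; have [rr [L [rr0 HL]]] := costate_lip q.
apply/cvgrPdist_le => e e0.
pose k := 2 * (2 * enorm2 (E q) + `|L| * rr) + 1.
have k0 : 0 < k.
  have := enorm2_ge0 (E q); have := mulr_ge0 (normr_ge0 L) (ltW rr0); rewrite /k; lra.
pose dl := Num.min rr (e / k).
have dl0 : 0 < dl by rewrite !lt_min rr0 divr_gt0.
near=> p.
have pd : enorm2 (qsub p q) < dl by near: p; exact: near_enorm2.
have [p1 p2] : enorm2 (qsub p q) < rr /\ enorm2 (qsub p q) < e / k.
  by move: pd; rewrite !lt_min => /andP[].
have n0 := enorm2_ge0 (qsub p q).
have eqq : enorm2 (qsub q q) < rr by rewrite qsubxx.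
have lip := HL _ _ p1 eqq.
have lip' : enorm2 (qsub (E p) (E q)) <= `|L| * rr.
  apply: (le_trans lip); apply: le_trans (ler_wpM2r n0 (ler_norm L)) _.
  by apply: ler_wpM2l => //; exact: ltW.
have h1 := value_subgrad q p; have h2 := value_subgrad p q.
have g1 := en_ge0 (fun t => vsub (X p t) (X q t)) 0 (T q).
have g2 := en_ge0 (fun t => vsub (X q t) (X p t)) 0 (T p).
have := pq_abs (E q) (qsub p q); rewrite ler_norml => /andP[c1 c1'].
have := pq_abs (qsub (E p) (E q)) (qsub p q); rewrite ler_norml => /andP[c2 c2'].
have c3 : pq (E p) (qsub q p) = - pq (qsub (E p) (E q)) (qsub p q) - pq (E q) (qsub p q).
  by rewrite /pq /qsub /dot /vadd /vscale /=; ring.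
have c4 := ler_wpM2r n0 lip'.
have c5 : k * enorm2 (qsub p q) <= e by rewrite mulrC -ler_pdivlMr // ltW.
have c7 := mulr_ge0 (enorm2_ge0 (E q)) n0.
have c8 := mulr_ge0 (mulr_ge0 (normr_ge0 L) (ltW rr0)) n0.
rewrite /k in c5; rewrite c3 in h2; rewrite ler_norml; apply/andP; split; lra.
Unshelve. all: by end_near. Qed.

Lemma value_lb : exists c : R, 0 < c /\ forall q, c * mq q.1 q.2 ^+ 5 <= value q.
Proof.
have [c [d [c0 d0 H]]] := interp (ltW M0); exists c; split=> // q.
have := H _ _ _ (traj_dyn Obnd (Xtraj q)) 0 (lexx _); rewrite Xq Yq add0r => h.
apply: le_trans h _; apply: value_ge; apply: mulr_ge0; [exact: ltW|exact: mq_ge0].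
Qed.

Lemma value_pq_cont p : continuous (fun q => value q + 2 * pq p q).
Proof.
move=> q; apply: cvgD; first exact: value_cont.
apply/cvgrPdist_le => e e0.
pose k := 2 * enorm2 p + 1.
have k0 : 0 < k by have := enorm2_ge0 p; rewrite /k; lra.
near=> a.
have ad : enorm2 (qsub a q) < e / k by near: a; apply: near_enorm2; exact: divr_gt0.
have -> : 2 * pq p q - 2 * pq p a = 2 * pq p (qsub q a).
  by rewrite /pq /qsub /dot /vadd /vscale /=; ring.
rewrite normrM (ger0_norm (ler0n _ 2)); have := pq_abs p (qsub q a); rewrite qsubC => h.
have c5 : k * enorm2 (qsub a q) <= e by rewrite mulrC -ler_pdivlMr // ltW.
have := enorm2_ge0 (qsub a q); rewrite /k in c5; lra.
Unshelve. all: by end_near. Qed.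

(** The value grows at least like [m^5], whereas the linear term is at most of order [m^2] once
    [m >= 1]. Outside a compact box the sum is nonnegative, and it is 0 at the origin. *)
Lemma value_pq_min p : exists q, forall q', value q + 2 * pq p q <= value q' + 2 * pq p q'.
Proof.
have [c [c0 hc]] := value_lb.
pose P := enorm p.1 + enorm p.2.
have P0 : 0 <= P by rewrite addr_ge0 ?enorm_ge0.
(* For [m >= k] one has [c * m >= c + 4 P], which beats the linear term. For [m < k] both [|x|] and
   [|y|] are at most [k^2], so the point lies in the box. *)
pose k := 1 + 4 * P / c.
have k1 : 1 <= k by rewrite lerDl; apply: divr_ge0; [exact: mulr_ge0|exact: ltW].
pose I : set R := `[- k ^+ 2, k ^+ 2]%classic.
pose K : set (U * U) := (I `*` I) `*` (I `*` I).
have cI : compact I by exact: segment_compact.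
have cK : compact K by apply: compact_setX; apply: compact_setX.
have k20 : 0 <= k ^+ 2 by exact: sqr_ge0.
have I0 : I 0 by rewrite /I /= in_itv /= oppr_le0 k20.
have K0 : K (vzero R, vzero R) by [].
have Kn : K !=set0 by exists (vzero R, vzero R).
have cG : {within K, continuous (fun q => value q + 2 * pq p q)}.
  by apply: continuous_subspaceT; exact: value_pq_cont.
have [q _ hq] := compact_EVT_min Kn cK cG.
exists q => q'.
have [Kq'|nK] := pselect (K q'); first by apply: hq; rewrite inE.
have v0 : value (vzero R, vzero R) = 0.
  have h : T (vzero R, vzero R) = 0.
    apply/le_anti; rewrite T0 andbT; have := T_le_mq (vzero R, vzero R).
    by rewrite mq0 mulr0.
  by rewrite /value h /en itgxx.
have h0 : value q + 2 * pq p q <= 0.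
  have := hq (vzero R, vzero R); rewrite inE => /(_ K0); rewrite v0 add0r.
  by rewrite /pq /dot /= !mulr0 !addr0 mulr0.
apply: le_trans h0 _.
set m := mq q'.1 q'.2; have m0 : 0 <= m by exact: mq_ge0.
have km : k <= m.
  rewrite leNgt; apply/negP => mk; apply: nK.
  have mk2 : m ^+ 2 <= k ^+ 2 by rewrite ler_pXn2r ?nnegrE //; lra.
  have kk : k <= k ^+ 2 by rewrite expr2 ler_peMr //; lra.
  have f1 := mq_fst q'.1 q'.2; have f2 := mq_snd q'.1 q'.2; rewrite -/m in f1 f2.
  have g1 := enorm_fst q'.1; have g2 := enorm_snd q'.1.
  have g3 := enorm_fst q'.2; have g4 := enorm_snd q'.2.
  by split; split; rewrite /I /= in_itv /= -ler_norml; lra.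
have m1 : 1 <= m by lra.
have hv := hc q'; rewrite -/m in hv.
have b1 : - pq p q' <= P * m ^+ 2.
  have d1 : - dot p.1 q'.1 <= enorm p.1 * m ^+ 2.
    have -> : - dot p.1 q'.1 = dot p.1 (vscale (-1) q'.1) by rewrite /dot /vscale /=; ring.
    apply: le_trans (dot_le _ _) _; apply: ler_wpM2l; first exact: enorm_ge0.
    rewrite (_ : enorm _ = enorm q'.1); first exact: mq_fst.
    by rewrite /enorm /dot /vscale /= !mulN1r !mulrNN.
  have d2 : - dot p.2 q'.2 <= enorm p.2 * m ^+ 2.
    have -> : - dot p.2 q'.2 = dot p.2 (vscale (-1) q'.2) by rewrite /dot /vscale /=; ring.
    apply: le_trans (dot_le _ _) _; apply: ler_wpM2l; first exact: enorm_ge0.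
    rewrite (_ : enorm _ = enorm q'.2); last first.
      by rewrite /enorm /dot /vscale /= !mulN1r !mulrNN.
    apply: le_trans (mq_snd q'.1 q'.2) _; rewrite -/m expr2 ler_peMr //.
  rewrite /pq /P; lra.
have b2 : 2 * P * m ^+ 2 <= c * m ^+ 5.
  have -> : c * m ^+ 5 = (c * m) * m ^+ 2 * m ^+ 2 by ring.
  apply: ler_wpM2r; first exact: sqr_ge0.
  have h1 : c * k <= c * m by apply: ler_wpM2l => //; exact: ltW.
  have h2 : c * k = c + 4 * P by rewrite /k; field; exact: lt0r_neq0.
  have h3 : c * m <= c * m * m ^+ 2.
    by apply: ler_peMr; [apply: mulr_ge0 => //; exact: ltW|exact: exprn_ege1].
  lra.
lra.
Qed.

Lemma costate_surj p : exists q, E q = p.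
Proof.
have [q hq] := value_pq_min p; exists q.
pose D := qsub (E q) p.
have [rr [L [rr0 HL]]] := costate_lip q.
have n0 : 0 <= enorm2 D := enorm2_ge0 D.
(* If [q] minimises [value + 2 * pq p] but [D <> 0], a small step in the direction
   [D] would decrease it. *)
pose h := Num.min (rr / (enorm2 D + 1)) (1 / (2 * (`|L| + 1))).
have L0 : 0 <= `|L| by [].
have h0 : 0 < h by rewrite lt_min !divr_gt0 // ?mulr_gt0 //; lra.
have hD : h * enorm2 D < rr.
  have : h * (enorm2 D + 1) <= rr by rewrite -ler_pdivlMr ?ge_min ?lexx //; lra.
  lra.
have hL : h * (2 * (`|L| + 1)) <= 1.
  by rewrite -ler_pdivlMr ?ge_min ?lexx ?orbT // mulr_gt0 //; lra.
pose qh : U * U := (vadd q.1 (vscale h D.1), vadd q.2 (vscale h D.2)).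
have dq : enorm2 (qsub qh q) = h * enorm2 D.
  rewrite -(ger0_norm (ltW h0)) -sqrtr_sqr /enorm2 -sqrtrM ?sqr_ge0 //; congr Num.sqrt.
  by rewrite /qh /qsub /dot /vadd /vscale /=; ring.
have eqq : enorm2 (qsub q q) < rr by rewrite qsubxx.
have eqh : enorm2 (qsub qh q) < rr by rewrite dq.
have lip := HL _ _ eqh eqq; rewrite dq in lip.
have h1 := value_subgrad qh q; have h2 := hq qh.
have g1 := en_ge0 (fun t => vsub (X q t) (X qh t)) 0 (T qh).
have e1 : pq (E qh) (qsub q qh) = - h * pq (E qh) D.
  by rewrite /pq /qh /qsub /dot /vadd /vscale /=; ring.
have e2 : pq p qh = pq p q + h * pq p D.
  by rewrite /pq /qh /dot /vadd /vscale /=; ring.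
(* Minimality at [q] is played against the subgradient at [qh]. Going back from [E qh] to [E q]
   costs at most half of [|D|^2] by the Lipschitz bound, and this forces [D = 0]. *)
have e3 : h * pq (E qh) D <= h * pq p D by rewrite e1 in h1; rewrite e2 in h2; lra.
rewrite ler_pM2l // in e3.
have e4 : enorm2 D ^+ 2 = pq (E q) D - pq p D.
  by rewrite enorm2_sqr /pq /D /qsub /dot /vadd /vscale /=; ring.
have := pq_abs (qsub (E qh) (E q)) D; rewrite ler_norml => /andP[e5 _].
have e6 : pq (qsub (E qh) (E q)) D = pq (E qh) D - pq (E q) D.
  by rewrite /pq /qsub /dot /vadd /vscale /=; ring.
have e7 := ler_wpM2r n0 lip.
have e8 : L * (h * enorm2 D) * enorm2 D <= enorm2 D ^+ 2 / 2.
  have -> : L * (h * enorm2 D) * enorm2 D = (L * h) * enorm2 D ^+ 2 by ring.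
  have -> : enorm2 D ^+ 2 / 2 = 2^-1 * enorm2 D ^+ 2 by rewrite mulrC.
  apply: ler_wpM2r; first exact: sqr_ge0.
  have := ler_wpM2r (ltW h0) (ler_norm L); lra.
have e9 : enorm2 D ^+ 2 <= 0 by rewrite e6 in e5; lra.
apply: qsub_eq0; apply: enorm2_eq0; rewrite -/D.
rewrite leNgt; apply/negP => D0; move: e9; rewrite leNgt => /negP; apply.
by rewrite exprn_gt0.
Qed.

Lemma costate_bij : bijective E.
Proof.
have [g hg] := choice costate_surj.
by exists g => q; [apply: costate_inj|]; rewrite hg.
Qed.

(** With acceleration bounded by [M], a motion at rest at time [T] has [|x| <= 2 M T^2] and
    [|y| <= 2 M T] at the start. *)
Lemma T_lower q : (1 + 2 * M)^-1 * mq q.1 q.2 <= T q.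
Proof.
have Mp := M0; have k0 : 0 < 1 + 2 * M by lra.
rewrite mulrC ler_pdivrMr //.
have t0 : 0 <= (0 : R) <= T q by rewrite lexx T0.
have [b1 b2 b3 b4] := dyn_bounds (traj_dyn Obnd (Xtraj q)) (T0 q) (@Tzero q) t0.
rewrite Xq in b1 b2; rewrite Yq in b3 b4.
have Tq := T0 q.
apply: mq_le; first by rewrite mulr_ge0 // ltW.
  apply: le_trans (enorm_bound b1 b2) _.
  have -> : 2 * (M * T q * T q) = 2 * M * T q ^+ 2 by ring.
  rewrite exprMn mulrC; apply: ler_wpM2l; first exact: sqr_ge0.
  have := sqr_ge0 M; rewrite sqrrD; nra.
apply: le_trans (enorm_bound b3 b4) _; nra.
Qed.

Lemma costate_upper q : Num.max (powR (enorm (E q).1) (3^-1)) (powR (enorm (E q).2) (4^-1))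
  <= (1 + 2 * M) * C * mq q.1 q.2.
Proof.
have Mp := M0; have k0 : 0 < 1 + 2 * M by lra.
have Tq := T0 q.
apply: (@le_trans _ _ ((1 + 2 * M) * T q)); last first.
  by rewrite -mulrA ler_pM2l //; exact: T_le_mq.
have kT : 0 <= (1 + 2 * M) * T q by rewrite mulr_ge0 // ltW.
have [pphi ppsi _] := Xadj q.
have zp := adj_zero r0 Obox Obnd (Xtraj q) (Xadj q) Tq (@Tzero q).
have bx t : 0 <= t <= T q -> `|(X q t).1| <= M * T q * T q /\ `|(X q t).2| <= M * T q * T q.
  by move=> tT; have [] := dyn_bounds (traj_dyn Obnd (Xtraj q)) Tq (@Tzero q) tT.
have t0 : 0 <= (0 : R) <= T q by rewrite lexx T0.
have [b1 b2 b3 b4] := adj_bounds (lX q) pphi ppsi Tq zp bx t0.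
have big n : (0 < n)%N -> 2 * M <= (1 + 2 * M) ^+ n.
  case: n => // n _; rewrite exprS.
  have h1 : 1 <= (1 + 2 * M) ^+ n by apply: exprn_ege1; lra.
  apply: (@le_trans _ _ ((1 + 2 * M) * 1)); first lra.
  by apply: ler_wpM2l => //; exact: ltW.
rewrite ge_max; apply/andP; split; apply: powR_root => //; try exact: enorm_ge0.
  apply: le_trans (enorm_bound b1 b2) _.
  have -> : 2 * (M * T q * T q * T q) = 2 * M * T q ^+ 3 by ring.
  by rewrite exprMn; apply: ler_wpM2r; [exact: exprn_ge0|exact: big].
apply: le_trans (enorm_bound b3 b4) _.
have -> : 2 * (M * T q * T q * T q * T q) = 2 * M * T q ^+ 4 by ring.
by rewrite exprMn; apply: ler_wpM2r; [exact: exprn_ge0|exact: big].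
Qed.

(** With [n] the gauge of the costate, the quintic lower bound on the value and [adj_energy] give
    [c m^5 <= n^4 m + n^3 m^2], so [n] cannot be small compared with [m]. *)
Lemma costate_lower : exists C3 : R, 0 < C3 /\ forall q, C3 * mq q.1 q.2 <=
  Num.max (powR (enorm (E q).1) (3^-1)) (powR (enorm (E q).2) (4^-1)).
Proof.
have [c [c0 hc]] := value_lb.
(* If [n < k * m], each of the two terms is below [k m^5 <= c m^5 / 2]; the bound [k <= 1] absorbs
   the powers of [k]. *)
pose k := Num.min 1 (c / 2).
have k0 : 0 < k by rewrite lt_min ltr01 divr_gt0.
have k1 : k <= 1 by rewrite ge_min lexx.
have kc : k <= c / 2 by rewrite ge_min lexx orbT.
exists k; split=> // q.
set m := mq _ _; have m0 : 0 <= m by exact: mq_ge0.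
set n := Num.max _ _.
have n0 : 0 <= n by rewrite le_max powR_ge0.
have p3 : enorm (E q).1 <= n ^+ 3.
  rewrite -[leLHS](@powR_rootK _ _ 2) ?enorm_ge0 // ler_pXn2r ?nnegrE ?powR_ge0 //.
  by rewrite le_max lexx.
have p4 : enorm (E q).2 <= n ^+ 4.
  rewrite -[leLHS](@powR_rootK _ _ 3) ?enorm_ge0 // ler_pXn2r ?nnegrE ?powR_ge0 //.
  by rewrite le_max lexx orbT.
have h := adj_energy r0 Obox Obnd (Xtraj q) (Xadj q) (T0 q) (@Tzero q) (lexx 0) (T0 q).
rewrite Xq Yq -/(value q) in h.
have h1 := le_trans (hc q) h; rewrite -/m in h1.
have opp v w : - dot v w <= enorm v * enorm w.
  have -> : - dot v w = dot v (vscale (-1) w) by rewrite /dot /vscale /=; ring.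
  apply: le_trans (dot_le _ _) _; rewrite (_ : enorm (vscale _ _) = enorm w) //.
  by rewrite /enorm /dot /vscale /= !mulN1r !mulrNN.
have f1 := mq_fst q.1 q.2; have f2 := mq_snd q.1 q.2; rewrite -/m in f1 f2.
have h2 : c * m ^+ 5 <= n ^+ 4 * m + n ^+ 3 * m ^+ 2.
  apply: le_trans h1 _; rewrite opprD; apply: lerD.
    apply: le_trans (opp _ _) _; apply: ler_pM => //; exact: enorm_ge0.
  apply: le_trans (opp _ _) _; apply: ler_pM => //; exact: enorm_ge0.
rewrite leNgt; apply/negP => nk.
have m1 : 0 < m.
  by rewrite lt_neqAle m0 andbT; apply/eqP => m00; move: nk; rewrite -m00 mulr0 ltNge n0.
have n3 : n ^+ 3 < k * m ^+ 3.
  apply: (@lt_le_trans _ _ ((k * m) ^+ 3)); first by rewrite ltr_pXn2r ?nnegrE ?mulr_ge0 // ltW.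
  rewrite exprMn; apply: ler_wpM2r; first exact: exprn_ge0.
  by rewrite exprS ger_pMr // expr_le1 // ltW.
have n4 : n ^+ 4 < k * m ^+ 4.
  apply: (@lt_le_trans _ _ ((k * m) ^+ 4)); first by rewrite ltr_pXn2r ?nnegrE ?mulr_ge0 // ltW.
  rewrite exprMn; apply: ler_wpM2r; first exact: exprn_ge0.
  by rewrite exprS ger_pMr // expr_le1 // ltW.
have a1 : n ^+ 4 * m < k * m ^+ 5.
  have -> : k * m ^+ 5 = k * m ^+ 4 * m by ring.
  by rewrite ltr_pM2r.
have a2 : n ^+ 3 * m ^+ 2 < k * m ^+ 5.
  have -> : k * m ^+ 5 = k * m ^+ 3 * m ^+ 2 by ring.
  by rewrite ltr_pM2r // exprn_gt0.
have a3 : k * m ^+ 5 <= c / 2 * m ^+ 5 by apply: ler_wpM2r => //; exact: exprn_ge0.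
lra.
Qed.

End Synthesis.

(** * Geometry of the control set and translation of the definitions *)

Section ControlSet.
Variable R : realType.
Notation U := (R * R)%type.
Implicit Types (x y u phi psi : R -> U) (a b v w p : U).
Variable O : set U.

Lemma interior_box : interior O (vzero R) -> exists r : R, 0 < r /\
  forall v, `|v.1| <= r -> `|v.2| <= r -> O v.
Proof.
move=> /nbhs_ballP[e /= e0 he]; exists (e / 2); split; first exact: divr_gt0.
move=> v h1 h2; apply: he; split; rewrite /ball /= sub0r normrN; lra.
Qed.

Lemma compact_bound : compact O -> O (vzero R) -> exists M : R,
  forall v, O v -> `|v.1| <= M /\ `|v.2| <= M.
Proof.
move=> cO O0.
have c1 : {within O, continuous (fun v : U => `|v.1|)}.
  apply: continuous_subspaceT => v; apply: cvg_norm; exact: cvg_fst.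
have c2 : {within O, continuous (fun v : U => `|v.2|)}.
  apply: continuous_subspaceT => v; apply: cvg_norm; exact: cvg_snd.
have On : O !=set0 by exists (vzero R).
have [a _ ha] := compact_EVT_max On cO c1.
have [b _ hb] := compact_EVT_max On cO c2.
exists (Num.max `|a.1| `|b.2|) => v Ov; rewrite !le_max.
by rewrite ha ?inE // hb ?inE ?orbT.
Qed.

Lemma convex_setE : convex_set O -> forall v w (l : R), O v -> O w -> 0 <= l <= 1 ->
  O (vadd (vscale l v) (vscale (1 - l) w)).
Proof.
move=> cO v w l Ov Ow /andP[l0 l1].
have := cO v w (Itv01 l0 l1); rewrite !inE => /(_ Ov Ow).
exact: id.
Qed.

(** Let [c] be the point of [O] nearest to [v]. Moving from [c] towards a point [w] of [O] cannot
    decrease the distance to [v], so [v - c] is the normal of a separating line through [c]. *)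
Lemma convex_sep : compact O -> O (vzero R) ->
  (forall v w (l : R), O v -> O w -> 0 <= l <= 1 -> O (vadd (vscale l v) (vscale (1 - l) w))) ->
  forall v, ~ O v -> exists p (h : R), (forall w, O w -> dot p w <= h) /\ h < dot p v.
Proof.
move=> cO O0 conv v nOv.
have cf : {within O, continuous (fun w : U => (w.1 - v.1) * (w.1 - v.1) + (w.2 - v.2) * (w.2 - v.2))}.
  apply: continuous_subspaceT => w.
  have f1 : (fun z : U => z.1) @ w --> w.1 by exact: cvg_fst.
  have f2 : (fun z : U => z.2) @ w --> w.2 by exact: cvg_snd.
  by apply: cvgD; apply: cvgM; apply: cvgB => //; exact: cvg_cst.
have On : O !=set0 by exists (vzero R).
have [c Oc hc] := compact_EVT_min On cO cf; rewrite inE in Oc.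
have {}hc w : O w -> dot (vsub c v) (vsub c v) <= dot (vsub w v) (vsub w v).
  by move=> Ow; rewrite !vsubE /dot /=; apply: hc; rewrite inE.
pose p := vsub v c; exists p, (dot p c); split.
  move=> w Ow; rewrite -subr_le0; set k := dot p w - dot p c.
  pose n := dot (vsub w c) (vsub w c).
  have n0 : 0 <= n by exact: dot_ge0.
  have key (l : R) : 0 < l -> l <= 1 -> 2 * k <= l * n.
    move=> l0 l1; have Om : O (vadd (vscale l w) (vscale (1 - l) c)).
      by apply: conv => //; rewrite ltW.
    have := hc _ Om; rewrite -subr_ge0.
    have -> : dot (vsub (vadd (vscale l w) (vscale (1 - l) c)) v)
        (vsub (vadd (vscale l w) (vscale (1 - l) c)) v) - dot (vsub c v) (vsub c v) =
        l * (l * n - 2 * k).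
      by rewrite /k /n /p !vsubE /dot /vadd /vscale /=; ring.
    by rewrite pmulr_rge0 // subr_ge0.
  rewrite leNgt; apply/negP => k0.
  pose l := Num.min 1 (k / (n + 1)).
  have l0 : 0 < l by rewrite lt_min ltr01 divr_gt0 //; lra.
  have ln : l * (n + 1) <= k by rewrite -ler_pdivlMr ?ge_min ?lexx ?orbT //; lra.
  have := key l l0; rewrite ge_min lexx => /(_ isT); lra.
rewrite -subr_gt0.
have -> : dot p v - dot p c = dot p p by rewrite /p !vsubE /dot /=; ring.
rewrite lt_neqAle dot_ge0 andbT; apply/eqP => e; apply: nOv.
have : p = vzero R by apply: enorm_eq0; apply: le_enorm => //; rewrite -e expr0n.
by move=> /vsub_eq0 ->.
Qed.

Lemma admissibleE (M : R) x y u (x0 y0 : U) :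
  (forall v, O v -> `|v.1| <= M /\ `|v.2| <= M) ->
  admissible O x0 y0 x y u <-> start O x y u x0 y0.
Proof.
move=> hM; split.
  move=> [m1 m2 Ou hx hy].
  have v0 (f : R -> U) : vint f 0 = vzero R by rewrite /vint !itgE !itgxx.
  have add0 v : vadd v (vzero R) = v by rewrite /vadd /= !addr0 -surjective_pairing.
  have x00 : x 0 = x0 by rewrite (hx 0) // v0 add0.
  have y00 : y 0 = y0 by rewrite (hy 0) // v0 add0.
  split=> //; split=> //.
  - by split; split=> // b; exists M => s /andP[s0 _]; have [] := hM _ (Ou s s0).
  - by split=> t t0; rewrite (hy t t0) y00.
  - by split=> t t0; rewrite (hx t t0) x00.
move=> [[[[m1 _] [m2 _]] Ou [py1 py2] [px1 px2]] x00 y00]; split=> //.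
- move=> t t0; rewrite (surjective_pairing (x t)) -x00 /vadd /vint /= !itgE.
  by congr pair; [exact: px1|exact: px2].
- move=> t t0; rewrite (surjective_pairing (y t)) -y00 /vadd /vint /= !itgE.
  by congr pair; [exact: py1|exact: py2].
Qed.

Lemma cost_bdd x c : vlbm x -> (cost x <= (2^-1 * c)%:E)%E <-> bdd x c.
Proof.
move=> lx; have [h1 h2] := itg_ybound c (lbm_dot lx lx) (fun t => dot_ge0 (x t)).
rewrite /cost EFinM; split=> h.
  by apply: h1; rewrite lee_pmul2l in h.
by apply: lee_wpmul2l; [rewrite lee_fin|exact: h2].
Qed.

Lemma optimalE (M : R) x y u (x0 y0 : U) :
  (forall v, O v -> `|v.1| <= M /\ `|v.2| <= M) ->
  optimal O x0 y0 x y u <-> opt O x y u x0 y0.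
Proof.
move=> hM; split=> -[ad op].
  have st := (admissibleE x y u x0 y0 hM).1 ad; split=> // x' y' u' c st' b'.
  have [tr _ _] := st; have [tr' _ _] := st'.
  have [lx _ _] := traj_vlbm hM tr; have [lx' _ _] := traj_vlbm hM tr'.
  apply/(cost_bdd c lx); apply: le_trans (op _ _ _ ((admissibleE x' y' u' x0 y0 hM).2 st')) _.
  exact/(cost_bdd c lx').
split; first exact/(admissibleE x y u x0 y0 hM).
move=> x' y' u' /(admissibleE x' y' u' x0 y0 hM) st'.
have [tr _ _] := ad; have [tr' _ _] := st'.
have [lx _ _] := traj_vlbm hM tr; have [lx' _ _] := traj_vlbm hM tr'.
have c0 : (0 <= cost x')%E.
  apply: mule_ge0; first by rewrite lee_fin.
  by apply: integral_ge0 => t _; rewrite lee_fin dot_ge0.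
(* An infinite cost makes the comparison trivial; a finite cost [c] is the energy bound [2 * c]. *)
move: c0; case E : (cost x') => [c| |] // _; last by rewrite leey.
have -> : c = 2^-1 * (2 * c) by rewrite mulrA mulVf ?mul1r // pnatr_eq0.
apply/(cost_bdd _ lx); apply: (op x' y' u') => //; apply/(cost_bdd _ lx').
by rewrite E lee_fin mulrA mulVf ?mul1r // pnatr_eq0.
Qed.

Lemma adjointE x u phi psi : vlbm x -> adjoint O x u phi psi <-> adj O x u phi psi.
Proof.
move=> lx; split=> -[h1 h2 ae].
  have pphi : vprim phi x by split=> t t0; rewrite (h1 t t0).
  have [l1 l2] := vlbm_prim pphi lx.
  split=> //; split=> t t0; rewrite (h2 t t0) /vadd /vscale /= !itgE.
    by rewrite itgZ.
  by rewrite itgZ.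
have [l1 l2] := vlbm_prim h1 lx; case: h1 h2 => p1 p2 [q1 q2].
split=> // t t0.
  rewrite (surjective_pairing (phi t)) /vadd /vint /= !itgE.
  by congr pair; [exact: p1|exact: p2].
rewrite (surjective_pairing (psi t)) /vadd /vint /vscale /= !itgE -!itgZ //.
by congr pair; [exact: q1|exact: q2].
Qed.

End ControlSet.

Theorem theorem1 (R : realType) (O : set (R * R)) :
  convex_set O -> compact O -> interior O (vzero R) ->
  (* 1. existence and uniqueness of the optimal trajectory and of the adjoint *)
  (forall x0 y0 : R * R,
    (exists x y u : R -> R * R, optimal O x0 y0 x y u) /\
    (forall x y u x' y' u' : R -> R * R,
       optimal O x0 y0 x y u -> optimal O x0 y0 x' y' u' ->
       forall t, 0 <= t -> x' t = x t /\ y' t = y t) /\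
    (forall x y u : R -> R * R, optimal O x0 y0 x y u ->
       (exists phi psi : R -> R * R, adjoint O x u phi psi) /\
       (forall phi psi phi' psi' : R -> R * R,
          adjoint O x u phi psi -> adjoint O x u phi' psi' ->
          forall t, 0 <= t -> phi' t = phi t /\ psi' t = psi t))) /\
  (* 2. finite hitting time T(q0) *)
  (exists T : (R * R) * (R * R) -> R,
     continuous T /\
     exists C1 C2 : R, 0 < C1 /\ 0 < C2 /\
     forall x0 y0 : R * R,
       0 <= T (x0, y0) /\
       C1 * Num.max (Num.sqrt (enorm x0)) (enorm y0) <= T (x0, y0) /\
       T (x0, y0) <= C2 * Num.max (Num.sqrt (enorm x0)) (enorm y0) /\
       (forall x y u phi psi : R -> R * R,
          optimal O x0 y0 x y u -> adjoint O x u phi psi ->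
          forall t, 0 <= t ->
            (T (x0, y0) <= t ->
               [/\ x t = vzero R, y t = vzero R, phi t = vzero R & psi t = vzero R]) /\
            (t < T (x0, y0) ->
               (x t, y t) <> (vzero R, vzero R) /\
               (phi t, psi t) <> (vzero R, vzero R)))) /\
  (* 3. the map E : q0 |-> p(0, q0) *)
  (exists E : (R * R) * (R * R) -> (R * R) * (R * R),
     locally_lipschitz E /\ bijective E /\
     (forall (x0 y0 : R * R) (x y u phi psi : R -> R * R),
        optimal O x0 y0 x y u -> adjoint O x u phi psi ->
        E (x0, y0) = (phi 0, psi 0)) /\
     exists C3 C4 : R, 0 < C3 /\ 0 < C4 /\
     forall x0 y0 : R * R,
       C3 * Num.max (Num.sqrt (enorm x0)) (enorm y0)
         <= Num.max (powR (enorm (E (x0, y0)).1) (3^-1))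
                    (powR (enorm (E (x0, y0)).2) (4^-1)) /\
       Num.max (powR (enorm (E (x0, y0)).1) (3^-1))
               (powR (enorm (E (x0, y0)).2) (4^-1))
         <= C4 * Num.max (Num.sqrt (enorm x0)) (enorm y0)).
Proof.
move=> cvx cO iO.
have [r [r0 Obox]] := interior_box iO.
have O0 : O (vzero R) by apply: Obox; rewrite normr0 ltW.
have [M Obnd] := compact_bound cO O0.
have Oconv := convex_setE cvx.
have Osep := convex_sep cO O0 Oconv.
have M0 := bound_gt0 r0 Obox Obnd.
have [C [C0 fin]] := finite_time r0 Obox Obnd.
have vl x y u x0 y0 : opt O x y u x0 y0 -> vlbm x.
  by move=> [[tr _ _] _]; have [] := traj_vlbm Obnd tr.
(* One optimal motion with its adjoint and rest time is fixed for every start. By uniqueness, what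
   holds for the chosen data holds for any optimal triple and any adjoint. *)
have ex (q : (R * R) * (R * R)) : exists s : (R -> R * R) * (R -> R * R) * (R -> R * R) *
    (R -> R * R) * (R -> R * R) * R, let: (x, y, u, phi, psi, T) := s in
    [/\ opt O x y u q.1 q.2, adj O x u phi psi, 0 <= T &
      [/\ zero_from x y T, (forall t, 0 <= t -> t < T -> ~ (x t = vzero R /\ y t = vzero R)) &
       forall s, 0 <= s -> T <= s + C * mq (x s) (y s)]].
  have [x [y [u op]]] := opt_exists r0 Obox Obnd Oconv Osep q.1 q.2.
  have [[tr _ _] _] := op; have [lx ly lu] := traj_vlbm Obnd tr; have [_ _ py px] := tr.
  have [T [T0 z nz le]] := hitting lx ly lu px py (fin _ _ _ _ _ op) C0.
  have [phi [psi ad]] := adj_exists r0 Obox Obnd Oconv op T0 z.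
  by exists (x, y, u, phi, psi, T).
have [S hS] := choice ex.
pose X q := (S q).1.1.1.1.1; pose Y q := (S q).1.1.1.1.2; pose V q := (S q).1.1.1.2.
pose Phi q := (S q).1.1.2; pose Psi q := (S q).1.2; pose T q := (S q).2.
have {}hS q : [/\ opt O (X q) (Y q) (V q) q.1 q.2, adj O (X q) (V q) (Phi q) (Psi q), 0 <= T q &
    [/\ zero_from (X q) (Y q) (T q),
      (forall t, 0 <= t -> t < T q -> ~ (X q t = vzero R /\ Y q t = vzero R)) &
      forall s, 0 <= s -> T q <= s + C * mq (X q s) (Y q s)]].
  by have := hS q; rewrite /X /Y /V /Phi /Psi /T; case: (S q) => [[[[[]]]]].
have Xopt q : opt O (X q) (Y q) (V q) q.1 q.2 by have [] := hS q.
have Xtraj q : traj O (X q) (Y q) (V q) by have [[]] := Xopt q.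
have X0 q : (X q 0, Y q 0) = q by have [[_ -> ->] _] := Xopt q; case: q.
have Xadj q : adj O (X q) (V q) (Phi q) (Psi q) by have [] := hS q.
have T0 q : 0 <= T q by have [] := hS q.
have Tzero q : zero_from (X q) (Y q) (T q) by have [_ _ _ []] := hS q.
have Tle q (s : R) : 0 <= s -> T q <= s + C * mq (X q s) (Y q s).
  by have [_ _ _ [_ _ h]] := hS q; apply: h.
have Tnz q (t : R) : 0 <= t -> t < T q -> ~ (X q t = vzero R /\ Y q t = vzero R).
  by have [_ _ _ [_ h _]] := hS q; apply: h.
have uniq x y u x0 y0 : opt O x y u x0 y0 ->
    forall t, 0 <= t -> x t = X (x0, y0) t /\ y t = Y (x0, y0) t.
  by move=> op t t0; apply: (opt_unique r0 Obox Obnd Oconv Osep op (Xopt (x0, y0))).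
have zero x y u x0 y0 : opt O x y u x0 y0 -> zero_from x y (T (x0, y0)).
  move=> op t Tt; have [-> ->] := uniq _ _ _ _ _ op _ (le_trans (T0 _) Tt); exact: Tzero.
have trj x y u x0 y0 : opt O x y u x0 y0 -> traj O x y u by case=> [[]].
have adjE x y u x0 y0 phi psi : opt O x y u x0 y0 -> adjoint O x u phi psi -> adj O x u phi psi.
  by move=> /vl lx /(adjointE _ _ _ _ lx).
split; [move=> x0 y0; split; [|split]|split].
- have [x [y [u op]]] := opt_exists r0 Obox Obnd Oconv Osep x0 y0.
  by exists x, y, u; apply/optimalE; first exact: Obnd.
- move=> x y u x' y' u' /(optimalE _ _ _ _ _ Obnd) op /(optimalE _ _ _ _ _ Obnd) op' t t0.
  exact: (opt_unique r0 Obox Obnd Oconv Osep op' op).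
- move=> x y u /(optimalE _ _ _ _ _ Obnd) op; split.
    have [phi [psi ad]] := adj_exists r0 Obox Obnd Oconv op (T0 _) (zero _ _ _ _ _ op).
    by exists phi, psi; apply/(adjointE _ _ _ _ (vl _ _ _ _ _ op)).
  move=> phi psi phi' psi' /(adjE _ _ _ _ _ _ _ op) a1 /(adjE _ _ _ _ _ _ _ op) a2 t t0.
  have tr := trj _ _ _ _ _ op; have z := zero _ _ _ _ _ op.
  exact: (adj_unique r0 Obox Obnd tr a2 tr a1 (fun t _ => erefl) (T0 _) z z t0).
- exists T; split; first exact: (T_cont r0 Obox Obnd Xtraj X0 Xadj T0 Tzero C0 Tle).
  exists (1 + 2 * M)^-1, C; split; first by rewrite invr_gt0; lra.
  split=> // x0 y0; split; first exact: T0.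
  split; first exact: (T_lower r0 Obox Obnd Xtraj X0 T0 Tzero (x0, y0)).
  split; first exact: (T_le_mq X0 Tle (x0, y0)).
  move=> x y u phi psi /(optimalE _ _ _ _ _ Obnd) op /(adjE _ _ _ _ _ _ _ op) ad t t0.
  have tr := trj _ _ _ _ _ op; have z := zero _ _ _ _ _ op; split=> [Tt|tT].
    by have [-> ->] := z t Tt; have [-> ->] := adj_zero r0 Obox Obnd tr ad (T0 _) z Tt.
  have nz : ~ (x t = vzero R /\ y t = vzero R).
    have [-> ->] := uniq _ _ _ _ _ op t t0; exact: Tnz.
  split=> -[e1 e2]; apply: nz => //.
  exact: (adj_nonzero r0 Obox Obnd tr ad (T0 _) z t0 e1 e2).
- exists (costate0 Phi Psi).
  split; first exact: (costate_lip r0 Obox Obnd Xtraj X0 Xadj T0 Tzero C0 Tle).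
  split; first exact: (costate_bij r0 Obox Obnd Xtraj X0 Xadj T0 Tzero C0 Tle).
  split.
    move=> x0 y0 x y u phi psi /(optimalE _ _ _ _ _ Obnd) op /(adjE _ _ _ _ _ _ _ op) ad.
    have tr := trj _ _ _ _ _ op; have z := zero _ _ _ _ _ op.
    have xx t : 0 <= t -> x t = X (x0, y0) t by move=> /(uniq _ _ _ _ _ op)[].
    by have [-> ->] := adj_unique r0 Obox Obnd tr ad (Xtraj _) (Xadj _) xx (T0 _) z (Tzero _) (lexx 0).
  have [C3 [C30 lo]] := costate_lower r0 Obox Obnd Xtraj X0 Xadj T0 Tzero.
  exists C3, ((1 + 2 * M) * C); split=> //; split; first by rewrite mulr_gt0 //; lra.
  move=> x0 y0; split; first exact: (lo (x0, y0)).
  exact: (costate_upper r0 Obox Obnd Xtraj X0 Xadj T0 Tzero Tle (x0, y0)).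
Qed.
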